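(* Let $d\ge1$, $\alpha\in[-1/2,\infty)^d$, $\sigma>0$, $1\le p\le\infty$, $1\le q\le\infty$, and assume that $(p,q)$ satisfies one of the following: (a) $\sigma>d/2$ ($p,q$ arbitrary); (b) $\sigma=d/2$ and $(p,q)\ne(\infty,1)$, $(p,q)\neq(1,\infty)$; (c) $0<\sigma<d/2$, $\frac1p-\frac{2\sigma}{d}\le\frac1q<\frac1p+\frac{2\sigma}{d}$, and $(p,q)\neq\big(1,\frac{d}{d-2\sigma}\big)$, $(p,q)\ne\big(\frac{d}{2\sigma},\infty\big)$. Then there is a constant $C$ such that $$\|\mathcal{I}_H^{\alpha,\sigma}f\|_{L^q(\mathbb{R}^d_+)}\le C\|f\|_{L^p(\mathbb{R}^d_+)},\qquad f\in L^p(\mathbb{R}^d_+).$$ Moreover, for each such pair $(p,q)$ with $p<\infty$ and for every $k\in\mathbb{N}^d$, $$\langle\mathcal{I}_H^{\alpha,\sigma}f,\varphi_k^\alpha\rangle=(4|k|+2|\alpha|+2d)^{-\sigma}\langle f,\varphi_k^\alpha\rangle,\qquad f\in L^p(\mathbb{R}^d_+).$$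
   Context: $\mathbb{R}^d_+=(0,\infty)^d$ with Lebesgue measure, $\mathbb{N}=\{0,1,\ldots\}$, $|k|=\sum k_i$, $|\alpha|=\sum\alpha_i$ (possibly negative), $1/\infty=0$, and $\langle f,g\rangle=\int_{\mathbb{R}^d_+}f\overline{g}\,dx$ whenever it makes sense. For $\alpha\in(-1,\infty)^d$ and $k\in\mathbb{N}^d$, the Laguerre functions of Hermite type are $\varphi_k^\alpha(x)=\prod_{i=1}^d\varphi_{k_i}^{\alpha_i}(x_i)$, $x\in\mathbb{R}^d_+$, where $$\varphi_{k_i}^{\alpha_i}(x_i)=\Big(\frac{2\Gamma(k_i+1)}{\Gamma(k_i+\alpha_i+1)}\Big)^{1/2}L_{k_i}^{\alpha_i}(x_i^2)\,x_i^{\alpha_i+1/2}e^{-x_i^2/2}$$ and $L_{m}^{\nu}$ is the Laguerre polynomial of degree $m$ and order $\nu$. They form an orthonormal basis of $L^2(\mathbb{R}^d_+)$. Define the heat kernel, the potential kernel and the potential operator by $$G_t^{\alpha,H}(x,y)=\sum_{k\in\mathbb{N}^d}e^{-t(4|k|+2|\alpha|+2d)}\varphi_k^\alpha(x)\varphi_k^\alpha(y),\qquad \mathcal{K}_H^{\alpha,\sigma}(x,y)=\frac1{\Gamma(\sigma)}\int_0^\infty G_t^{\alpha,H}(x,y)t^{\sigma-1}\,dt,$$ $$\mathcal{I}_H^{\alpha,\sigma}f(x)=\int_{\mathbb{R}^d_+}\mathcal{K}_H^{\alpha,\sigma}(x,y)f(y)\,dy,$$ the last one on the natural domain of functions $f$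 for which the integral converges for a.e. $x\in\mathbb{R}^d_+$. *)

(* Defs.v *)
From HB Require Import structures.
From mathcomp Require Import all_boot all_order all_algebra.
From mathcomp Require Import all_classical all_reals all_analysis.
From mathcomp Require Import complex.

Set Implicit Arguments.
Unset Strict Implicit.
Unset Printing Implicit Defensive.

Import Order.TTheory GRing.Theory Num.Theory.
Import numFieldNormedType.Exports.

Local Open Scope classical_set_scope.
Local Open Scope ring_scope.
Local Open Scope complex_scope.

Section pushforward_cons.
Context d (T : measurableType d) (R : realType) (n : nat).
Variables (m1 : {sigma_finite_measure set T -> \bar R})
          (m2 : {sigma_finite_measure set (n.-tuple T) -> \bar R}).

Definition tcons (z : T * n.-tuple T) : n.+1.-tuple T :=
  [the n.+1.-tuple T of z.1 :: z.2].

Lemma measurable_tcons : measurable_fun [set: T * n.-tuple T] tcons.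
Proof. by apply: measurable_cons. Qed.

Definition cons_measure : set (n.+1.-tuple T) -> \bar R :=
  pushforward (m1 \x m2)%E tcons.

Let cons_measure0 : cons_measure set0 = 0%E.
Proof. by rewrite /cons_measure /pushforward preimage_set0 measure0. Qed.

Let cons_measure_ge0 A : (0 <= cons_measure A)%E.
Proof. by rewrite /cons_measure /pushforward; exact: integral_ge0. Qed.

Let cons_measure_additive : semi_sigma_additive cons_measure.
Proof.
move=> F mF tF mUF; rewrite /cons_measure /pushforward preimage_bigcup.
apply: measure_semi_sigma_additive.
- by move=> n'; rewrite -[X in measurable X]setTI; exact: measurable_tcons.
- apply/trivIsetP => /= i j _ _ ij; rewrite -preimage_setI.
  by move/trivIsetP : tF => /(_ _ _ _ _ ij) ->//; rewrite preimage_set0.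
- by rewrite -preimage_bigcup -[X in measurable X]setTI; exact: measurable_tcons.
Qed.

HB.instance Definition _ := isMeasure.Build _ _ _ cons_measure
  cons_measure0 cons_measure_ge0 cons_measure_additive.

Let cons_measure_sigma_finite : sigma_finite setT cons_measure.
Proof.
have /sigma_finiteP[F [FT ndF Ffin]] := sigma_finiteT m1.
have /sigma_finiteP[G [GT ndG Gfin]] := sigma_finiteT m2.
pose hd (t : n.+1.-tuple T) := thead t.
pose tl (t : n.+1.-tuple T) : n.-tuple T := [tuple of behead t].
have mhd : measurable_fun setT hd by exact: measurable_tnth.
have mtl : measurable_fun setT tl by exact: measurable_behead.
exists (fun i : nat => hd @^-1` F i `&` tl @^-1` G i).
  apply/seteqP; split => // t _.
  have [i _ Fi] : (\bigcup_i F i) (hd t) by rewrite -FT.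
  have [j _ Gj] : (\bigcup_i G i) (tl t) by rewrite -GT.
  exists (maxn i j) => //; split => /=.
    by move: Fi; exact/subsetPset/ndF/leq_maxl.
  by move: Gj; exact/subsetPset/ndG/leq_maxr.
move=> i; have [mF Foo] := Ffin i; have [mG Goo] := Gfin i; split.
  by apply: measurableI; rewrite -[X in measurable X]setTI; [exact: mhd|exact: mtl].
rewrite /cons_measure /pushforward.
have tlK z : tl (tcons z) = z.2 by case: z => a b; apply/val_inj.
rewrite (_ : _ @^-1` _ = F i `*` G i); last first.
  by apply/seteqP; split => z /=; rewrite tlK.
by rewrite product_measure1E// lte_mul_pinfty// ge0_fin_numE.
Qed.

HB.instance Definition _ := Measure_isSigmaFinite.Build _ _ _ cons_measure
  cons_measure_sigma_finite.

End pushforward_cons.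

(* The Lebesgue measure of R^n, as the n-fold product of [lebesgue_measure]. *)
Fixpoint lebesgueN (R : realType) (n : nat) :
    {sigma_finite_measure set (n.-tuple (measurableTypeR R)) -> \bar R} :=
  match n with
  | 0 => \d_([tuple] : 0.-tuple (measurableTypeR R))
  | m.+1 => cons_measure (@lebesgue_measure R) (lebesgueN R m)
  end.

Lemma lebesgueN_box (R : realType) (n : nat)
    (A : 'I_n -> set (measurableTypeR R)) : (forall i, measurable (A i)) ->
  lebesgueN R n [set x | forall i, A i (tnth x i)] =
    (\prod_(i < n) lebesgue_measure (A i))%E.
Proof.
elim: n A => [|n IHn] A mA.
  rewrite big_ord0 /= /dirac indicE mem_set//=.
  by case.
rewrite big_ord_recl /= -IHn// -product_measure1E//; last first.
  rewrite (_ : mkset _ = \bigcap_(i in [set: 'I_n])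
      ((fun x : n.-tuple _ => tnth x i) @^-1` A (lift ord0 i))).
    apply: fin_bigcap_measurable => // i _.
    by rewrite -[X in measurable X]setTI; exact: measurable_tnth.
  by apply/seteqP; split => x /= h; [move=> i _|move=> i]; exact: h.
rewrite /cons_measure /pushforward; congr product_measure1.
apply/seteqP; split => -[a b] /=.
  by move=> h; split; [have := h ord0; rewrite tnth0|move=> i; have := h (lift ord0 i); rewrite tnthS].
move=> [h0 h] i; case: (unliftP ord0 i) => [j|] ->; last by rewrite tnth0.
by rewrite tnthS; exact: h.
Qed.

(* R^d is [d.-tuple (measurableTypeR R)], and functions on R^d_+ are total
   functions whose values off [orthant d] are never used. *)
Definition orthant (R : realType) (d : nat) :
    set (d.-tuple (measurableTypeR R)) :=
  [set x | forall i, 0 < tnth x i].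

Definition Gamma (R : realType) (s : R) : R :=
  Rintegral (@lebesgue_measure R) `]0, +oo[ (fun t => t `^ (s - 1) * expR (- t)).

(* L_m^nu = \sum_(i <= m) (-1)^i binom(m + nu, m - i) X^i / i!, where
   binom(m + nu, m - i) = (nu + i + 1) ... (nu + m) / (m - i)!. *)
Definition laguerre (R : realType) (nu : R) (m : nat) : {poly R} :=
  \poly_(i < m.+1)
    ((-1) ^+ i * (\prod_(i.+1 <= j < m.+1) (nu + j%:R)) /
       ((m - i)`! * i`!)%N%:R).

Definition phi1 (R : realType) (a : R) (k : nat) (u : R) : R :=
  Num.sqrt (2 * Gamma (k%:R + 1) / Gamma (k%:R + a + 1)) *
    (laguerre a k).[u ^+ 2] * u `^ (a + 1 / 2) * expR (- (u ^+ 2 / 2)).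

Section laguerre_operators.
Context (R : realType) (d : nat).
Implicit Types (alpha : 'I_d -> R) (k : 'I_d -> nat)
  (x y : d.-tuple (measurableTypeR R)) (p : \bar R)
  (f g : d.-tuple (measurableTypeR R) -> R[i]).

Definition phi alpha k x : R :=
  \prod_(i < d) phi1 (alpha i) (k i) (tnth x i).

Definition laguerre_eigenvalue alpha k : R :=
  4 * (\sum_(i < d) k i)%N%:R + 2 * \sum_(i < d) alpha i + 2 * d%:R.

(* The multiple series over N^d converges absolutely for t > 0; its sum is
   taken along the boxes {0, ..., n - 1}^d. *)
Definition heat_kernel alpha (t : R) x y : R :=
  limn (fun n : nat => \sum_(k : {ffun 'I_d -> 'I_n})
    expR (- (t * laguerre_eigenvalue alpha (fun i => k i : nat))) *
    phi alpha (fun i => k i : nat) x * phi alpha (fun i => k i : nat) y).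

(* Extended-real valued: the kernel may be +oo on the diagonal. *)
Definition potential_kernel alpha (sigma : R) x y : \bar R :=
  ((Gamma sigma)^-1%:E *
    \int[@lebesgue_measure R]_(t in `]0%R, +oo[)
      (heat_kernel alpha t x y * t `^ (sigma - 1))%:E)%E.

(* Natural domain: the complex-valued integrand is integrable for a.e. x. *)
Definition potential_dom alpha (sigma : R) f : Prop :=
  {ae lebesgueN R d, forall x, orthant x ->
    (lebesgueN R d).-integrable (@orthant R d)
      (fun y => potential_kernel alpha sigma x y * (complex.Re (f y))%:E)%E /\
    (lebesgueN R d).-integrable (@orthant R d)
      (fun y => potential_kernel alpha sigma x y * (complex.Im (f y))%:E)%E}.

Definition potential alpha (sigma : R) f x : R[i] :=
  fine (\int[lebesgueN R d]_(y in @orthant R d)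
    (potential_kernel alpha sigma x y * (complex.Re (f y))%:E))%E +i*
  fine (\int[lebesgueN R d]_(y in @orthant R d)
    (potential_kernel alpha sigma x y * (complex.Im (f y))%:E))%E.

(* The L^p(R^d_+) norm of f is the L^p(R^d) norm of |f| extended by 0. *)
Definition norm_Lp p f : \bar R :=
  Lnorm (lebesgueN R d) p ((fun x => (Normc.normc (f x))%:E) \_ (@orthant R d)).

Definition in_Lp p f : Prop :=
  [/\ measurable_fun (@orthant R d) (fun x => complex.Re (f x)),
      measurable_fun (@orthant R d) (fun x => complex.Im (f x)) &
      (norm_Lp p f < +oo)%E].

Definition pairing_dom f g : Prop :=
  (lebesgueN R d).-integrable (@orthant R d)
    (fun x => (complex.Re (f x * (g x)^*))%:E) /\
  (lebesgueN R d).-integrable (@orthant R d)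
    (fun x => (complex.Im (f x * (g x)^*))%:E).

Definition pairing f g : R[i] :=
  Rintegral (lebesgueN R d) (@orthant R d)
    (fun x => complex.Re (f x * (g x)^*)) +i*
  Rintegral (lebesgueN R d) (@orthant R d)
    (fun x => complex.Im (f x * (g x)^*)).

Definition phiC alpha k : d.-tuple (measurableTypeR R) -> R[i] :=
  fun x => (phi alpha k x)%:C.

End laguerre_operators.

(* Main.v *)
(* The heat kernel is a product of one-dimensional kernels, which the Hille-Hardy
   formula expresses through the Bessel series; for alpha >= -1/2 this yields a
   Gaussian bound. Hence, for some A, the kernel G_t is at most
   A t^(-d/2) e^(-t/2), has masses at most A e^(-t/2) in each variable, and total
   mass at most A t^(-d/2) e^(-t/2) on the product of two orthants.

   By duality, boundedness from L^p to L^q amounts to bounding the integral of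
   K(x, y) F(y)^P H(x)^r over all F, H >= 0 of mass at most 1, where P = 1/p and
   r = 1 - 1/q. At fixed t, weighted AM-GM bounds the corresponding integral for
   G_t by a multiple of t^(-(d/2) |P + r - 1|) e^(-t/2), which is integrable
   against t^(sigma - 1) as soon as (d/2) |P + r - 1| < sigma. The only other
   admissible case is P + r = 1 + 2 sigma/d; there one separates H(x) <= F(y) from
   its complement, and each part is estimated by truncating one density at the
   level of the other.

   Since the phi_k are orthonormal, integrating G_t against phi_k multiplies it by
   e^(-t lambda_k). As phi_k is bounded and integrable, one density H
   satisfies |phi_k| <= M H^r for every r in [0, 1], so the same estimate justifies
   Fubini's theorem in the pairing of the potential of f with phi_k. *)

Require Import Defs.
From mathcomp Require Import all_boot all_order all_algebra.
From mathcomp Require Import all_classical all_reals all_analysis.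
From mathcomp Require Import measurable_realfun ess_sup_inf complex ring lra zify.

Set Implicit Arguments.
Unset Strict Implicit.
Unset Printing Implicit Defensive.

Import Order.TTheory GRing.Theory Num.Theory.
Import numFieldNormedType.Exports.

Local Open Scope classical_set_scope.
Local Open Scope ring_scope.

(** * Rising factorials and Laguerre polynomials *)

(** The condition alpha_i >= -1/2 makes the exponent of z^(a + 1/2) nonnegative in the
    one-dimensional kernel, so that the bound by e^z holds down to z = 0 and no singularity at the
    boundary of the orthant remains. The factor e^z then completes the square in the exponent,
    leaving a Gaussian in u - v and a Gaussian in u + v. The former controls the mass in one
    variable. The latter expresses the confinement by the quadratic potential and makes the mass on
    the product of two orthants finite; a translation-invariant kernel has no such finite mass, and
    this is what admits q < p.

    In the bilinear form the exponents occur only as P and r in [0, 1], with 0^0 = 1, so that values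
    1 and infinity of p and q are not special there. On the critical line P + r = 1 + 2 sigma/d the
    bound at fixed t is of order t^(-sigma) and its time integral diverges logarithmically at 0;
    hence the truncation has to be made before integrating in t. The two ends of this line are the
    pairs excluded in case (c). *)

Lemma eqW disp (T : porderType disp) (x y : T) : x = y -> (x <= y)%O.
Proof. by move->. Qed.

Section rising.
Context {A : comNzRingType}.
Implicit Types s : A.

Definition rising s n : A := \prod_(j < n) (s + j%:R).

Lemma rising0 s : rising s 0 = 1.
Proof. exact: big_ord0. Qed.

Lemma risingSr s n : rising s n.+1 = rising s n * (s + n%:R).
Proof. by rewrite /rising big_ord_recr. Qed.

Lemma risingSl s n : rising s n.+1 = s * rising (s + 1) n.
Proof.
rewrite /rising big_ord_recl addr0; congr (_ * _); apply: eq_bigr => i _.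
by rewrite lift0 -natr1; ring.
Qed.

Lemma risingD s m n : rising s (m + n) = rising s m * rising (s + m%:R) n.
Proof.
elim: n => [|n IHn]; first by rewrite addn0 rising0 mulr1.
by rewrite addnS !risingSr IHn natrD; ring.
Qed.

Lemma rising_nat s m n :
  \prod_(m <= j < n) (s + j%:R) = rising (s + m%:R) (n - m).
Proof.
rewrite -{1}(add0n m) big_addn big_mkord /rising; apply: eq_bigr => i _.
by rewrite natrD; ring.
Qed.

Lemma rising_diff s n :
  rising (s + 1) n - rising s n = n%:R * rising (s + 1) n.-1.
Proof.
case: n => [|n]; first by rewrite !rising0; ring.
rewrite risingSr risingSl /= -(natr1 n); ring.
Qed.

(* With E the shift s |-> s + 1 and Delta = E - 1, the left-hand side is the
   coefficient of z^j in (1 + z E)^i (1 + z)^l applied to s^(n); replacing one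
   factor 1 + z by 1 + z E adds z Delta, and Delta s^(n) = n (s + 1)^(n-1). *)
Lemma rising_saalschutz i l j s : (j <= i + l)%N ->
  \sum_(m < j.+1) ('C(i, m) * 'C(l, j - m))%:R * rising (s + m%:R) (i + l) =
  'C(i + l, j)%:R * rising (s + j%:R) (i + l - j) * rising (s + i%:R) j.
Proof.
elim: i l j s => [|i IHi] l j s jl.
  rewrite big_ord_recl big1 => [|k _]; last by rewrite bin0n mul0n mul0r.
  rewrite bin0 subn0 mul1n !addr0 !add0n -mulrA; congr (_ * _).
  by rewrite -{1}(subnKC (jl : (j <= l)%N)) risingD mulrC.
have := IHi l.+1 j s; rewrite addnS -addSn => /(_ jl).
case: j jl => [|j] jl.
  by rewrite !big_ord_recl !big_ord0 !bin0 !rising0 !subn0.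
move=> E1.
have := IHi l j (s + 1); rewrite -ltnS => /(_ jl) => E2.
pose P m := rising (s + m%:R) (i.+1 + l).
have PS m : P m.+1 - P m = (i.+1 + l)%:R * rising (s + 1 + m%:R) (i + l).
  rewrite /P -natr1 addrA rising_diff addSn /=.
  by congr (_ * rising _ _); ring.
have step : \sum_(m < j.+2) ('C(i.+1, m) * 'C(l, j.+1 - m))%:R * P m =
    \sum_(m < j.+2) ('C(i, m) * 'C(l.+1, j.+1 - m))%:R * P m +
    \sum_(m < j.+1) ('C(i, m) * 'C(l, j - m))%:R * (P m.+1 - P m).
  rewrite (eq_bigr _ (fun m _ => mulrBr _ _ _)) sumrB.
  rewrite big_ord_recl [in RHS]big_ord_recr /=.
  under eq_bigr => m _.
    rewrite /bump leq0n add1n binS subSS mulnDl natrD mulrDl.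
    over.
  rewrite big_split /=.
  under [X in _ = X + _ + _]eq_bigr => m _.
    rewrite subSn; last by rewrite -ltnS.
    rewrite binS mulnDr natrD mulrDl.
    over.
  rewrite big_split /= subnn.
  set S1 := \sum_(m < j.+1) ('C(i, m) * 'C(l, j - m))%:R * P m.+1.
  set S2 := \sum_(m < j.+1) ('C(i, m) * 'C(l, j - m))%:R * P m.
  rewrite !bin0 subn0.
  set S3 := \sum_(m < j.+1) ('C(i, m.+1) * 'C(l, j - m))%:R * P m.+1.
  set S4 := \sum_(m < j.+1) ('C(i, m) * 'C(l, (j - m).+1))%:R * P m.
  have E3 : S3 + (1 * 'C(l, j.+1))%:R * P 0%N =
            S4 + ('C(i, j.+1) * 1)%:R * P j.+1.
    rewrite /S3 /S4 big_ord_recr [in RHS]big_ord_recl /= subnn subn0 !bin0.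
    rewrite [LHS]addrC [LHS]addrA; congr (_ + _ + _).
    by apply: eq_bigr => m _; rewrite /bump leq0n add1n subnSK.
  rewrite addrA [_ + S3]addrC E3; ring.
move: step; rewrite /P => ->; rewrite E1.
under eq_bigr => m _.
  have := PS m; rewrite /P => ->; rewrite mulrCA; over.
rewrite -mulr_sumr E2 addSn subSS.
have -> : s + j.+1%:R = s + 1 + j%:R by rewrite -natr1; ring.
have -> : s + i.+1%:R = s + i%:R + 1 by rewrite -natr1; ring.
have -> : s + 1 + i%:R = s + i%:R + 1 by ring.
have := rising_diff (s + i%:R) j.+1; rewrite /= => /eqP.
rewrite subr_eq => /eqP ->.
have H : (i + l).+1%:R * 'C(i + l, j)%:R = j.+1%:R * 'C((i + l).+1, j.+1)%:R :> A.
  by rewrite -!natrM mul_bin_diag.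
rewrite !mulrA H; ring.
Qed.

End rising.

(** * Reindexing of triangular sums *)

Section triangular_sums.
Context {V : zmodType}.

Lemma sum_ord_shift m N (f : nat -> V) :
  \sum_(e < N - m) f (m + e)%N = \sum_(i < N | (m <= i)%N) f i.
Proof.
rewrite -(big_geq_mkord m N xpredT f).
have -> := big_addn 0 N m xpredT f; rewrite big_mkord.
by apply: eq_bigr => i _; rewrite addnC.
Qed.

Lemma sum_triangle M (F : nat -> nat -> V) :
  \sum_(l < M) \sum_(h < l.+1) F (l - h)%N h =
  \sum_(e < M) \sum_(h < M | (e + h < M)%N) F e h.
Proof.
transitivity (\sum_(l < M) \sum_(h < M | (h <= l)%N) F (l - h)%N h).
  apply: eq_bigr => l _.
  by rewrite (big_ord_widen M (fun h => F (l - h)%N h)).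
rewrite (exchange_big_dep xpredT)//= [RHS](exchange_big_dep xpredT)//=; apply: eq_bigr => h _.
rewrite -(@sum_ord_shift h M (fun l => F (l - h)%N h)).
rewrite (eq_bigr (fun e : 'I_(M - h) => F e h)); last first.
  by move=> e _; rewrite addKn.
rewrite (big_ord_widen M (fun e => F e h)) ?leq_subr//.
by apply: eq_bigl => e; rewrite ltn_subRL addnC.
Qed.

(** The substitution is i = m + e, j = m + h with l = e + h; the last condition on m reads m + e + h
    < N. It regroups a product of two Laguerre sums by the powers of x y and of x + y. *)
Lemma sum_triangle_shift N (F : nat -> nat -> nat -> V) :
  \sum_(m < N) \sum_(l < N - m) \sum_(h < l.+1) F m (l - h)%N h =
  \sum_(i < N) \sum_(j < N)
     \sum_(m < N | [&& (m <= i)%N, (m <= j)%N & (i + j < N + m)%N])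
       F m (i - m)%N (j - m)%N.
Proof.
transitivity (\sum_(m < N) \sum_(i < N | (m <= i)%N)
   \sum_(j < N | (m <= j)%N && (i + j < N + m)%N) F m (i - m)%N (j - m)%N).
  apply: eq_bigr => m _; rewrite sum_triangle.
  rewrite -(@sum_ord_shift m N (fun i =>
    \sum_(j < N | (m <= j)%N && (i + j < N + m)%N) F m (i - m)%N (j - m)%N))//.
  apply: eq_bigr => e _; rewrite addKn.
  rewrite big_mkcondr/= -(@sum_ord_shift m N (fun j =>
    if (m + e + j < N + m)%N then F m e (j - m)%N else 0))//.
  rewrite big_mkcond/=; apply: eq_bigr => h _; rewrite addKn.
  by congr (if _ then _ else _); rewrite ltn_subRL; apply/idP/idP; lia.
rewrite (exchange_big_dep xpredT)//=; apply: eq_bigr => i _.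
by rewrite (exchange_big_dep xpredT).
Qed.

End triangular_sums.

(** * Product formula for Laguerre polynomials *)

Section laguerre_product.
Context {R : realType}.
Implicit Types a x y : R.

Lemma rising_gt0 (s : R) n : 0 < s -> 0 < rising s n.
Proof. by move=> s0; apply: prodr_gt0 => i _; rewrite ltr_wpDr. Qed.

(** The sign is left to [(- x) ^+ i], so that these coefficients are nonnegative when [-1 < a];
    majorants are then obtained by evaluating at a negative argument. *)
Definition laguerre_coef a n i : R :=
  rising (a + 1 + i%:R) (n - i) / ((n - i)`!%:R * i`!%:R).

Lemma laguerreE a n x :
  (laguerre a n).[x] = \sum_(i < n.+1) laguerre_coef a n i * (- x) ^+ i.
Proof.
rewrite /laguerre horner_poly; apply: eq_bigr => i _.
rewrite /laguerre_coef rising_nat subSS natrM -natr1 (exprNn x).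
have -> : a + (i%:R + 1) = a + 1 + i%:R by ring.
ring.
Qed.

(* Multiplied by i! (n - i)! (a + 1)^(i + j), this is [rising_saalschutz]. *)
Lemma laguerre_product_coef a n i j : -1 < a -> (i <= n)%N -> (j <= n)%N ->
  n`!%:R / rising (a + 1) n * laguerre_coef a n i * laguerre_coef a n j =
  \sum_(m < n.+1 | [&& (m <= i)%N, (m <= j)%N & (i + j < n.+1 + m)%N])
    rising (a + 1 + (i + j)%:R) (n + m - (i + j)) /
    (m`!%:R * rising (a + 1) m * (n + m - (i + j))`!%:R * (i - m)`!%:R
     * (j - m)`!%:R).
Proof.
move=> a1 ni nj.
have s0 : 0 < a + 1 by rewrite -ltrBlDr sub0r.
set s := a + 1 in s0 *.
have r0 k : rising s k != 0 by rewrite gt_eqF// rising_gt0.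
have f0 k : k`!%:R != 0 :> R by rewrite pnatr_eq0 -lt0n fact_gt0.
have rb k l : (k <= l)%N -> rising (s + k%:R) (l - k) = rising s l / rising s k.
  by move=> kl; rewrite -{2}(subnKC kl) risingD mulrAC divff// mul1r.
have := @rising_saalschutz _ i (n - i) j s; rewrite (subnKC ni) => /(_ nj) E.
pose c : R := (i`!%:R * (n - i)`!%:R * rising s (i + j)).
have c0 : c != 0 by rewrite /c !mulf_neq0.
apply: (mulfI c0).
transitivity ('C(n, j)%:R * rising (s + j%:R) (n - j) * rising (s + i%:R) j).
  rewrite -[X in rising (s + i%:R) X](addKn i j) (rb i (i + j)%N) ?leq_addr//.
  rewrite /laguerre_coef -/s !rb// /c -(bin_fact nj) !natrM; field.
  by rewrite !f0 !r0.
rewrite -E mulr_sumr.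
rewrite (big_ord_widen_cond n.+1 xpredT
  (fun m => ('C(i, m) * 'C(n - i, j - m))%:R * rising (s + m%:R) n))// big_mkcond.
rewrite [RHS]big_mkcond; apply: eq_bigr => m _ /=.
rewrite ltnS.
have [mi|im] := leqP m i; last by rewrite bin_small// mul0n mul0r; case: ifP.
have [mj|jm] //= := leqP m j.
(* The condition m <= j is the original range of summation; the other two say that neither binomial
   coefficient vanishes. *)
case: ifPn => [ijn|]; last first.
  by rewrite -leqNgt => h; rewrite [X in (_ * X)%N]bin_small ?muln0 ?mul0r//; lia.
have e : (n - i - (j - m) = n + m - (i + j))%N by lia.
have hb : (j - m <= n - i)%N by lia.
have -> : rising (s + m%:R) n = rising s (n + m) / rising s m.
  by rewrite -[X in rising _ X](addnK m n) rb ?leq_addl// addnK.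
rewrite rb; last by lia.
rewrite /c -(bin_fact mi) -(bin_fact hb) e natrM !natrM.
have b0 k l : (k <= l)%N -> 'C(l, k)%:R != 0 :> R.
  by move=> kl; rewrite pnatr_eq0 -lt0n bin_gt0.
field.
by rewrite !f0 !r0.
Qed.

(* Bailey's formula. *)
Lemma laguerre_product a n x y : -1 < a ->
  n`!%:R / rising (a + 1) n * (laguerre a n).[x] * (laguerre a n).[y] =
  \sum_(m < n.+1) (x * y) ^+ m / (m`!%:R * rising (a + 1) m) *
    (laguerre (a + (2 * m)%:R) (n - m)).[x + y].
Proof.
move=> a1.
have f0 k : k`!%:R != 0 :> R by rewrite pnatr_eq0 -lt0n fact_gt0.
pose F m e h : R := (- x) ^+ (m + e) * (- y) ^+ (m + h) *
  (rising (a + 1 + (m + e + (m + h))%:R) (n + m - (m + e + (m + h))) /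
    (m`!%:R * rising (a + 1) m * (n + m - (m + e + (m + h)))`!%:R * e`!%:R
     * h`!%:R)).
transitivity (\sum_(m < n.+1) \sum_(l < n.+1 - m) \sum_(h < l.+1) F m (l - h)%N h).
  rewrite sum_triangle_shift !laguerreE -mulrA big_distrlr mulr_sumr.
  apply: eq_bigr => i _; rewrite mulr_sumr; apply: eq_bigr => j _.
  have := @laguerre_product_coef a n i j a1.
  rewrite -!(ltnS _ n) !ltn_ord => /(_ isT isT) E.
  rewrite /=; transitivity (n`!%:R / rising (a + 1) n * laguerre_coef a n i *
     laguerre_coef a n j * ((- x) ^+ i * (- y) ^+ j)); first ring.
  rewrite E mulr_suml; apply: eq_bigr => m /and3P[mi mj _].
  by rewrite /F !subnKC// mulrC.
apply: eq_bigr => m _.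
have mn : (m <= n)%N by rewrite -ltnS.
rewrite laguerreE -subSn// mulr_sumr; apply: eq_bigr => l _.
rewrite opprD exprDn mulr_sumr mulr_sumr; apply: eq_bigr => h _.
have hl : (h <= l)%N by rewrite -ltnS.
have lb := ltn_ord l.
rewrite /F /laguerre_coef.
have -> : (m + (l - h) + (m + h) = 2 * m + l)%N by lia.
have -> : (n + m - (2 * m + l) = n - m - l)%N by lia.
have -> : a + (2 * m)%:R + 1 + l%:R = a + 1 + (2 * m + l)%:R.
  by rewrite natrD; ring.
rewrite -(bin_fact hl) !natrM -mulr_natr !exprD -[x * y]mulrNN exprMn.
have b0 : 'C(l, h)%:R != 0 :> R by rewrite pnatr_eq0 -lt0n bin_gt0.
have r0 k : rising (a + 1) k != 0.
  by rewrite gt_eqF// rising_gt0// -ltrBlDr sub0r.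
field.
by rewrite !f0 b0 r0.
Qed.

End laguerre_product.

(** * The Gamma function *)

Section positive_half_line.
Context {R : realType}.
Notation mu := (@lebesgue_measure R).
Local Open Scope ereal_scope.

Lemma bigcup_exhaust (a b : R^nat) :
  (forall n, (0 < a n)%R) -> (a n @[n --> \oo] --> 0%R) ->
  (b n @[n --> \oo] --> +oo%R) ->
  \bigcup_n `[a n, b n]%classic = `]0%R, +oo[%classic.
Proof.
move=> a0 cva cvb; apply/seteqP; split => [x [n _]|x] /=.
  by rewrite !in_itv/= andbT => /andP[anx _]; exact: lt_le_trans anx.
rewrite in_itv/= andbT => x0.
have : \forall n \near \oo, (a n < x)%R /\ (x <= b n)%R.
  apply: filterI; first exact: (cvgr_lt _ cva).
  by move/cvgryPge : cvb; exact.
by case=> n _ /(_ n (leqnn n)) [anx xbn]; exists n => //=; rewrite in_itv/= xbn ltW.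
Qed.

Lemma ge0_cvg_integral_exhaust (a b : R^nat) (f : R -> \bar R) :
  (forall n, (0 < a n)%R) -> (a n @[n --> \oo] --> 0%R) ->
  (b n @[n --> \oo] --> +oo%R) ->
  nonincreasing_seq a -> nondecreasing_seq b ->
  measurable_fun (`]0%R, +oo[ : set R) f -> (forall x : R, (0 < x)%R -> 0 <= f x) ->
  \int[mu]_(x in `[a n, b n]) f x @[n --> \oo] --> \int[mu]_(x in `]0%R, +oo[) f x.
Proof.
move=> a0 cva cvb nia ndb mf f0; rewrite -(bigcup_exhaust a0 cva cvb).
have sub n : `[a n, b n]%classic `<=` `]0%R, +oo[%classic.
  by move=> x /=; rewrite !in_itv/= andbT => /andP[anx _]; exact: lt_le_trans anx.
apply: ge0_nondecreasing_set_cvg_integral.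
- move=> m n mn; apply/subsetPset => x /=; rewrite !in_itv/= => /andP[ax xb].
  by rewrite (le_trans (nia _ _ mn) ax) (le_trans xb (ndb _ _ mn)).
- by move=> n; exact: measurable_itv.
- by move=> n; exact: measurable_funS mf.
- by move=> n x /sub /=; rewrite in_itv/= andbT; exact: f0.
Qed.

Lemma cvg_natS : (n.+1%:R : R)%R @[n --> \oo] --> +oo%R.
Proof. by have := @cvgr_idn R; rewrite -cvg_shiftS. Qed.

Lemma nonincreasing_invS : nonincreasing_seq (fun n => n.+1%:R^-1 : R)%R.
Proof. by move=> m n mn; rewrite lef_pV2 ?posrE// ler_nat. Qed.

Lemma nondecreasing_natS : nondecreasing_seq (fun n => n.+1%:R : R)%R.
Proof. by move=> m n mn; rewrite ler_nat. Qed.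

Lemma ge0_cvg_integral_pos (f : R -> \bar R) :
  measurable_fun (`]0%R, +oo[ : set R) f -> (forall x : R, (0 < x)%R -> 0 <= f x) ->
  \int[mu]_(x in `[n.+1%:R^-1%R, n.+1%:R%R]) f x @[n --> \oo] -->
  \int[mu]_(x in `]0%R, +oo[) f x.
Proof.
move=> mf f0; apply: (@ge0_cvg_integral_exhaust (fun n => n.+1%:R^-1)%R
  (fun n => n.+1%:R)%R) => //.
- exact: cvg_harmonic.
- exact: cvg_natS.
- exact: nonincreasing_invS.
- exact: nondecreasing_natS.
Qed.

Lemma pos_continuous_measurable (f : R -> R) :
  (forall x : R, (0 < x)%R -> {for x, continuous f}) ->
  measurable_fun (`]0%R, +oo[ : set R) f.
Proof.
move=> cf; apply: open_continuous_measurable_fun; first exact: interval_open.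
by move=> x; rewrite inE/= in_itv/= andbT; exact: cf.
Qed.

(** Substitution on the compact intervals [1/(n+1), n+1], followed by monotone convergence on both
    sides: the limits of [F] at the endpoints make the image intervals exhaust the half-line. *)
Lemma integral_pos_subst (F f G : R -> R) :
  (forall x : R, (0 < x)%R -> (0 < F x)%R) ->
  {in [pred x | (0 < x)%R] &, {homo F : x y / (x < y)%R}} ->
  (forall x : R, (0 < x)%R -> is_derive x (1%R : R) F (f x)) ->
  (forall x : R, (0 < x)%R -> {for x, continuous f}) ->
  (forall x : R, (0 < x)%R -> {for x, continuous G}) ->
  (forall x : R, (0 < x)%R -> (0 <= f x)%R) ->
  (forall x : R, (0 < x)%R -> (0 <= G x)%R) ->
  (F n.+1%:R^-1 @[n --> \oo] --> 0)%R ->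
  (F n.+1%:R @[n --> \oo] --> +oo)%R ->
  \int[mu]_(x in `]0%R, +oo[) (G x)%:E =
  \int[mu]_(x in `]0%R, +oo[) (G (F x) * f x)%:E.
Proof.
move=> F0 incF dF cf cG f0 G0 cvF0 cvFy.
have cF (x : R) : (0 < x)%R -> {for x, continuous F}.
  move=> x0; apply: differentiable_continuous; apply/derivable1_diffP.
  by have [] := dF x x0.
have mG : measurable_fun (`]0%R, +oo[ : set R) (EFin \o G).
  by apply/measurable_EFinP; apply: pos_continuous_measurable => x; exact: cG.
have mGf : measurable_fun (`]0%R, +oo[ : set R) (fun x => (G (F x) * f x)%:E).
  apply/measurable_EFinP; apply: pos_continuous_measurable => x x0.
  apply: continuousM; last exact: cf.
  by apply: continuous_comp; [exact: cF|exact/cG/F0].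
have cv1 := @ge0_cvg_integral_exhaust (fun n => F n.+1%:R^-1)%R
  (fun n => F n.+1%:R)%R (EFin \o G).
have cv2 := ge0_cvg_integral_pos mGf.
have i0 (n : nat) : (0 < n.+1%:R^-1 :> R)%R by [].
have E n : \int[mu]_(x in `[n.+1%:R^-1%R, n.+1%:R%R]) (G (F x) * f x)%:E =
    \int[mu]_(x in `[F n.+1%:R^-1%R, F n.+1%:R%R]) (EFin \o G) x.
  have le1 : (n.+1%:R^-1 <= n.+1%:R :> R)%R.
    by rewrite (@le_trans _ _ 1%R)// ?invf_le1 ?ler1n.
  have pos (x : R) : x \in `[n.+1%:R^-1%R, n.+1%:R%R] -> (0 < x)%R.
    by rewrite in_itv/= => /andP[h _]; exact: lt_le_trans h.
  have poso (x : R) : x \in `]n.+1%:R^-1%R, n.+1%:R%R[ -> (0 < x)%R.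
    by rewrite in_itv/= => /andP[h _]; exact: lt_trans h.
  have dFE (x : R) : (0 < x)%R -> (derive1 F x = f x)%R.
    by move=> x0; rewrite derive1E; have [_ ->] := dF x x0.
  transitivity (\int[mu]_(x in `[n.+1%:R^-1%R, n.+1%:R%R])
     (((G \o F) * derive1 F)%R x)%:E).
    apply: eq_integral => x; rewrite inE/= => /pos x0.
    by rewrite /= -[((G \o F) * _)%R x]/(G (F x) * derive1 F x)%R dFE.
  have nearE (x : R) : (0 < x)%R -> \forall y \near x, f y = derive1 F y.
    move=> x0; near=> y; rewrite dFE//; near: y.
    exact: lt_nbhsr.
  rewrite -(@integration_by_substitution_increasing R F G)//.
  - move=> x y xi yi; apply: incF; rewrite inE/=; exact: pos.
  - move=> x /poso x0; rewrite /continuous_at dFE//.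
    by apply: cvg_trans (cf _ x0); apply: near_eq_cvg; exact: nearE.
  - apply/cvg_ex; exists (f n.+1%:R^-1)%R.
    apply: cvg_within_filter.
    by apply: cvg_trans (cf _ (i0 n)); apply: near_eq_cvg; exact: nearE.
  - apply/cvg_ex; exists (f n.+1%:R)%R.
    apply: cvg_within_filter.
    apply: cvg_trans (cf _ (ltr0Sn R n)); apply: near_eq_cvg; exact: nearE.
  - split => [x /poso x0||]; first by have [] := dF x x0.
      by apply: cvg_within_filter; exact: cF.
    by apply: cvg_within_filter; apply: cF.
  - apply: continuous_in_subspaceT => x; rewrite inE/= in_itv/= => /andP[h _].
    by apply: cG; apply: lt_le_trans h; exact: F0.
have cv1' : \int[mu]_(x in `[F n.+1%:R^-1%R, F n.+1%:R%R]) (EFin \o G) x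
    @[n --> \oo] --> \int[mu]_(x in `]0%R, +oo[) (EFin \o G) x.
  apply: cv1 => //.
  - by move=> n; exact: F0.
  - move=> m n mn; have [->//|neq] := eqVneq m n.
    by apply/ltW/incF; rewrite ?inE// ltf_pV2 ?posrE// ltr_nat ltnS ltn_neqAle neq.
  - move=> m n mn; have [->//|neq] := eqVneq m n.
    by apply/ltW/incF; rewrite ?inE// ltr_nat ltnS ltn_neqAle neq.
have {}cv2 : \int[mu]_(x in `[F n.+1%:R^-1%R, F n.+1%:R%R]) (EFin \o G) x
    @[n --> \oo] --> \int[mu]_(x in `]0%R, +oo[) (G (F x) * f x)%:E.
  rewrite -(funext E).
  by apply: cv2 => x x0; rewrite lee_fin mulr_ge0// ?f0// G0// F0.
by rewrite -(cvg_lim (@ereal_hausdorff R) cv2) -(cvg_lim (@ereal_hausdorff R) cv1').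
Unshelve. all: end_near. Qed.

End positive_half_line.

(** * Gamma integrals *)

Section gamma_function.
Context {R : realType}.
Notation mu := (@lebesgue_measure R).
Implicit Types s t x : R.

Lemma continuous_powR s x : 0 < x -> {for x, continuous (fun u : R => u `^ s)}.
Proof.
move=> x0; apply: differentiable_continuous; apply/derivable1_diffP.
by have [] := is_derive1_powR s x0.
Qed.

Lemma measurable_fun_powR d (T : measurableType d) (D : set T) (f : T -> R) s :
  measurable_fun D f -> measurable_fun D (fun z => f z `^ s).
Proof. by move=> mf; apply: (@measurableT_comp _ _ _ _ _ _ (fun t : R => t `^ s)). Qed.

Lemma powR_le1 x s : 0 <= x <= 1 -> 0 <= s -> x `^ s <= 1.
Proof.
move=> /andP[x0 x1] s0.
have := @ge0_ler_powR R s s0 x 1; rewrite powR1; apply => //.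
by rewrite nnegrE.
Qed.

(** For x >= 1 the power is at most an integer power, hence at most a multiple of one term of the
    exponential series at x / 2. The second summand takes care of x < 1, where a negative s makes
    the power unbounded. *)
Lemma powR_expR_bound s : exists2 C : R, 0 < C &
  forall x, 0 < x -> x `^ s <= C * expR (x / 2) + x `^ s * (x < 1)%R%:R.
Proof.
have [m sm] : exists m : nat, s <= m.+1%:R.
  exists (Num.bound `|s|); rewrite -natr1.
  rewrite (le_trans (ler_norm s))// (le_trans (ltW (archi_boundP (normr_ge0 s))))//.
  by rewrite lerDl.
exists (m.+1`!%:R * 2 ^+ m.+1) => [|x x0].
  by rewrite mulr_gt0// ?exprn_gt0// ltr0n fact_gt0.
have [x1|x1] := ltP x 1.
  by rewrite mulr1 lerDr mulr_ge0 ?expR_ge0// mulr_ge0// exprn_ge0.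
rewrite mulr0 addr0 (@le_trans _ _ (x ^+ m.+1))//.
  by rewrite -powR_mulrn ?(ltW x0)//; exact: ler_powR.
have /(expR_ge1Dxn m) : 0 <= x / 2 by rewrite divr_ge0// ltW.
move=> /(le_trans _) H.
have f0 : 0 < m.+1`!%:R :> R by rewrite ltr0n fact_gt0.
have : (x / 2) ^+ m.+1 / m.+1`!%:R <= expR (x / 2) by apply: H; rewrite lerDr.
rewrite ler_pdivrMr// exprMn exprVn ler_pdivrMr ?exprn_gt0// => /le_trans; apply.
by apply: eqW; ring.
Qed.

Lemma integral_expR_half :
  (\int[mu]_(t in `]0%R, +oo[) (expR (- (t / 2)))%:E < +oo)%E.
Proof.
have m2 : measurable_fun setT (fun t : R => (expR (- (t / 2)))%:E).
  by apply/measurable_EFinP; apply: measurableT_comp => //;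
     apply: measurableT_comp => //; exact: mulrr_measurable.
have cE : continuous (fun t : R => expR (- (t / 2))).
  move=> x; apply: continuous_comp; last exact: continuous_expR.
  by apply: continuousN; apply: mulrr_continuous.
rewrite integral_itv_obnd_cbnd//; last exact: measurable_funTS.
rewrite (@ge0_continuous_FTC2y _ _ (fun t => - 2 * expR (- (t / 2))) _ 0)//.
- by rewrite -EFinB ltry.
- exact: continuous_subspaceT.
- rewrite -[X in _ --> X](mulr0 (-2)); apply: cvgM; first exact: cvg_cst.
  apply: (@cvg_comp _ _ _ (fun t : R => t / 2) (fun t => expR (- t)) _ +oo%R).
    by apply: gt0_cvgMly => //; exact: cvg_id.
  exact: cvgr_expR.
- apply: cvg_within_filter; apply: cvgM; first exact: cvg_cst.
  exact: cE.
- move=> x _; rewrite derive1E derive_val /GRing.scale/=.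
  by field.
Qed.

Lemma measurable_gamma_scale s (l : R) (D : set R) :
  measurable_fun D (fun t : R => (t `^ (s - 1) * expR (- (t * l)))%:E).
Proof.
apply: measurable_funTS; apply/measurable_EFinP; apply: measurable_funM.
  exact: measurable_powR.
by apply: measurableT_comp => //; apply: measurableT_comp => //; exact: mulrr_measurable.
Qed.

Lemma measurable_gamma_fun s (D : set R) :
  measurable_fun D (fun t : R => (t `^ (s - 1) * expR (- t))%:E).
Proof.
apply: measurable_funTS; apply/measurable_EFinP; apply: measurable_funM.
  exact: measurable_powR.
by apply: measurableT_comp => //; exact: oppr_measurable.
Qed.

Lemma gamma_fun_ge0 s t : (0 <= (t `^ (s - 1) * expR (- t))%:E)%E.
Proof. by rewrite lee_fin mulr_ge0// ?powR_ge0 ?expR_ge0. Qed.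

Lemma integral_gamma_lty1 s : 1 <= s ->
  (\int[mu]_(t in `]0%R, +oo[) (t `^ (s - 1) * expR (- t))%:E < +oo)%E.
Proof.
move=> s1; have [C C0 H] := powR_expR_bound (s - 1).
have m2 : measurable_fun (`]0%R, +oo[ : set R) (fun t : R => (expR (- (t / 2)))%:E).
  by apply: measurable_funTS; apply/measurable_EFinP; apply: measurableT_comp => //;
     apply: measurableT_comp => //; exact: mulrr_measurable.
apply: (@le_lt_trans _ _ (\int[mu]_(t in `]0%R, +oo[)
    ((C + 1)%:E * (expR (- (t / 2)))%:E)))%E.
  apply: ge0_le_integral => //.
  - by move=> x _; exact: gamma_fun_ge0.
  - exact: measurable_gamma_fun.
  - exact: emeasurable_funM.
  move=> x /=; rewrite in_itv/= andbT => x0.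
  rewrite -EFinM lee_fin.
  have -> : expR (- x) = expR (- (x / 2)) * expR (- (x / 2)).
    by rewrite -expRD; congr expR; field.
  rewrite mulrA ler_pM2r ?expR_gt0// expRN ler_pdivrMr ?expR_gt0//.
  apply: (le_trans (H _ x0)); rewrite mulrDl mul1r lerD2l.
  have [x1|x1] := ltP x 1; last by rewrite mulr0 expR_ge0.
  rewrite mulr1 (@le_trans _ _ 1)//; first by apply: powR_le1; rewrite ?subr_ge0// !ltW.
  by rewrite ltW// expR_gt1 divr_gt0.
rewrite ge0_integralZl//.
- by rewrite lte_mul_pinfty//; [rewrite lee_fin; lra|exact: integral_expR_half].
- by rewrite lee_fin; lra.
Qed.

Lemma integral_gamma_parts s (a b : R) : 0 < a -> a < b -> 0 < s ->
  (\int[mu]_(t in `[a, b]) (t `^ (s + 1 - 1) * expR (- t))%:E =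
   (a `^ s * expR (- a) - b `^ s * expR (- b))%:E +
   s%:E * \int[mu]_(t in `[a, b]) (t `^ (s - 1) * expR (- t))%:E)%E.
Proof.
move=> a0 ab s0; rewrite addrK.
have pos x : a <= x -> 0 < x by exact: lt_le_trans.
have cE x : {for x, continuous (fun t : R => expR (- t))}.
  by apply: continuous_comp; [exact: continuousN|exact: continuous_expR].
have cw (f : R -> R) : (forall x, 0 < x -> {for x, continuous f}) ->
    {within `[a, b], continuous f}.
  move=> cf; apply: continuous_in_subspaceT => x; rewrite inE/= in_itv/=.
  by move=> /andP[/pos x0 _]; exact: cf.
have dlr (f : R -> R) : (forall x, 0 < x -> derivable f x 1) ->
    derivable_oo_LRcontinuous f a b.
  have df x : 0 < x -> derivable f x 1 -> {for x, continuous f}.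
    by move=> x0 dfx; apply: differentiable_continuous; apply/derivable1_diffP.
  move=> dfx; split => [x||].
  - by rewrite in_itv/= => /andP[/ltW/pos x0 _]; exact: dfx.
  - by apply: cvg_within_filter; apply: df => //; exact: dfx.
  - by apply: cvg_within_filter; apply: df; [|apply: dfx]; exact: lt_trans ab.
have dN (x : R) : is_derive x (1 : R) (fun t : R => - expR (- t)) (expR (- x)).
  by apply: is_derive_eq; rewrite /GRing.scale/=; ring.
rewrite (@integration_by_parts R (fun t => t `^ s) (fun t => - expR (- t))
  (fun t => s * t `^ (s - 1)) (fun t => expR (- t)) a b)//; last 6 first.
- by apply: cw => x x0; apply: continuousM; [exact: cvg_cst|exact: continuous_powR].
- by apply: dlr => x x0; have [] := is_derive1_powR s x0.
- move=> x; rewrite in_itv/= => /andP[/ltW/pos x0 _].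
  by rewrite powR_derive1// in_itv/= x0.
- by apply: cw.
- by apply: dlr => x x0; have [] := dN x.
- by move=> x _; rewrite derive1E; have [_ ->] := dN x.
congr (_ + _)%E; first by congr EFin; ring.
under eq_integral do rewrite mulrN EFinN.
rewrite integral_ge0N/=; last first.
  by move=> x _; rewrite lee_fin !mulr_ge0// ?powR_ge0 ?expR_ge0// ltW.
rewrite oppeK.
under eq_integral do rewrite -mulrA EFinM.
rewrite ge0_integralZl//; first exact: measurable_gamma_fun.
  by move=> x _; exact: gamma_fun_ge0.
by rewrite lee_fin ltW.
Qed.

(** The identity is between extended reals and presupposes no finiteness, so that it can serve to
    prove that the integral is finite. *)
Lemma integral_gamma_rec s : 0 < s ->
  (\int[mu]_(t in `]0%R, +oo[) (t `^ (s + 1 - 1) * expR (- t))%:E =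
   s%:E * \int[mu]_(t in `]0%R, +oo[) (t `^ (s - 1) * expR (- t))%:E)%E.
Proof.
move=> s0.
have cv u := @ge0_cvg_integral_pos R (fun t => (t `^ (u - 1) * expR (- t))%:E)
   (@measurable_gamma_fun u _) (fun x _ => gamma_fun_ge0 u x).
rewrite -(cvg_lim (@ereal_hausdorff R) (cv (s + 1))).
apply: cvg_lim => //.
rewrite -[X in _ --> X]add0e.
have -> : (fun n : nat => \int[mu]_(x in `[n.+1%:R^-1%R, n.+1%:R%R])
     (x `^ (s + 1 - 1) * expR (- x))%:E)%E =
  (fun n => ((n.+1%:R^-1%R : R) `^ s * expR (- (n.+1%:R^-1)%R) -
     n.+1%:R%R `^ s * expR (- n.+1%:R)%R)%:E + s%:E *
   \int[mu]_(t in `[(n.+1%:R^-1%R : R), n.+1%:R%R]) (t `^ (s - 1) * expR (- t))%:E)%E.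
  (* For n = 0 the interval is reduced to the point 1, whereas integration by parts wants distinct
     endpoints. *)
  apply/funext => -[|n].
    by rewrite invr1 subrr add0e set_itv1 !integral_set1 mule0.
  apply: integral_gamma_parts => //.
  by rewrite (@lt_trans _ _ 1)// ?invf_lt1// ltr1n.
apply: cvgeD => //.
  apply/fine_cvgP; split; first by near=> n.
  rewrite /= -[X in _ --> X](subr0 (0 : R)); apply: cvgB.
    apply: (@squeeze_cvgr _ _ _ _ (fun=> 0) (fun n => (n.+1%:R^-1 : R) `^ s)).
    - near=> n; rewrite mulr_ge0 ?powR_ge0 ?expR_ge0//=.
      by rewrite ler_piMr ?powR_ge0// expR_le1 oppr_le0.
    - exact: cvg_cst.
    - have /cvg_at_rightP := @powR_cvg0 R s s0; apply.
      by split => //; exact: cvg_harmonic.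
  (* The exponent s + 1 leaves a spare factor: b^s e^(-b) <= C / b for b >= 1. *)
  have [C C0 H] := powR_expR_bound (s + 1).
  apply: (@squeeze_cvgr _ _ _ _ (fun=> 0) (fun n => C * (n.+1%:R^-1 : R))).
  - near=> n; rewrite mulr_ge0 ?powR_ge0 ?expR_ge0//=.
    have := H n.+1%:R (ltr0Sn _ _); rewrite [_ < 1]ltNge ler1n/= mulr0 addr0.
    rewrite powRD ?pnatr_eq0 ?implybT// powRr1// => h.
    rewrite expRN ler_pdivlMr// mulrAC ler_pdivrMr ?expR_gt0//.
    by rewrite (le_trans h)// ler_pM2l// ler_expR ler_pdivrMr// ler_peMr// ler1n.
  - exact: cvg_cst.
  - by rewrite -[X in _ --> X](mulr0 C); apply: cvgM; [exact: cvg_cst|exact: cvg_harmonic].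
by apply: cvgeZl => //; exact: cv.
Unshelve. all: end_near. Qed.

(** The integral for s + 1 >= 1 is finite, and it is s times the integral for s, which therefore
    cannot be infinite. *)
Lemma integral_gamma_lty s : 0 < s ->
  (\int[mu]_(t in `]0%R, +oo[) (t `^ (s - 1) * expR (- t))%:E < +oo)%E.
Proof.
move=> s0; have : (s%:E * \int[mu]_(t in `]0%R, +oo[) (t `^ (s - 1) * expR (- t))%:E < +oo)%E.
  by rewrite -integral_gamma_rec// integral_gamma_lty1// lerDr ltW.
by apply: contraTT; rewrite -!leNgt !leye_eq => /eqP ->; rewrite gt0_muley// lte_fin.
Qed.

Lemma integral_gamma s : 0 < s ->
  (\int[mu]_(t in `]0%R, +oo[) (t `^ (s - 1) * expR (- t))%:E = (Gamma s)%:E)%E.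
Proof.
move=> s0; rewrite /Gamma /Rintegral fineK// ge0_fin_numE ?integral_gamma_lty//.
by apply: integral_ge0 => t _; exact: gamma_fun_ge0.
Qed.

Lemma GammaS s : 0 < s -> Gamma (s + 1) = s * Gamma s.
Proof.
move=> s0; apply: EFin_inj; rewrite EFinM -!integral_gamma//; last by rewrite addr_gt0.
exact: integral_gamma_rec.
Qed.

(** The functional equation raises the exponent of t to s > 0, after which the integrand is at least
    e^(-2) on [1, 2]. *)
Lemma Gamma_gt0 s : 0 < s -> 0 < Gamma s.
Proof.
move=> s0; rewrite -(pmulr_rgt0 _ s0) -GammaS// -lte_fin -integral_gamma ?addr_gt0// addrK.
apply: (@lt_le_trans _ _ (\int[mu]_(t in `[1%R, 2%R]) (expR (- 2))%:E)%E).
  rewrite integral_cst; last exact: measurable_itv.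
  rewrite /= lebesgue_measure_itv/= lte_fin ltr1n -EFinD -EFinM lte_fin.
  by rewrite mulr_gt0 ?expR_gt0//; lra.
have m3 := @measurable_gamma_fun (s + 1); rewrite addrK in m3.
apply: (@le_trans _ _ (\int[mu]_(t in `[1%R, 2%R]) (t `^ s * expR (- t))%:E)%E).
  apply: ge0_le_integral => //.
  - exact: m3.
  - move=> x /=; rewrite in_itv/= => /andP[x1 x2]; rewrite lee_fin.
    rewrite (@le_trans _ _ (expR (- x)))// ?ler_expR ?lerN2//.
    by rewrite ler_peMl ?expR_ge0// -(powRr0 x) ler_powR// ltW.
apply: ge0_subset_integral => //.
- exact: m3.
- by move=> x _; rewrite lee_fin mulr_ge0// ?powR_ge0 ?expR_ge0.
- move=> x /=; rewrite !in_itv/= andbT => /andP[x1 _]; exact: lt_le_trans x1.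
Qed.

Lemma Gamma_rising s n : 0 < s -> Gamma (s + n%:R) = rising s n * Gamma s.
Proof.
move=> s0; elim: n => [|n IHn]; first by rewrite addr0 rising0 mul1r.
rewrite -natr1 addrA GammaS ?IHn ?risingSr; last by rewrite ltr_wpDr.
ring.
Qed.

Lemma Gamma1 : Gamma (1 : R) = 1.
Proof.
apply: EFin_inj; rewrite -integral_gamma// subrr.
under eq_integral do rewrite powRr0 mul1r.
have cE : continuous (fun t : R => expR (- t)).
  by move=> x; apply: continuous_comp; [exact: continuousN|exact: continuous_expR].
rewrite integral_itv_obnd_cbnd//; last first.
  apply: measurable_funTS; apply/measurable_EFinP.
  exact: continuous_measurable_fun.
rewrite (@ge0_continuous_FTC2y _ _ (fun t => - expR (- t)) _ 0)//.
- by rewrite oppr0 expR0 EFinN sub0e oppeK.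
- exact: continuous_subspaceT.
- by rewrite -oppr0; apply: cvgN; exact: cvgr_expR.
- by apply: cvg_within_filter; apply: cvgN; exact: cE.
- by move=> x _; rewrite derive1E derive_val /GRing.scale/=; ring.
Qed.

Lemma Gamma_fact n : Gamma (n%:R + 1) = n`!%:R :> R.
Proof.
elim: n => [|n IHn]; first by rewrite add0r Gamma1 fact0.
by rewrite GammaS ?ltr0Sn// -natr1 IHn factS natrM natr1.
Qed.

Lemma integral_gamma_scale s (l : R) : 0 < s -> 0 < l ->
  (\int[mu]_(t in `]0%R, +oo[) (t `^ (s - 1) * expR (- (t * l)))%:E =
   (Gamma s * l `^ (- s))%:E)%E.
Proof.
move=> s0 l0.
have cE (x : R) : {for x, continuous (fun t : R => expR (- t))}.
  by apply: continuous_comp; [exact: continuousN|exact: continuous_expR].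
have := @integral_pos_subst R (fun t => t * l) (fun=> l)
  (fun t => t `^ (s - 1) * expR (- t)).
rewrite integral_gamma// => H.
rewrite [Gamma s * _]mulrC EFinM; have {}H : ((Gamma s)%:E = \int[mu]_(x in `]0%R, +oo[)
    ((x * l) `^ (s - 1) * expR (- (x * l)) * l)%:E)%E.
  apply: H => //.
  - by move=> x x0; rewrite mulr_gt0.
  - by move=> x y _ _ xy; rewrite ltr_pM2r.
  - by move=> x _; apply: is_derive_eq; rewrite /GRing.scale/=; ring.
  - by move=> x x0; exact: cvg_cst.
  - by move=> x x0; apply: continuousM => //; exact: continuous_powR.
  - by move=> x _; exact: ltW.
  - by move=> x _; rewrite mulr_ge0 ?powR_ge0 ?expR_ge0.
  - rewrite -[X in _ --> X](mul0r l).
    by apply: cvgM; [exact: cvg_harmonic|exact: cvg_cst].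
  - apply/cvgryPge => A; have /cvgryPge/(_ (A / l)) := @cvg_natS R.
    by apply: filterS => n; rewrite ler_pdivrMr.
rewrite H.
rewrite -ge0_integralZl//; last 3 first.
- apply: measurable_funTS; apply/measurable_EFinP.
  apply: measurable_funM; last exact: measurable_cst.
  apply: measurable_funM; first exact: measurable_fun_powR (mulrr_measurable _).
  by apply: measurableT_comp => //; apply: measurableT_comp => //;
    exact: mulrr_measurable.
- by move=> x _; rewrite lee_fin !mulr_ge0// ?powR_ge0 ?expR_ge0// ltW.
- by rewrite lee_fin powR_ge0.
apply: eq_integral => x; rewrite inE/= in_itv/= andbT => x0.
rewrite -EFinM powRM ?ltW// powRN; congr EFin.
have : l `^ (s - 1) * l = l `^ s by rewrite mulrC mulr_powRB1// ltW.
have : l `^ s != 0 by rewrite powR_eq0 gt_eqF.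
move=> h h2; rewrite -h2 in h *; field.
by rewrite (gt_eqF l0) powR_eq0 (gt_eqF l0).
Qed.

Lemma integral_gamma_sqr s : 0 < s ->
  (\int[mu]_(u in `]0%R, +oo[) (u `^ (2 * s - 1) * expR (- u ^+ 2))%:E =
   (Gamma s / 2)%:E)%E.
Proof.
move=> s0.
have cE (x : R) : {for x, continuous (fun t : R => expR (- t))}.
  by apply: continuous_comp; [exact: continuousN|exact: continuous_expR].
have := @integral_pos_subst R (fun t => t ^+ 2) (fun t => 2 * t)
  (fun t => t `^ (s - 1) * expR (- t)).
rewrite integral_gamma// => H.
rewrite [Gamma s * _]mulrC EFinM; have {}H : ((Gamma s)%:E = \int[mu]_(x in `]0%R, +oo[)
    ((x ^+ 2) `^ (s - 1) * expR (- x ^+ 2) * (2 * x))%:E)%E.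
  apply: H => //.
  - by move=> x x0; rewrite exprn_gt0.
  - by move=> x y; rewrite !inE/= => x0 y0 xy; rewrite ltrXn2r// ltW.
  - by move=> x _; apply: is_derive_eq; rewrite /GRing.scale/=; ring.
  - by move=> x x0; apply: cvgM; [exact: cvg_cst|exact: cvg_id].
  - by move=> x x0; apply: continuousM => //; exact: continuous_powR.
  - by move=> x x0; rewrite mulr_ge0 ?ltW.
  - by move=> x _; rewrite mulr_ge0 ?powR_ge0 ?expR_ge0.
  - rewrite -[X in _ --> X](mulr0 (0 : R)); under eq_fun do rewrite expr2.
    by apply: cvgM; exact: cvg_harmonic.
  - apply/cvgryPge => A; have /cvgryPge/(_ A) := @cvg_natS R; apply: filterS => n.
    by move/le_trans; apply; rewrite expr2 ler_peMr// ler1n.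
rewrite H.
rewrite -ge0_integralZl//; last 2 first.
- apply: measurable_funTS; apply/measurable_EFinP.
  apply: measurable_funM; last exact: mulrl_measurable.
  apply: measurable_funM.
    apply: measurable_fun_powR; exact: exprn_measurable.
  by apply: measurableT_comp => //; apply: measurableT_comp => //;
    exact: exprn_measurable.
- move=> x /=; rewrite in_itv/= andbT => x0.
  by rewrite lee_fin !mulr_ge0// ?powR_ge0 ?expR_ge0// ltW.
apply: eq_integral => x; rewrite inE/= in_itv/= andbT => x0.
rewrite -EFinM; congr EFin.
have -> : x `^ (2 * s - 1) = (x ^+ 2) `^ (s - 1) * x.
  rewrite -powR_mulrn ?ltW// -powRrM -{3}(powRr1 (ltW x0)) -powRD; last by rewrite (gt_eqF x0) implybT.
  by congr (_ `^ _); ring.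
by field.
Qed.

End gamma_function.

(** * The Hille-Hardy formula *)

Section series_lemmas.
Context {R : realType}.
Implicit Types (u v D : R^nat).

Lemma cvg_series_nneseries u l : (forall n, 0 <= u n) ->
  (\sum_(k <oo) (u k)%:E = l%:E)%E -> series u n @[n --> \oo] --> l.
Proof.
move=> u0 ul.
have : (\sum_(0 <= k < n) (u k)%:E)%E @[n --> \oo] --> l%:E.
  by rewrite -ul; apply: is_cvg_nneseries => k _ _; rewrite lee_fin.
under eq_fun do rewrite sumEFin.
by move/fine_cvgP => [_].
Qed.

Lemma nneseries_cvg_series u l : (forall n, 0 <= u n) ->
  series u n @[n --> \oo] --> l -> (\sum_(k <oo) (u k)%:E = l%:E)%E.
Proof.
move=> u0 ul; apply: cvg_lim => //; under eq_fun do rewrite sumEFin.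
by apply: cvg_EFin => //; near=> n.
Unshelve. all: end_near. Qed.

Lemma cvg_seriesZ (c : R) u v l : series u n @[n --> \oo] --> l ->
  (forall k, v k = c * u k) -> series v n @[n --> \oo] --> c * l.
Proof.
move=> ul /funext ->; under eq_fun do rewrite /series/= -mulr_sumr.
by apply: cvgM => //; exact: cvg_cst.
Qed.

Lemma series_le_lim u l n : (forall n, 0 <= u n) ->
  series u n @[n --> \oo] --> l -> series u n <= l.
Proof.
move=> u0 ul; rewrite -(cvg_lim _ ul)//; apply: nondecreasing_cvgn_le.
  by apply: nondecreasing_series => k _ _.
by apply/cvg_ex; exists l.
Qed.

Lemma cvg_big_sum (I : Type) (r : seq I) (f : I -> R^nat) (g : I -> R) :
  (forall i, f i n @[n --> \oo] --> g i) ->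
  \sum_(i <- r) f i n @[n --> \oo] --> \sum_(i <- r) g i.
Proof.
move=> fg; elim: r => [|i r IHr].
  by rewrite big_nil; under eq_fun do rewrite big_nil; exact: cvg_cst.
by rewrite big_cons; under eq_fun do rewrite big_cons; exact: cvgD.
Qed.

Lemma cvg_big_prod (I : Type) (r : seq I) (f : I -> R^nat) (g : I -> R) :
  (forall i, f i n @[n --> \oo] --> g i) ->
  \prod_(i <- r) f i n @[n --> \oo] --> \prod_(i <- r) g i.
Proof.
move=> fg; elim: r => [|i r IHr].
  by rewrite big_nil; under eq_fun do rewrite big_nil; exact: cvg_cst.
by rewrite big_cons; under eq_fun do rewrite big_cons; exact: cvgM.
Qed.

(* Tannery's theorem. *)
Lemma cvg_series_dominated (f : nat -> R^nat) u D :
  (forall l, f n l @[n --> \oo] --> u l) -> (forall n l, `|f n l| <= D l) ->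
  cvgn (series D) ->
  cvgn (series u) /\ \sum_(0 <= l < n) f n l @[n --> \oo] --> limn (series u).
Proof.
move=> fu fD cD.
have uD l : `|u l| <= D l.
  have h : `|f n l| @[n --> \oo] --> `|u l| by apply: cvg_norm.
  rewrite -(cvg_lim _ h)//; apply: limr_le; first by apply/cvg_ex; exists `|u l|.
  by near=> n.
have D0 l : 0 <= D l by apply: le_trans (uD l).
have cu : cvgn (series u).
  by apply: normed_cvg; apply: series_le_cvg cD => n //=.
split => //; apply/cvgrPdist_le => e e0.
have e30 : 0 < e / 4 by rewrite divr_gt0.
have [N _ HN] : \forall n \near \oo, limn (series D) - series D n <= e / 4.
  move/cvgrPdist_le : cD => /(_ _ e30); apply: filterS => n.
  exact/le_trans/ler_norm.
have tail n : (N <= n)%N -> \sum_(N <= l < n) D l <= e / 4.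
  move=> Nn; apply: le_trans (HN _ (leqnn N)).
  rewrite lerBrDl -[leLHS](big_cat_nat (leq0n N) Nn)/=.
  exact: (@series_le_lim D).
have cN : \sum_(0 <= l < N) `|u l - f n l| @[n --> \oo] --> \sum_(0 <= l < N) (0 : R).
  apply: cvg_big_sum => l; rewrite -(normr0 R) -(subrr (u l)).
  by apply: cvg_norm; apply: cvgB => //; exact: cvg_cst.
rewrite big1_eq in cN.
near=> n.
have Nn : (N <= n)%N by near: n; exact: nbhs_infty_ge.
have H1 : `|limn (series u) - series u n| <= e / 4.
  by near: n; move/cvgrPdist_le : cu; apply.
have H2 : \sum_(0 <= l < N) `|u l - f n l| <= e / 4.
  near: n; move/cvgrPdist_le : cN => /(_ _ e30); apply: filterS => n.
  by rewrite sub0r normrN; apply: le_trans; exact: ler_norm.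
rewrite -(subrKA (series u n)) (le_trans (ler_normD _ _))//.
have -> : e = e / 4 + (e / 4 + (e / 4 + e / 4)) by field.
rewrite lerD// /series /= -sumrB (le_trans (ler_norm_sum _ _ _))//.
rewrite (big_cat_nat (leq0n N) Nn)/= lerD//.
apply: (@le_trans _ _ (\sum_(N <= l < n) (D l + D l))).
  by apply: ler_sum => l _; rewrite (le_trans (ler_normB _ _))// lerD.
by rewrite big_split lerD//= tail.
Unshelve. all: end_near. Qed.

(** Summation of a double series by antidiagonals. The partial sum of order n contains the first n -
    l terms of row l, each converging to the row sum, and [D] dominates the absolute partial sums of
    the rows. *)
Lemma cvg_series_diag (d : nat -> R^nat) u D :
  (forall l, series (d l) n @[n --> \oo] --> u l) ->
  (forall l n, \sum_(0 <= j < n) `|d l j| <= D l) -> cvgn (series D) ->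
  cvgn (series u) /\
  series (fun k => \sum_(l < k.+1) d l (k - l)%N) n @[n --> \oo] -->
    limn (series u).
Proof.
move=> du dD cD.
have [] := @cvg_series_dominated (fun n l => series (d l) (n - l)%N) u D.
- move=> l; rewrite -(cvg_shiftn l); under eq_fun do rewrite addnK.
  exact: du.
- by move=> n l; apply: le_trans (dD l (n - l)%N); exact: ler_norm_sum.
- exact: cD.
move=> cu cv; split => //.
suff -> : series (fun k => \sum_(l < k.+1) d l (k - l)%N) =
    (fun n => \sum_(0 <= l < n) series (d l) (n - l)%N) by [].
apply/funext => n; rewrite /series /= !big_mkord.
rewrite (sum_triangle n (fun e h => d h e)) (exchange_big_dep xpredT)//=.
apply: eq_bigr => h _; rewrite big_mkord (big_ord_widen n (fun e => d h e)) ?leq_subr//.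
by apply: eq_bigl => e; rewrite ltn_subRL addnC.
Qed.

End series_lemmas.

(** * Generating functions of the Laguerre polynomials *)

Section generating_function.
Context {R : realType}.
Implicit Types (a nu s w x y X : R).

Lemma nneseries_expR x : 0 <= x ->
  (\sum_(k <oo) (x ^+ k / k`!%:R)%:E = (expR x)%:E)%E.
Proof.
move=> x0; apply: nneseries_cvg_series => [n|]; first by rewrite divr_ge0 ?exprn_ge0.
exact: is_cvg_series_exp_coeff.
Qed.

(** Both sides times Gamma(s) are the integral of t^(s - 1) e^(-t) e^(t w), with e^(t w) expanded
    into its nonnegative series and integrated termwise. *)
Lemma cvg_binomial_series s w : 0 < s -> 0 <= w < 1 ->
  series (fun j => rising s j / j`!%:R * w ^+ j) n @[n --> \oo] -->
    (1 - w) `^ (- s).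
Proof.
move=> s0 /andP[w0 w1].
have G0 := Gamma_gt0 s0.
pose g (j : nat) (t : R) := ((w ^+ j / j`!%:R)%:E *
  (t `^ (s + j%:R - 1) * expR (- t))%:E)%E.
have sj j : 0 < s + j%:R by rewrite ltr_wpDr.
have wj j : 0 <= w ^+ j / j`!%:R by rewrite divr_ge0 ?exprn_ge0.
have E : (\int[@lebesgue_measure R]_(t in `]0%R, +oo[)
    (\sum_(j <oo) g j t) = (Gamma s * (1 - w) `^ (- s))%:E)%E.
  rewrite -integral_gamma_scale ?subr_gt0//.
  apply: eq_integral => t; rewrite inE/= in_itv/= andbT => t0.
  have -> : (- (t * (1 - w)) = - t + t * w) by ring.
  rewrite expRD mulrA EFinM -(nneseries_expR (mulr_ge0 (ltW t0) w0)).
  rewrite -nneseriesZl; last by move=> k _; rewrite lee_fin divr_ge0 ?exprn_ge0// mulr_ge0// ltW.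
  apply: eq_eseriesr => j _; rewrite /g -!EFinM; congr EFin.
  rewrite -addrA [_%:R - 1]addrC addrA.
  rewrite [t `^ (s - 1 + _)]powRD ?(gt_eqF t0) ?implybT//.
  rewrite powR_mulrn ?(ltW t0)// exprMn; ring.
rewrite integral_nneseries// in E; last 2 first.
- move=> j; apply: emeasurable_funM; first exact: measurable_cst.
  exact: measurable_gamma_fun.
- by move=> j t _; rewrite mule_ge0 ?lee_fin ?wj ?mulr_ge0 ?powR_ge0 ?expR_ge0.
have {}E : (\sum_(j <oo) (Gamma s * (rising s j / j`!%:R * w ^+ j))%:E =
    (Gamma s * (1 - w) `^ (- s))%:E)%E.
  rewrite -E; apply: eq_eseriesr => j _.
  rewrite /g ge0_integralZl//.
  - rewrite integral_gamma// -EFinM Gamma_rising//; congr EFin; ring.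
  - exact: measurable_gamma_fun.
  - by move=> t _; exact: gamma_fun_ge0.
  - by rewrite lee_fin wj.
have r0 j : 0 <= rising s j / j`!%:R * w ^+ j.
  by rewrite mulr_ge0 ?exprn_ge0// divr_ge0// ltW// rising_gt0.
move/cvg_series_nneseries : E => /(_ _)/wrap[].
  by move=> j; rewrite mulr_ge0 ?r0 ?ltW.
move=> cv.
rewrite -(mulKf (lt0r_neq0 G0) (_ `^ _)); apply: cvg_seriesZ cv _ => j.
by rewrite mulKf ?gt_eqF.
Qed.

Lemma laguerre_coef_ge0 nu k i : -1 < nu -> 0 <= laguerre_coef nu k i.
Proof.
move=> nu1; rewrite divr_ge0// ltW// rising_gt0// ltr_wpDr//.
by rewrite -ltrBlDr sub0r.
Qed.

Lemma laguerre_norm_le nu k X : -1 < nu ->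
  `|(laguerre nu k).[X]| <= (laguerre nu k).[- `|X| ].
Proof.
move=> nu1; rewrite !laguerreE (le_trans (ler_norm_sum _ _ _))//.
apply: ler_sum => i _; rewrite opprK normrM normrX normrN.
by rewrite ger0_norm// laguerre_coef_ge0.
Qed.

(** Each L_k is expanded in powers of X and the sum over k is taken at a fixed power: row l is a
    binomial series of parameter nu + 1 + l. The row sums then form an exponential series, and
    replacing X w by its absolute value gives the majorant. *)
Lemma cvg_laguerre_series nu X w : -1 < nu -> 0 <= w < 1 ->
  series (fun k => w ^+ k * (laguerre nu k).[X]) n @[n --> \oo] -->
    (1 - w) `^ (- (nu + 1)) * expR (- (X * w / (1 - w))).
Proof.
move=> nu1 /andP[w0 w1].
have nu0 : 0 < nu + 1 by rewrite -ltrBlDr sub0r.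
have w10 : 0 < 1 - w by rewrite subr_gt0.
pose c := (1 - w) `^ (- (nu + 1)).
have c0 : 0 <= c by exact: powR_ge0.
have nul l : 0 < nu + 1 + l%:R by rewrite ltr_wpDr.
have cE l : (1 - w) `^ (- (nu + 1 + l%:R)) = c / (1 - w) ^+ l.
  by rewrite opprD powRD ?(gt_eqF w10) ?implybT// powR_invn ?ltW.
have bin l := @cvg_binomial_series (nu + 1 + l%:R) w (nul l).
have bin0 l j : 0 <= rising (nu + 1 + l%:R) j / j`!%:R * w ^+ j.
  by rewrite mulr_ge0 ?exprn_ge0// divr_ge0// ltW// rising_gt0.
pose d l j := (- X * w) ^+ l / l`!%:R * (rising (nu + 1 + l%:R) j / j`!%:R * w ^+ j).
pose u l := (- X * w) ^+ l / l`!%:R * (1 - w) `^ (- (nu + 1 + l%:R)).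
pose D l := `|X * w| ^+ l / l`!%:R * (1 - w) `^ (- (nu + 1 + l%:R)).
have cvE x : series (fun l => x ^+ l / l`!%:R * (c / (1 - w) ^+ l)) n @[n --> \oo]
    --> c * expR (x / (1 - w)).
  apply: cvg_seriesZ (is_cvg_series_exp_coeff (x / (1 - w))) _ => l.
  by rewrite /exp_coeff/= exprMn exprVn; ring.
have [|||_ H] := @cvg_series_diag R d u D.
- by move=> l; apply: cvg_seriesZ (bin l _) _ => //; rewrite w0.
- move=> l n; rewrite /d; under eq_bigr do rewrite normrM (ger0_norm (bin0 _ _)).
  rewrite -mulr_sumr /D normrM normrX mulNr normrN normfV (ger0_norm (ler0n _ _)).
  rewrite ler_wpM2l ?divr_ge0 ?exprn_ge0//.
  by apply: (@series_le_lim _ _ _ n (bin0 l)); apply: bin; rewrite w0.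
- rewrite /D; under eq_fun do rewrite cE.
  by apply/cvg_ex; eexists; exact: cvE.
have uE : series u n @[n --> \oo] --> c * expR (- X * w / (1 - w)).
  rewrite (_ : u = (fun l => (- X * w) ^+ l / l`!%:R * (c / (1 - w) ^+ l))).
    exact: cvE.
  by apply/funext => l; rewrite /u cE.
move: H; rewrite (cvg_lim _ uE)// !mulNr; apply: cvg_trans; apply: near_eq_cvg.
near=> n; rewrite /series/=; apply: eq_bigr => k _.
rewrite laguerreE mulr_sumr; apply: eq_bigr => l _.
have lk : (l <= k)%N by rewrite -ltnS.
have -> : w ^+ k = w ^+ l * w ^+ (k - l) by rewrite -exprD subnKC.
by rewrite /d /laguerre_coef exprMn invfM; ring.
Unshelve. all: end_near. Qed.

Lemma rising_ge1 s n : 1 <= s -> 1 <= rising s n.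
Proof.
move=> s1; elim: n => [|n IHn]; first by rewrite rising0.
by rewrite risingSr mulr_ege1// ler_wpDr.
Qed.

Definition bessel_series a (Z : R) := fun m => Z ^+ m / (m`!%:R * rising (a + 1) m).

(* With Z = (z / 2)^2 this is Gamma (a + 1) (z / 2)^(- a) I_a(z), where I_a is
   the modified Bessel function. *)
Definition bessel a (Z : R) : R := limn (series (bessel_series a Z)).

Lemma bessel_series_ge0 a Z m : -1 < a -> 0 <= Z -> 0 <= bessel_series a Z m.
Proof.
move=> a1 Z0; rewrite divr_ge0 ?exprn_ge0// mulr_ge0// ltW// rising_gt0//.
by rewrite -ltrBlDr sub0r.
Qed.

Lemma is_cvg_bessel a Z : -1 < a -> 0 <= Z -> cvgn (series (bessel_series a Z)).
Proof.
move=> a1 Z0; have a0 : 0 < a + 1 by rewrite -ltrBlDr sub0r.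
(* Only the first factor a + 1 of the rising factorial can be less than 1, so c bounds all the
   inverses and the exponential series dominates. *)
pose c := 1 + (a + 1)^-1.
have c1 : 1 <= c by rewrite lerDl invr_ge0 ltW.
have rc m : (rising (a + 1) m)^-1 <= c.
  case: m => [|m]; first by rewrite rising0 invr1.
  rewrite risingSl invfM -[c]mulr1 ler_pM//.
  - by rewrite invr_ge0 ltW.
  - by rewrite invr_ge0 ltW// rising_gt0// addr_gt0.
  - by rewrite lerDr.
  have r1 : 1 <= rising (a + 1 + 1) m by rewrite rising_ge1// lerDr ltW.
  by rewrite invf_le1// (lt_le_trans ltr01).
apply: (@series_le_cvg _ _ (fun m => c * exp_coeff Z m)) => //.
- by move=> m; exact: bessel_series_ge0.
- by move=> m; rewrite mulr_ge0 ?(le_trans ler01 c1)// /exp_coeff/= divr_ge0 ?exprn_ge0.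
- move=> m; rewrite /bessel_series /exp_coeff/= invfM mulrA mulrC ler_wpM2r//.
  by rewrite divr_ge0 ?exprn_ge0.
by apply/cvg_ex; exists (c * expR Z); apply: cvg_seriesZ (is_cvg_series_exp_coeff Z) _.
Qed.

(** The product formula turns the left-hand side into a double series indexed by m and n - m, whose
    row m is the generating function of order a + 2 m at x + y. Evaluation at -(x + y), where all
    terms are nonnegative, gives the majorant; it has the same shape, so one computation sums
    both. *)
Lemma hille_hardy a x y w : -1 < a -> 0 <= x -> 0 <= y -> 0 <= w < 1 ->
  series (fun n => w ^+ n * (n`!%:R / rising (a + 1) n *
    (laguerre a n).[x] * (laguerre a n).[y])) n @[n --> \oo] -->
  (1 - w) `^ (- (a + 1)) * expR (- ((x + y) * w / (1 - w))) *
    bessel a (x * y * w / (1 - w) ^+ 2).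
Proof.
move=> a1 x0 y0 /andP[w0 w1].
have w10 : 0 < 1 - w by rewrite subr_gt0.
have am (m : nat) : -1 < a + (2 * m)%:R by rewrite ltr_wpDr.
pose c := (1 - w) `^ (- (a + 1)).
have c0 : 0 <= c by exact: powR_ge0.
have cE m : (1 - w) `^ (- (a + (2 * m)%:R + 1)) = c / (1 - w) ^+ (2 * m).
  rewrite addrAC opprD powRD ?(gt_eqF w10) ?implybT// powR_invn ?ltW//.
pose B := bessel_series a (x * y * w).
have B0 m : 0 <= B m by apply: bessel_series_ge0 => //; rewrite !mulr_ge0.
pose e (X : R) := expR (- (X * w / (1 - w))).
pose d (m j : nat) : R := B m * (w ^+ j * (laguerre (a + (2 * m)%:R) j).[x + y]).
pose u (m : nat) : R := B m * ((1 - w) `^ (- (a + (2 * m)%:R + 1)) * e (x + y)).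
pose D (m : nat) : R := B m * ((1 - w) `^ (- (a + (2 * m)%:R + 1)) * e (- (x + y))).
have lag m X := @cvg_laguerre_series (a + (2 * m)%:R) X w (am m).
have cvE X : series (fun m => B m * ((1 - w) `^ (- (a + (2 * m)%:R + 1)) * e X)) n
    @[n --> \oo] --> c * e X * bessel a (x * y * w / (1 - w) ^+ 2).
  apply: cvg_seriesZ (is_cvg_bessel a1 _) _ => [|m].
    by rewrite divr_ge0 ?exprn_ge0 ?mulr_ge0// ltW.
  by rewrite cE /B /bessel_series exprM (exprMn _ (x * y * w)) exprVn; ring.
have [|||_ H] := @cvg_series_diag R d u D.
- by move=> m; apply: cvg_seriesZ (lag m _ _) _ => //; rewrite w0.
- move=> m n; rewrite /d; under eq_bigr do rewrite normrM (ger0_norm (B0 _)).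
  rewrite -mulr_sumr /D ler_wpM2l//.
  apply: (@le_trans _ _ (series (fun j => w ^+ j *
      (laguerre (a + (2 * m)%:R) j).[- (x + y)]) n)).
    rewrite /series/=; apply: ler_sum => j _.
    rewrite normrM normrX (ger0_norm w0) ler_wpM2l ?exprn_ge0//.
    have := @laguerre_norm_le (a + (2 * m)%:R) j (x + y) (am m).
    by rewrite (ger0_norm (addr_ge0 x0 y0)).
  apply: series_le_lim; last by apply: lag; rewrite w0.
  move=> j; rewrite mulr_ge0 ?exprn_ge0//.
  have := @laguerre_norm_le (a + (2 * m)%:R) j (x + y) (am m).
  by rewrite (ger0_norm (addr_ge0 x0 y0)); exact: le_trans.
- by apply/cvg_ex; eexists; exact: cvE.
move: H; rewrite (cvg_lim _ (cvE (x + y)))//.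
apply: cvg_trans; apply: near_eq_cvg; near=> n; rewrite /series/=.
apply: eq_bigr => k _; rewrite laguerre_product// mulr_sumr.
apply: eq_bigr => m _; have mk : (m <= k)%N by rewrite -ltnS.
have -> : w ^+ k = w ^+ m * w ^+ (k - m) by rewrite -exprD subnKC.
by rewrite /d /B /bessel_series (exprMn _ _ w); ring.
Unshelve. all: end_near. Qed.

End generating_function.

(** * Growth of the Bessel function *)

Section bessel_bound.
Context {R : realType}.
Implicit Types (a b s t x y z : R).

Lemma powR_amgm x y t : 0 <= x -> 0 <= y -> 0 <= t <= 1 ->
  x `^ (1 - t) * y `^ t <= (1 - t) * x + t * y.
Proof.
move=> x0 y0 /andP[t0 t1].
have [->|tn0] := eqVneq t 0.
  by rewrite subr0 !powRr0 powRr1// mul0r addr0 mul1r mulr1.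
have [->|tn1] := eqVneq t 1.
  by rewrite subrr !powRr0 powRr1// mul0r add0r !mul1r.
have t0' : 0 < t by rewrite lt_neqAle eq_sym tn0.
have t1' : 0 < 1 - t by rewrite subr_gt0 lt_neqAle tn1.
have := @conjugate_powR R (x `^ (1 - t)) (y `^ t) (1 - t)^-1 t^-1.
rewrite !powR_ge0 !invrK !invr_gt0 -!powRrM !divff ?gt_eqF// !powRr1//.
by move=> /(_ isT isT t1' t0'); rewrite subrK => /(_ erefl); rewrite [x * _]mulrC [y * t]mulrC.
Qed.

(** Factor by factor, x + t + j is the mean of x + j and x + 1 + j with weights 1 - t and t, and
    weighted AM-GM applies. *)
Lemma rising_logconcave x t m : 0 < x -> 0 <= t <= 1 ->
  rising x m `^ (1 - t) * rising (x + 1) m `^ t <= rising (x + t) m.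
Proof.
move=> x0 t01; have t0 : 0 <= t by case/andP : t01.
elim: m => [|m IHm]; first by rewrite !rising0 !powR1 mulr1.
have xm : 0 <= x + m%:R by rewrite addr_ge0// ltW.
have x1 : 0 < x + 1 by rewrite addr_gt0.
have r0 (y : R) k : 0 < y -> 0 <= rising y k by move=> y0; rewrite ltW// rising_gt0.
have xm1 : 0 <= x + 1 + m%:R by rewrite addr_ge0// ltW.
rewrite !risingSr !powRM ?r0//.
rewrite mulrACA ler_pM// ?mulr_ge0 ?powR_ge0//.
have -> : x + t + m%:R = (1 - t) * (x + m%:R) + t * (x + 1 + m%:R) by ring.
exact: powR_amgm.
Qed.

Lemma fact_double m : (2 * m)`!%:R = 4 ^+ m * m`!%:R * rising (2^-1) m :> R.
Proof.
elim: m => [|m IHm]; first by rewrite muln0 !fact0 rising0 !mul1r.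
rewrite mulnS !addSn add0n !factS !natrM IHm exprS risingSr.
rewrite -(natr1 (2 * m).+1) -(natr1 (2 * m)) -(natr1 m) natrM; by field.
Qed.

(** For N = 0 this is the duplication formula. Passing from N to N + 1 multiplies the left side by 2
    m + N + 1 <= 2 (N + 1/2 + m), while the rising factorial gains (N + 1/2 + m) / (N + 1/2); the
    constant grows by 2 (N + 1/2). *)
Lemma rising_fact_bound N : exists2 C : R, 0 < C & forall m,
  (2 * m + N)`!%:R <= C * (4 ^+ m * m`!%:R * rising (N%:R + 2^-1) m).
Proof.
elim: N => [|N [C C0 IHN]].
  by exists 1 => // m; rewrite addn0 fact_double add0r mul1r.
exists (2 * (N%:R + 2^-1) * C) => [|m]; first by rewrite !mulr_gt0// addr_gt0.
have h : N%:R + 2^-1 != 0 :> R by rewrite gt_eqF// addr_gt0.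
have -> : rising (N.+1%:R + 2^-1) m =
    rising (N%:R + 2^-1) m * (N%:R + 2^-1 + m%:R) / (N%:R + 2^-1) :> R.
  by rewrite -risingSr risingSl mulrC mulKf// -(natr1 N); congr rising; ring.
rewrite addnS factS natrM.
apply: (@le_trans _ _ (2 * (N%:R + 2^-1 + m%:R) *
   (C * (4 ^+ m * m`!%:R * rising (N%:R + 2^-1) m)))); last first.
  move: (N%:R + 2^-1) h => r h.
  by apply: eqW; field.
rewrite ler_pM// -(natr1 (2 * m + N)) natrD natrM; have := ler0n R N; lra.
Qed.

(** At half-integer order the m-th term is comparable with the term of index 2 m + N of the
    exponential series, and distinct m give distinct indices. *)
Lemma bessel_bound_nat N : exists2 C : R, 0 < C & forall z m, 0 <= z ->
  z ^+ N * bessel_series (N%:R - 2^-1) (z ^+ 2 / 4) m <=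
    C * (z ^+ (2 * m + N) / (2 * m + N)`!%:R).
Proof.
have [C C0 HC] := rising_fact_bound N; exists C => // z m z0.
rewrite /bessel_series.
have -> : N%:R - 2^-1 + 1 = N%:R + 2^-1 :> R by field.
rewrite exprMn -exprM exprVn.
have f0 : 0 < (2 * m + N)`!%:R :> R by rewrite ltr0n fact_gt0.
have r0 : 0 < rising (N%:R + 2^-1) m :> R by rewrite rising_gt0// ltr_wpDl.
have m0 : 0 < m`!%:R :> R by rewrite ltr0n fact_gt0.
have e0 : 0 < 4 ^+ m :> R by rewrite exprn_gt0.
rewrite exprD [z ^+ N * _]mulrC.
have -> : z ^+ (2 * m) / 4 ^+ m / (m`!%:R * rising (N%:R + 2^-1) m) * z ^+ N =
   z ^+ (2 * m) * z ^+ N * (4 ^+ m * m`!%:R * rising (N%:R + 2^-1) m)^-1.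
  by field; rewrite !gt_eqF.
rewrite mulrCA ler_wpM2l ?mulr_ge0 ?exprn_ge0//.
by rewrite ler_pdivlMr// ler_pdivrMl ?mulr_gt0// mulrC.
Qed.

Lemma series_expR_sub N z n : 0 <= z ->
  \sum_(0 <= m < n) (z ^+ (2 * m + N) / (2 * m + N)`!%:R) <= expR z.
Proof.
move=> z0; have e0 k : 0 <= exp_coeff z k.
  by rewrite /exp_coeff/= divr_ge0 ?exprn_ge0.
apply: (@le_trans _ _ (series (exp_coeff z) (2 * n + N)%N)); last first.
  by apply: (series_le_lim _ e0); exact: is_cvg_series_exp_coeff.
elim: n => [|n IHn]; first by rewrite big_nil; exact: sumr_ge0.
rewrite big_nat_recr//= mulnS -addnA add2n !seriesSr /=.
apply: (@le_trans _ _ (series (exp_coeff z) (2 * n + N)%N + exp_coeff z (2 * n + N)%N)).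
  by rewrite lerD.
by rewrite lerDl.
Qed.

(* With a + 1/2 = N + t, interpolate term by term between the orders N - 1/2 and
   N + 1/2, for which the series is dominated by a part of that of expR z. *)
Lemma bessel_bound a : - (1 / 2) <= a -> exists2 C : R, 0 < C & forall z, 0 < z ->
  z `^ (a + 1 / 2) * bessel a (z ^+ 2 / 4) <= C * expR z.
Proof.
move=> ha; have b0 : 0 <= a + 1 / 2 by lra.
have a1 : -1 < a by lra.
have [N /andP[Na aN]] : exists N : nat, N%:R <= a + 1 / 2 < N.+1%:R.
  by exists (Num.truncn (a + 1 / 2)); rewrite truncn_itv.
pose t := a + 1 / 2 - N%:R.
have t01 : 0 <= t <= 1 by rewrite /t subr_ge0 Na/= lerBlDl; move: aN; rewrite -(natr1 N) => /ltW.
have [C C0 HC] := bessel_bound_nat N.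
have [C' C0' HC'] := bessel_bound_nat N.+1.
exists (C + C') => [|z z0]; first exact: addr_gt0.
have Z0 : 0 <= z ^+ 2 / 4 by rewrite divr_ge0 ?exprn_ge0// ltW.
have term m : z `^ (a + 1 / 2) * bessel_series a (z ^+ 2 / 4) m <=
   (1 - t) * (C * (z ^+ (2 * m + N) / (2 * m + N)`!%:R)) +
   t * (C' * (z ^+ (2 * m + N.+1) / (2 * m + N.+1)`!%:R)).
  have [t0 t1] := andP t01.
  apply: (@le_trans _ _ ((1 - t) * (z ^+ N * bessel_series (N%:R - 2^-1) (z ^+ 2 / 4) m)
     + t * (z ^+ N.+1 * bessel_series (N.+1%:R - 2^-1) (z ^+ 2 / 4) m))); last first.
    by apply: lerD; apply: ler_wpM2l; rewrite ?subr_ge0//; [apply: HC|apply: HC']; exact: ltW.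
  have N1 : -1 < N%:R - 2^-1 :> R by rewrite ltrBrDl; have := ler0n R N; lra.
  have N2 : -1 < N.+1%:R - 2^-1 :> R by rewrite ltrBrDl; have := ler0n R N.+1; lra.
  apply: le_trans (powR_amgm _ _ t01); last 2 first.
  - by rewrite mulr_ge0 ?exprn_ge0 ?bessel_series_ge0// ltW.
  - by rewrite mulr_ge0 ?exprn_ge0 ?bessel_series_ge0// ltW.
  rewrite (powRM _ (exprn_ge0 N (ltW z0)) (bessel_series_ge0 m N1 Z0)).
  rewrite (powRM _ (exprn_ge0 N.+1 (ltW z0)) (bessel_series_ge0 m N2 Z0)).
  rewrite mulrACA; apply: ler_pM; rewrite ?powR_ge0 ?bessel_series_ge0//.
    rewrite -(powR_mulrn N (ltW z0)) -(powR_mulrn N.+1 (ltW z0)) -!powRrM -powRD ?(gt_eqF z0) ?implybT//.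
    by apply: eqW; congr (_ `^ _);
       rewrite /t -(natr1 N); ring.
  rewrite /bessel_series.
  have E1 : N%:R - 2^-1 + 1 = N%:R + 2^-1 :> R by field.
  have E2 : N.+1%:R - 2^-1 + 1 = N%:R + 2^-1 + 1 :> R by rewrite -(natr1 N); field.
  have E3 : a + 1 = N%:R + 2^-1 + t by rewrite /t; field.
  have x0 : 0 < N%:R + 2^-1 :> R by rewrite ltr_wpDl.
  have x1 : 0 < N%:R + 2^-1 + 1 :> R by rewrite addr_gt0.
  have x2 : 0 < N%:R + 2^-1 + t by rewrite ltr_wpDr.
  have m0 : 0 < m`!%:R :> R by rewrite ltr0n fact_gt0.
  rewrite E1 E2 E3; set q := N%:R + 2^-1 in x0 x1 x2 *.
  have K (u : R) : 0 <= u -> u `^ (1 - t) * u `^ t = u.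
    by move=> u0; rewrite -powRD subrK ?powRr1 ?oner_eq0.
  rewrite !powRM ?(exprn_ge0 m Z0) ?invr_ge0 ?mulr_ge0 ?(ltW m0) ?(ltW (rising_gt0 _ _))//.
  rewrite mulrACA K// ?(exprn_ge0 m Z0)// ler_wpM2l ?(exprn_ge0 m Z0)//.
  rewrite -!powR_inv1 ?mulr_ge0 ?(ltW m0) ?(ltW (rising_gt0 _ _))//.
  rewrite -!powRrM ![-1 * _]mulrC !powRrM !powR_inv1 ?powR_ge0// ?mulr_ge0 ?(ltW m0) ?(ltW (rising_gt0 _ _))//.
  rewrite -invfM lef_pV2 ?posrE ?mulr_gt0 ?powR_gt0 ?mulr_gt0 ?rising_gt0//.
  rewrite !powRM ?(ltW m0) ?(ltW (rising_gt0 _ _))// mulrACA K ?(ltW m0)//.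
  by rewrite ler_wpM2l ?(ltW m0)// rising_logconcave.
have [t0 t1] := andP t01.
have cv : z `^ (a + 1 / 2) * series (bessel_series a (z ^+ 2 / 4)) n @[n --> \oo] -->
    z `^ (a + 1 / 2) * bessel a (z ^+ 2 / 4).
  by apply: cvgM; [exact: cvg_cst|exact: is_cvg_bessel].
rewrite -(cvg_lim _ cv)//; apply: limr_le; first by apply/cvg_ex; eexists; exact: cv.
near=> n; rewrite /series/= mulr_sumr.
apply: (@le_trans _ _ ((1 - t) * (C * expR z) + t * (C' * expR z))); last first.
  have := expR_gt0 z; set E := expR z => E0.
  rewrite [(C + C') * _]mulrDl lerD//.
    by rewrite ler_piMl ?mulr_ge0 ?(ltW C0) ?(ltW E0)// gerBl.
  by rewrite ler_piMl ?mulr_ge0 ?(ltW C0') ?(ltW E0).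
apply: (le_trans (ler_sum _ (fun m _ => term m))).
rewrite big_split/= -!mulr_sumr lerD// ler_wpM2l ?subr_ge0// ler_wpM2l ?(ltW C0) ?(ltW C0')//;
  by apply: series_expR_sub; exact: ltW.
Unshelve. all: end_near. Qed.

End bessel_bound.

(** * The one-dimensional heat kernel *)

Section one_dimensional_heat_kernel.
Context {R : realType}.
Implicit Types (a t u v : R).

Lemma phi1_mul a k u v : -1 < a ->
  phi1 a k u * phi1 a k v =
  2 / Gamma (a + 1) * (u `^ (a + 1 / 2) * v `^ (a + 1 / 2)) *
    expR (- ((u ^+ 2 + v ^+ 2) / 2)) *
    (k`!%:R / rising (a + 1) k * (laguerre a k).[u ^+ 2] * (laguerre a k).[v ^+ 2]).
Proof.
move=> a1; have a0 : 0 < a + 1 by rewrite -ltrBlDr sub0r.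
have r0 := rising_gt0 k a0; have g0 := Gamma_gt0 a0.
have -> : - ((u ^+ 2 + v ^+ 2) / 2) = - (u ^+ 2 / 2) + - (v ^+ 2 / 2) by field.
rewrite expRD /phi1 Gamma_fact -addrA [k%:R + _]addrC Gamma_rising//.
set c := 2 * _ / _.
have c0 : 0 <= c by rewrite divr_ge0 ?mulr_ge0// ltW// mulr_gt0.
have f0 : k`!%:R != 0 :> R by rewrite pnatr_eq0 -lt0n fact_gt0.
set Lu := (laguerre a k).[u ^+ 2]; set Lv := (laguerre a k).[v ^+ 2].
set pu := u `^ _; set pv := v `^ _; set eu := expR _; set ev := expR _.
transitivity (Num.sqrt c ^+ 2 * (Lu * pu * eu * (Lv * pv * ev))); first by ring.
by rewrite sqr_sqrtr// /c; field; rewrite !gt_eqF.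
Qed.

Lemma powR_inv (x b : R) : 0 <= x -> x^-1 `^ b = (x `^ b)^-1.
Proof. by move=> x0; rewrite -(powR_inv1 x0) -powRrM mulN1r powRN. Qed.

Definition heat1_term a t u v (k : nat) : R :=
  expR (- (t * (4 * k%:R + 2 * a + 2))) * phi1 a k u * phi1 a k v.

Definition heat1 a t u v : R := limn (series (heat1_term a t u v)).

(** The closed form of the kernel given by the Hille-Hardy formula at w = e^(-4t), with arguments
    u^2 and v^2. *)
Definition mehler a t u v : R := let w := expR (- (4 * t)) in
  2 / Gamma (a + 1) * (u `^ (a + 1 / 2) * v `^ (a + 1 / 2)) *
    expR (- ((u ^+ 2 + v ^+ 2) / 2)) * expR (- (t * (2 * a + 2))) *
  ((1 - w) `^ (- (a + 1)) * expR (- ((u ^+ 2 + v ^+ 2) * w / (1 - w))) *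
    bessel a (u ^+ 2 * v ^+ 2 * w / (1 - w) ^+ 2)).

Lemma cvg_heat1_mehler a t u v : -1 < a -> 0 < t ->
  series (heat1_term a t u v) n @[n --> \oo] --> mehler a t u v.
Proof.
move=> a1 t0; rewrite /mehler; set w := expR (- (4 * t)); set c := 2 / _ * _ * _ * _.
have w01 : 0 <= w < 1 by rewrite expR_ge0 expR_lt1 oppr_lt0 mulr_gt0.
apply: cvg_seriesZ (hille_hardy a1 (sqr_ge0 u) (sqr_ge0 v) w01) _ => k.
rewrite /heat1_term -(mulrA (expR _) (phi1 a k u)) phi1_mul// /c.
have -> : - (t * (4 * k%:R + 2 * a + 2)) = k%:R * - (4 * t) + - (t * (2 * a + 2)) by ring.
by rewrite expRD expRM_natl -/w; ring.
Qed.

Lemma heat1E a t u v : -1 < a -> 0 < t -> heat1 a t u v = mehler a t u v.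
Proof. by move=> a1 t0; apply: cvg_lim => //; exact: cvg_heat1_mehler. Qed.

Lemma is_cvg_heat1 a t u v : -1 < a -> 0 < t ->
  series (heat1_term a t u v) n @[n --> \oo] --> heat1 a t u v.
Proof. by move=> a1 t0; rewrite heat1E//; exact: cvg_heat1_mehler. Qed.

Lemma bessel_ge0 a Z : -1 < a -> 0 <= Z -> 0 <= bessel a Z.
Proof.
move=> a1 Z0; apply: limr_ge; first exact: is_cvg_bessel.
by near=> n; apply: sumr_ge0 => k _; exact: bessel_series_ge0.
Unshelve. all: end_near. Qed.

Lemma heat1_ge0 a t u v : -1 < a -> 0 < t -> 0 <= heat1 a t u v.
Proof.
move=> a1 t0; have a0 : 0 < a + 1 by rewrite -ltrBlDr sub0r.
rewrite heat1E// /mehler; set w := expR (- (4 * t)).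
have w1 : 0 < 1 - w by rewrite subr_gt0 expR_lt1 oppr_lt0 mulr_gt0.
rewrite !mulr_ge0 ?powR_ge0 ?expR_ge0 ?invr_ge0 ?(ltW (Gamma_gt0 _))//.
apply: bessel_ge0 => //.
apply: mulr_ge0; last by rewrite invr_ge0 sqr_ge0.
by rewrite mulr_ge0 ?expR_ge0// mulr_ge0 ?sqr_ge0.
Qed.

Lemma heat1_sym a t u v : heat1 a t u v = heat1 a t v u.
Proof.
by congr (limn (series _)); apply/funext => k; rewrite /heat1_term -mulrA [phi1 a k u * _]mulrC mulrA.
Qed.

(** In hyperbolic terms [htau t] is tanh t and [hrho t] is 1 / (2 sinh (2t)). *)
Definition htau t : R := (1 - expR (- (2 * t))) / (1 + expR (- (2 * t))).
Definition hrho t : R := expR (- (2 * t)) / (1 - expR (- (2 * t)) ^+ 2).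

(* In terms of q = e^(-2t) and z = 2 u v q / (1 - q^2), the kernel is
   (q / (1 - q^2))^(1/2) z^(a + 1/2) bessel a (z^2 / 4) exp(- (u^2 + v^2)
   (1 + q^2) / (2 (1 - q^2))) up to a constant. *)
Lemma heat1_le a : - (1 / 2) <= a -> exists2 A : R, 0 < A &
  forall t u v, 0 < t -> 0 < u -> 0 < v ->
  heat1 a t u v <= A * (hrho t `^ (1 / 2) *
    expR (- (((u - v) ^+ 2 / htau t + htau t * (u + v) ^+ 2) / 4))).
Proof.
move=> ha; have a1 : -1 < a by lra.
have a0 : 0 < a + 1 by lra.
have [C C0 HC] := bessel_bound ha.
have g0 := Gamma_gt0 a0.
exists (2 / Gamma (a + 1) * C) => [|t u v t0 u0 v0].
  by rewrite mulr_gt0// divr_gt0.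
rewrite heat1E// /mehler /htau /hrho.
have -> : - (4 * t) = 2%:R * - (2 * t) by ring.
rewrite expRM_natl; set q := expR (- (2 * t)).
have q0 : 0 < q by exact: expR_gt0.
have q1 : 0 < 1 - q by rewrite subr_gt0 expR_lt1 oppr_lt0 mulr_gt0.
have q2 : 0 < 1 + q by rewrite addr_gt0.
have q12 : 1 - q ^+ 2 = (1 - q) * (1 + q) by ring.
have q3 : 0 < 1 - q ^+ 2 by rewrite q12 mulr_gt0.
pose z := 2 * u * v * q / (1 - q ^+ 2).
have z0 : 0 < z by rewrite divr_gt0// !mulr_gt0.
have -> : u ^+ 2 * v ^+ 2 * q ^+ 2 / (1 - q ^+ 2) ^+ 2 = z ^+ 2 / 4.
  by rewrite /z; field; rewrite gt_eqF.
have -> : expR (- (t * (2 * a + 2))) = q `^ (a + 1).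
  by rewrite /q -expRM; congr expR; ring.
set b := a + 1 / 2; set rho := q / (1 - q ^+ 2).
have rho0 : 0 < rho by rewrite divr_gt0.
have b0 : 0 <= b by rewrite /b; lra.
have uvE : u `^ b * v `^ b = z `^ b * (2 * rho) `^ (- b).
  rewrite powRN -powRM ?(ltW u0) ?(ltW v0)//.
  have -> : u * v = z / (2 * rho) by rewrite /z /rho; field; rewrite !gt_eqF.
  have i0 : 0 <= (2 * rho)^-1 by rewrite invr_ge0 mulr_ge0// ltW.
  rewrite (powRM b (ltW z0) i0); congr (_ * _).
  by rewrite powR_inv// mulr_ge0// ltW.
have qE : q `^ (a + 1) * (1 - q ^+ 2) `^ (- (a + 1)) = rho `^ (a + 1).
  have i0 : 0 <= (1 - q ^+ 2)^-1 by rewrite invr_ge0 ltW.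
  rewrite powRN /rho (powRM (a + 1) (ltW q0) i0); congr (_ * _).
  by rewrite powR_inv// ltW.
have eE : expR z * (expR (- ((u ^+ 2 + v ^+ 2) / 2)) *
    expR (- ((u ^+ 2 + v ^+ 2) * q ^+ 2 / (1 - q ^+ 2)))) =
    expR (- (((u - v) ^+ 2 / ((1 - q) / (1 + q)) +
      (1 - q) / (1 + q) * (u + v) ^+ 2) / 4)).
  rewrite -!expRD; congr expR; rewrite /z q12; field.
  by rewrite !gt_eqF.
rewrite uvE -eE.
set e1 := expR (- ((u ^+ 2 + v ^+ 2) / 2)); set e2 := expR (- (_ * q ^+ 2 / _)).
have rhoE : rho `^ (a + 1) * (2 * rho) `^ (- b) <= rho `^ (1 / 2).
  have -> : (2 * rho) `^ (- b) = 2 `^ (- b) * rho `^ (- b).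
    by rewrite powRM// ltW.
  rewrite mulrCA -powRD ?(gt_eqF rho0) ?implybT//.
  have -> : a + 1 - b = 1 / 2 by rewrite /b; field.
  rewrite ler_piMl ?powR_ge0// -[leRHS](powRr0 2) ler_powR ?ler1n//.
  by rewrite oppr_le0.
have -> : 2 / Gamma (a + 1) * (z `^ b * (2 * rho) `^ (- b)) * e1 * q `^ (a + 1) *
  ((1 - q ^+ 2) `^ (- (a + 1)) * e2 * bessel a (z ^+ 2 / 4)) =
  2 / Gamma (a + 1) * ((rho `^ (a + 1) * (2 * rho) `^ (- b)) *
    ((z `^ b * bessel a (z ^+ 2 / 4)) * (e1 * e2))).
  by rewrite -qE; ring.
have -> : 2 / Gamma (a + 1) * C * (rho `^ (1 / 2) * (expR z * (e1 * e2))) =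
  2 / Gamma (a + 1) * (rho `^ (1 / 2) * ((C * expR z) * (e1 * e2))) by ring.
rewrite ler_wpM2l ?divr_ge0 ?(ltW g0)// ler_pM ?mulr_ge0 ?powR_ge0 ?expR_ge0//.
  by apply: bessel_ge0 => //; rewrite divr_ge0// exprn_ge0// ltW.
by rewrite ler_wpM2r ?mulr_ge0 ?expR_ge0// HC.
Qed.

Lemma htau_gt0 t : 0 < t -> 0 < htau t.
Proof.
move=> t0; apply: divr_gt0; last by rewrite addr_gt0 ?expR_gt0.
by rewrite subr_gt0 expR_lt1 oppr_lt0 mulr_gt0.
Qed.

Lemma hrho_ge0 t : 0 < t -> 0 <= hrho t.
Proof.
move=> t0; rewrite divr_ge0 ?expR_ge0// subr_ge0 -expRM_natl expR_le1.
by rewrite mulrN oppr_le0 !mulr_ge0// ltW.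
Qed.

Lemma hrho_le t : 0 < t -> hrho t <= expR (- t) / t.
Proof.
move=> t0; rewrite /hrho -expRM_natl.
(* From e^(-4t) <= e^(-t) and 1 + t <= e^t. *)
have h : 1 - expR (2%:R * - (2 * t)) >= t * expR (- t).
  have -> : 2%:R * - (2 * t) = - t + (- (3 * t)) by ring.
  rewrite lerBrDr; apply: (@le_trans _ _ (expR (- t) * (t + 1))).
    rewrite expRD mulrDr mulr1 [t * _]mulrC lerD2l.
    by rewrite ler_piMr ?expR_ge0// expR_le1 oppr_le0 mulr_ge0 ?ltW.
  rewrite [t + 1]addrC.
  rewrite expRN ler_pdivrMl ?expR_gt0// mulr1; exact: expR_ge1Dx.
have p0 : 0 < 1 - expR (2%:R * - (2 * t)).
  by apply: lt_le_trans h; rewrite mulr_gt0 ?expR_gt0.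
rewrite ler_pdivrMr// mulrAC ler_pdivlMr//.
have -> : expR (- (2 * t)) = expR (- t) * expR (- t).
  by rewrite -expRD; congr expR; ring.
by rewrite -mulrA ler_wpM2l ?expR_ge0// mulrC.
Qed.

(** The product is 1 / (4 cosh^2 t). A Gaussian of variance proportional to [htau t] has mass of
    order [htau t ^ (1/2)], so this bound makes the mass of the kernel in one variable bounded as t
    tends to 0. *)
Lemma hrho_htau_le t : 0 < t -> hrho t * htau t <= expR (- (2 * t)).
Proof.
move=> t0; rewrite /hrho /htau; set q := expR (- (2 * t)).
have q0 : 0 < q by exact: expR_gt0.
have q1 : 0 < 1 - q by rewrite subr_gt0 expR_lt1 oppr_lt0 mulr_gt0.
have q2 : 0 < 1 + q by rewrite addr_gt0.
have -> : q / (1 - q ^+ 2) * ((1 - q) / (1 + q)) = q / (1 + q) ^+ 2.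
  have -> : 1 - q ^+ 2 = (1 - q) * (1 + q) by ring.
  by field; rewrite !gt_eqF.
rewrite ler_pdivrMr ?exprn_gt0// ler_peMr ?(ltW q0)//.
by rewrite exprn_ege1// lerDl ltW.
Qed.

Lemma integral_gauss_le (u c : R) : 0 < c ->
  (\int[@lebesgue_measure R]_(v in `]0%R, +oo[) (expR (- ((u - v) ^+ 2 / (4 * c))))%:E
    <= ((4 * pi * c) `^ (1 / 2))%:E)%E.
Proof.
(* The integrand is, up to normalization, the normal density of mean u and variance 2c, whose
   integral over the whole line is 1. *)
move=> c0; pose s := Num.sqrt (2 * c).
have s2 : s ^+ 2 = 2 * c by rewrite sqr_sqrtr// mulr_ge0// ltW.
have s0 : s != 0 by rewrite gt_eqF// sqrtr_gt0 mulr_gt0.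
have pk : normal_peak s = ((4 * pi * c) `^ (1 / 2))^-1.
  rewrite /normal_peak s2 div1r powR12_sqrt ?mulr_ge0 ?pi_ge0 ?(ltW c0)//.
  by congr (Num.sqrt _)^-1; rewrite -mulr_natr; ring.
have p0 : 0 < (4 * pi * c) `^ (1 / 2) by rewrite powR_gt0// !mulr_gt0// pi_gt0.
apply: (@le_trans _ _ (\int[@lebesgue_measure R]_v
   (((4 * pi * c) `^ (1 / 2))%:E * (normal_pdf u s v)%:E))%E); last first.
  rewrite ge0_integralZl//=.
  - by rewrite integral_normal_pdf mule1.
  - by apply/measurable_EFinP; exact: measurable_normal_pdf.
  - by move=> x _; rewrite lee_fin normal_pdf_ge0.
  - by rewrite lee_fin ltW.
rewrite [leRHS](_ : _ = (\int[@lebesgue_measure R]_v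
    (expR (- ((u - v) ^+ 2 / (4 * c))))%:E)%E).
  apply: ge0_subset_integral => //.
    apply/measurable_EFinP; apply: continuous_measurable_fun => v.
    apply: continuous_comp; last exact: continuous_expR.
    apply: continuousN; apply: cvgM; last exact: cvg_cst.
    under eq_fun do rewrite expr2.
    by apply: cvgM; (apply: cvgB; [exact: cvg_cst|exact: cvg_id]).
apply: eq_integral => v _; rewrite /normal_pdf (negbTE s0) -EFinM pk mulVKf ?gt_eqF//.
rewrite /normal_fun s2; congr (expR _)%:E; rewrite -mulr_natr.
by field; rewrite gt_eqF.
Qed.

End one_dimensional_heat_kernel.

(** * Orthonormality of the Laguerre functions *)

Section has_integral.
Context d (T : measurableType d) (R : realType) (mu : {measure set T -> \bar R}).
Variables (D : set T) (mD : measurable D).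
Implicit Types (f g : T -> R) (c : R).

(** Integrability and value travel together: the value alone would not allow sums and scalars to be
    taken out of the integral. *)
Definition has_integral f c :=
  mu.-integrable D (fun x => (f x)%:E) /\ (\int[mu]_(x in D) (f x)%:E = c%:E)%E.

Lemma has_integralZ k f c : has_integral f c -> has_integral (fun x => k * f x) (k * c).
Proof.
move=> [fi fc]; split.
  by apply: eq_integrable (integrableZl mD k fi) => // x _; rewrite EFinM.
by under eq_integral do rewrite EFinM; rewrite integralZl// fc.
Qed.

Lemma has_integral_sum I (s : seq I) (f : I -> T -> R) (c : I -> R) :
  (forall i, has_integral (f i) (c i)) ->
  has_integral (fun x => \sum_(i <- s) f i x) (\sum_(i <- s) c i).
Proof.
move=> fc; elim: s => [|i s [IH1 IH2]].
  split; last by rewrite big_nil; under eq_integral do rewrite big_nil; rewrite integral0.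
  by apply: eq_integrable (integrable0 mu D) => // x _; rewrite big_nil.
have [f1 f2] := fc i; split.
  by apply: eq_integrable (integrableD mD f1 IH1) => // x _; rewrite big_cons EFinD.
rewrite big_cons; under eq_integral do rewrite big_cons EFinD.
by rewrite integralD// IH2 f2.
Qed.

Lemma eq_has_integral f g c : (forall x, D x -> f x = g x) ->
  has_integral f c -> has_integral g c.
Proof.
move=> fg [f1 f2]; split.
  by apply: eq_integrable f1 => // x /[!inE] Dx; rewrite fg.
by rewrite -f2; apply: eq_integral => x /[!inE] Dx; rewrite fg.
Qed.

End has_integral.

(** * Orthonormality and Gaussian bounds in one variable *)

Section orthonormality.
Context {R : realType}.
Notation mu := (@lebesgue_measure R).
Notation half := (`]0%R, +oo[%classic : set R).
Implicit Types (a s t u v : R).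

(** Up to the sign (-1)^j the sum is the j-th finite difference in s of a monic polynomial of degree
    b <= j: it vanishes for b < j and is j! for b = j. *)
Lemma rising_fin_diff s j b : (b <= j)%N ->
  \sum_(i < j.+1) (-1) ^+ i * 'C(j, i)%:R * rising (s + i%:R) b =
  if b == j then (-1) ^+ j * j`!%:R else 0.
Proof.
elim: j b s => [|j IHj] b s.
  rewrite leqn0 => /eqP ->; rewrite eqxx big_ord_recl big_ord0 rising0.
  by rewrite bin0 fact0; ring.
move=> bj; pose f i := rising (s + i%:R) b.
transitivity (\sum_(i < j.+1) (-1) ^+ i * 'C(j, i)%:R * (f i - f i.+1)).
  rewrite big_ord_recl /= bin0.
  under eq_bigr => i _.
    rewrite /bump leq0n add1n binS natrD mulrDr mulrDl.
    over.
  rewrite big_split /= -/(f 0%N).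
  rewrite (eq_bigr _ (fun i _ => mulrBr _ _ _)) sumrB.
  rewrite [in RHS]big_ord_recl /= bin0 -[in RHS]sumrN.
  rewrite -[in RHS]addrA [X in _ = _ + X]addrC; congr (_ + _).
  rewrite addrC; congr (_ + _).
    by apply: eq_bigr => i _; rewrite /f exprS; ring.
  rewrite big_ord_recr /= bin_small// mulr0 mul0r addr0.
  by apply: eq_bigr => i _; rewrite /bump leq0n add1n.
have fE i : f i - f i.+1 = - (b%:R * rising (s + 1 + i%:R) b.-1).
  have := rising_diff (s + i%:R) b; rewrite /f -(natr1 i).
  have -> : s + i%:R + 1 = s + 1 + i%:R by ring.
  have -> : s + (i%:R + 1) = s + 1 + i%:R by ring.
  by move=> <-; ring.
under eq_bigr do rewrite fE mulrN mulrCA -mulrN.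
rewrite -mulr_sumr sumrN; case: b bj f fE => [|b] bj f fE.
  by rewrite mul0r.
rewrite /= IHj// eqSS; case: eqP => [->|_]; last by rewrite oppr0 mulr0.
by rewrite exprS factS natrM; ring.
Qed.

(** The sum over i is the moment of L_j against x^l for the weight x^a e^(-x). It is a j-th finite
    difference of a polynomial of degree l, hence zero for l < j, so that only l = k = j can
    contribute. *)
Lemma laguerre_orthogonal a j k : -1 < a -> (k <= j)%N ->
  \sum_(l < k.+1) \sum_(i < j.+1) laguerre_coef a k l * (-1) ^+ l *
     (laguerre_coef a j i * (-1) ^+ i) * Gamma (a + 1 + (i + l)%:R) =
  if k == j then Gamma (a + 1 + j%:R) / j`!%:R else 0.
Proof.
move=> a1 kj; have a0 : 0 < a + 1 by rewrite -ltrBlDr sub0r.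
have f0 n : n`!%:R != 0 :> R by rewrite pnatr_eq0 -lt0n fact_gt0.
have r0 n : rising (a + 1) n != 0 by rewrite gt_eqF// rising_gt0.
have inner (l : nat) : (l <= j)%N -> \sum_(i < j.+1) laguerre_coef a j i * (-1) ^+ i *
    Gamma (a + 1 + (i + l)%:R) = Gamma (a + 1) * rising (a + 1) j / j`!%:R *
   (if l == j then (-1) ^+ j * j`!%:R else 0).
  move=> lj; rewrite -(rising_fin_diff (a + 1) lj) mulr_sumr; apply: eq_bigr => i _.
  have ij : (i <= j)%N by rewrite -ltnS.
  rewrite Gamma_rising// risingD /laguerre_coef -(bin_fact ij) !natrM.
  have -> : rising (a + 1) j = rising (a + 1) i * rising (a + 1 + i%:R) (j - i).
    by rewrite -risingD subnKC.
  have b0 : 'C(j, i)%:R != 0 :> R by rewrite pnatr_eq0 -lt0n bin_gt0.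
  by field; rewrite !f0 b0.
transitivity (\sum_(l < k.+1) laguerre_coef a k l * (-1) ^+ l *
    (Gamma (a + 1) * rising (a + 1) j / j`!%:R *
     (if (l : nat) == j then (-1) ^+ j * j`!%:R else 0))).
  apply: eq_bigr => l _; rewrite -inner; last by rewrite (leq_trans _ kj)// -ltnS.
  by rewrite mulr_sumr; apply: eq_bigr => i _; rewrite -!mulrA.
rewrite big_ord_recr /= big1 ?add0r; last first.
  move=> l _; rewrite ifN_eq; first by rewrite !mulr0.
  by rewrite neq_ltn (leq_trans _ kj).
case: eqP => [->|_]; last by rewrite !mulr0.
rewrite Gamma_rising// /laguerre_coef subnn rising0 fact0.
have e : (-1) ^+ j * (-1) ^+ j = 1 :> R by rewrite -exprMn mulrNN mulr1 expr1n.
transitivity ((-1) ^+ j * (-1) ^+ j * (rising (a + 1) j * Gamma (a + 1) / j`!%:R)).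
  by field.
by rewrite e mul1r.
Qed.

(** Under x = u^2 this is half of x^(a + i) e^(-x) dx, so the products of the functions [phi1]
    integrate to Gamma values. *)
Definition gauss_moment a (i : nat) u : R := u `^ (2 * (a + 1 + i%:R) - 1) * expR (- u ^+ 2).

Lemma measurable_gauss_moment a i (D : set R) : measurable_fun D (gauss_moment a i).
Proof.
apply: measurable_funTS; apply: measurable_funM; first exact: measurable_powR.
by apply: measurableT_comp => //; apply: measurableT_comp => //;
  exact: exprn_measurable.
Qed.

Lemma has_integral_gauss_moment a i : -1 < a ->
  has_integral mu half (gauss_moment a i) (Gamma (a + 1 + i%:R) / 2).
Proof.
move=> a1; have a0 : 0 < a + 1 + i%:R by rewrite ltr_wpDr// -ltrBlDr sub0r.
have E := integral_gamma_sqr a0; split => //.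
apply/integrableP; split; first by apply/measurable_EFinP; exact: measurable_gauss_moment.
under eq_integral do rewrite gee0_abs ?lee_fin ?mulr_ge0 ?powR_ge0 ?expR_ge0//.
by rewrite E ltry.
Qed.

Definition phi1_norm a k : R := Num.sqrt (2 * Gamma (k%:R + 1) / Gamma (k%:R + a + 1)).

Lemma phi1E a k u : phi1 a k u = phi1_norm a k *
  (laguerre a k).[u ^+ 2] * u `^ (a + 1 / 2) * expR (- (u ^+ 2 / 2)).
Proof. by []. Qed.

Lemma phi1_mul_moment a j k u : -1 < a -> 0 < u ->
  phi1 a j u * phi1 a k u =
  phi1_norm a j * phi1_norm a k *
  \sum_(l < k.+1) \sum_(i < j.+1) laguerre_coef a k l * (-1) ^+ l *
     (laguerre_coef a j i * (-1) ^+ i) * gauss_moment a (i + l) u.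
Proof.
move=> a1 u0; rewrite !phi1E.
move: (phi1_norm a j) (phi1_norm a k) => cj ck.
rewrite !laguerreE.
transitivity (cj * ck * ((\sum_(i < k.+1) laguerre_coef a k i * (- u ^+ 2) ^+ i) *
   ((\sum_(i < j.+1) laguerre_coef a j i * (- u ^+ 2) ^+ i) *
    (u `^ (a + 1 / 2) * u `^ (a + 1 / 2) * (expR (- (u ^+ 2 / 2)) * expR (- (u ^+ 2 / 2))))))).
  by ring.
congr (_ * _); rewrite mulr_suml; apply: eq_bigr => l _.
rewrite mulr_suml mulr_sumr; apply: eq_bigr => i _.
rewrite /gauss_moment -expRD -powRD ?(gt_eqF u0) ?implybT//.
have -> : - (u ^+ 2 / 2) + - (u ^+ 2 / 2) = - u ^+ 2 by field.
have -> : 2 * (a + 1 + (i + l)%:R) - 1 = a + 1 / 2 + (a + 1 / 2) + (2 * (i + l))%:R.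
  by rewrite natrM; field.
rewrite [u `^ (_ + (2 * _)%:R)]powRD ?(gt_eqF u0) ?implybT// powR_mulrn ?(ltW u0)//.
rewrite mulnDr exprD !exprM [(- u ^+ 2) ^+ l]exprNn [(- u ^+ 2) ^+ i]exprNn; ring.
Qed.

Lemma has_integral_phi1 a j k : -1 < a ->
  has_integral mu half (fun u => phi1 a j u * phi1 a k u) (if j == k then 1 else 0).
Proof.
move=> a1; have a0 : 0 < a + 1 by rewrite -ltrBlDr sub0r.
have mh : measurable half by exact: measurable_itv.
wlog kj : j k / (k <= j)%N => [H|].
  have [kj|/ltnW jk] := leqP k j; first exact: H.
  rewrite eq_sym; apply: eq_has_integral (H _ _ jk) => // u _; exact: mulrC.
have -> : (if j == k then 1 else 0) = phi1_norm a j * phi1_norm a k *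
  \sum_(l < k.+1) \sum_(i < j.+1) laguerre_coef a k l * (-1) ^+ l *
     (laguerre_coef a j i * (-1) ^+ i) * (Gamma (a + 1 + (i + l)%:R) / 2).
  under eq_bigr do under eq_bigr do rewrite mulrA.
  under eq_bigr do rewrite -mulr_suml.
  rewrite -mulr_suml laguerre_orthogonal// eq_sym; case: eqP => [->|_]; last first.
    by rewrite mul0r mulr0.
  have g0 : 0 < Gamma (a + 1 + j%:R) by rewrite Gamma_gt0// ltr_wpDr.
  have f0 : 0 < j`!%:R :> R by rewrite ltr0n fact_gt0.
  have -> : phi1_norm a j = Num.sqrt (2 * j`!%:R / Gamma (a + 1 + j%:R)).
    by rewrite /phi1_norm Gamma_fact -addrA addrC.
  rewrite -expr2 sqr_sqrtr; last by rewrite divr_ge0 ?mulr_ge0// ltW.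
  by field; rewrite !gt_eqF.
apply: (@eq_has_integral _ _ _ mu half mh (fun u => phi1_norm a j * phi1_norm a k *
  \sum_(l < k.+1) \sum_(i < j.+1) laguerre_coef a k l * (-1) ^+ l *
     (laguerre_coef a j i * (-1) ^+ i) * gauss_moment a (i + l) u)).
  by move=> u; rewrite /= in_itv/= andbT => u0; rewrite phi1_mul_moment.
apply: has_integralZ => //; apply: has_integral_sum => // l.
apply: has_integral_sum => // i; apply: has_integralZ => //.
exact: has_integral_gauss_moment.
Qed.

Lemma gauss_dominates (s : R) : 0 <= s -> exists2 M : R, 0 < M &
  forall u, 0 < u -> u `^ (2 * s) * expR (- (u ^+ 2 / 2)) <= M * expR (- (u ^+ 2 / 4)).
Proof.
move=> s0; have [C C0 H] := powR_expR_bound s.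
exists (2 `^ s * (C + 1)) => [|u u0]; first by rewrite mulr_gt0 ?powR_gt0 ?addr_gt0.
have u20 : 0 < u ^+ 2 / 2 by rewrite divr_gt0 ?exprn_gt0.
have -> : u `^ (2 * s) = 2 `^ s * (u ^+ 2 / 2) `^ s.
  rewrite -powRM ?(ltW u20)// powRrM (powR_mulrn 2 (ltW u0)).
  by congr (_ `^ _); field.
rewrite -(mulrA (2 `^ s)) -(mulrA (2 `^ s)) ler_wpM2l ?powR_ge0//.
have -> : - (u ^+ 2 / 2) = - (u ^+ 2 / 4) + - (u ^+ 2 / 4) by field.
rewrite expRD mulrA ler_pM2r ?expR_gt0// expRN ler_pdivrMr ?expR_gt0//.
apply: (le_trans (H _ u20)); have -> : u ^+ 2 / 2 / 2 = u ^+ 2 / 4 by field.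
rewrite mulrDl mul1r lerD2l; have [x1|x1] := ltP (u ^+ 2 / 2) 1.
  rewrite mulr1 (@le_trans _ _ 1)//; first by apply: powR_le1; rewrite // !ltW.
  by rewrite ltW// expR_gt1 divr_gt0 ?exprn_gt0.
by rewrite mulr0 expR_ge0.
Qed.

(** As a + 1/2 >= 0, every monomial of the polynomial times u^(a + 1/2) is a nonnegative power of u,
    which half of the Gaussian factor absorbs. *)
Lemma phi1_bound a k : - (1 / 2) <= a -> exists2 M : R, 0 < M &
  forall u, 0 < u -> `|phi1 a k u| <= M * expR (- (u ^+ 2 / 4)).
Proof.
move=> ha.
have /choice[M HM] : forall i : nat, exists M : R, 0 < M /\
   forall u, 0 < u -> u `^ (2 * (i%:R + (a + 1 / 2) / 2)) * expR (- (u ^+ 2 / 2)) <=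
     M * expR (- (u ^+ 2 / 4)).
  move=> i; have [|M M0 HM] := @gauss_dominates (i%:R + (a + 1 / 2) / 2).
    by rewrite addr_ge0// divr_ge0//; lra.
  by exists M.
exists (1 + phi1_norm a k * \sum_(i < k.+1) `|laguerre_coef a k i| * M i) => [|u u0].
  rewrite ltr_pwDl// mulr_ge0// ?sqrtr_ge0//; apply: sumr_ge0 => i _.
  by rewrite mulr_ge0// ltW//; have [] := HM i.
rewrite mulrDl mul1r ler_wpDl ?expR_ge0// phi1E.
have {}HM i := (HM i).2 u u0.
have e20 := expR_ge0 (- (u ^+ 2 / 2)).
move: (expR (- (u ^+ 2 / 2))) (expR (- (u ^+ 2 / 4))) e20 HM => e2 e4 e20 HM.
rewrite -!mulrA normrM ger0_norm ?sqrtr_ge0// ler_wpM2l ?sqrtr_ge0//.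
rewrite laguerreE mulr_suml mulr_suml (le_trans (ler_norm_sum _ _ _))//.
apply: ler_sum => i _; rewrite -mulrA normrM -mulrA ler_wpM2l//.
apply: le_trans (HM i).
rewrite !normrM normrX normrN normrX !ger0_norm ?powR_ge0 ?(ltW u0)//.
rewrite mulrA ler_wpM2r// -exprM -powR_mulrn ?(ltW u0)//.
rewrite -powRD ?(gt_eqF u0) ?implybT//; apply: eqW.
by congr (_ `^ _); rewrite natrM; field.
Qed.

Lemma measurable_phi1 a k (D : set R) : measurable_fun D (phi1 a k).
Proof.
apply: measurable_funTS; apply: measurable_funM; last first.
  apply: measurableT_comp => //; apply: measurableT_comp => //.
  by apply: measurable_funM => //; exact: exprn_measurable.
apply: measurable_funM; last exact: measurable_powR.
apply: measurable_funM => //.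
apply: (@measurableT_comp _ _ _ _ _ _ (fun x => (laguerre a k).[x])).
  by apply: continuous_measurable_fun; exact: continuous_horner.
exact: exprn_measurable.
Qed.

End orthonormality.

(** * Pointwise and mass estimates in one variable *)

Section heat1_estimates.
Context {R : realType}.
Notation mu := (@lebesgue_measure R).
Notation half := (`]0%R, +oo[%classic : set R).
Implicit Types (a s t u v : R).

Lemma measurable_heat1_term d (T : measurableType d) (D : set T) (f g h : T -> R) a k :
  measurable_fun D f -> measurable_fun D g -> measurable_fun D h ->
  measurable_fun D (fun z => heat1_term a (f z) (g z) (h z) k).
Proof.
move=> mf mg mh; apply: measurable_funM; last first.
  apply: (@measurableT_comp _ _ _ _ _ _ (phi1 a k)) => //; exact: measurable_phi1.
apply: measurable_funM; last first.
  apply: (@measurableT_comp _ _ _ _ _ _ (phi1 a k)) => //; exact: measurable_phi1.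
apply: measurableT_comp => //; apply: measurableT_comp => //.
by apply: measurable_funM.
Qed.

Lemma measurable_heat1 d (T : measurableType d) (D : set T) (f g h : T -> R) a :
  -1 < a -> measurable D -> measurable_fun D f -> measurable_fun D g ->
  measurable_fun D h -> (forall z, D z -> 0 < f z) ->
  measurable_fun D (fun z => heat1 a (f z) (g z) (h z)).
Proof.
move=> a1 mD mf mg mh f0.
apply: (@measurable_fun_cvg _ _ _ _ (fun n z =>
   \sum_(0 <= k < n) heat1_term a (f z) (g z) (h z) k)).
  by move=> n; apply: measurable_sum => k; exact: measurable_heat1_term.
by move=> z Dz; apply: is_cvg_heat1 => //; exact: f0.
Qed.

Lemma powR_le_base s u v : 0 <= s -> 0 <= u -> u <= v -> u `^ s <= v `^ s.
Proof.
move=> s0 u0 uv; apply: ge0_ler_powR => //; rewrite nnegrE//.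
exact: le_trans uv.
Qed.

(** The square root of the bound e^(-t) / t for [hrho t] is the case b = 1/2. In dimension d the
    exponent becomes d/2, while the rate 1/2 of the exponential is kept. *)
Definition decay (b t : R) : R := t `^ (- b) * expR (- (t / 2)).

Lemma hrho_sqrt_le t : 0 < t -> hrho t `^ (1 / 2) <= decay (1 / 2) t.
Proof.
move=> t0; have h2 : 0 <= 1 / 2 :> R by lra.
apply: (le_trans (powR_le_base h2 (hrho_ge0 t0) (hrho_le t0))).
have i0 : 0 <= t^-1 by rewrite invr_ge0 ltW.
rewrite (powRM _ (expR_ge0 _) i0) powR_inv ?(ltW t0)// -powRN mulrC.
rewrite /decay -expRM ler_wpM2l ?powR_ge0// ler_expR; lra.
Qed.

Lemma measurable_expR_sqr (c s : R) (D : set R) :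
  measurable_fun D (fun v : R => (expR (- ((c - v) ^+ 2 / s)))%:E).
Proof.
apply: measurable_funTS; apply/measurable_EFinP; apply: measurableT_comp => //.
apply: measurableT_comp => //; apply: measurable_funM => //.
by apply: measurable_funX; exact: measurable_funB.
Qed.

(* [W] is a majorant of the mass that is known to be measurable, so that products
   over the coordinates can be integrated. *)
Lemma heat1_estimates a : - (1 / 2) <= a -> exists2 A : R, 0 < A &
  forall t, 0 < t ->
  [/\ forall u v, 0 < u -> 0 < v -> heat1 a t u v <= A * decay (1 / 2) t,
      forall u, 0 < u ->
        (\int[mu]_(v in half) (heat1 a t u v)%:E <= (A * expR (- (t / 2)))%:E)%E &
      exists W : R -> \bar R, [/\ measurable_fun half W, forall u, (0 <= W u)%E,
        forall u, 0 < u -> (\int[mu]_(v in half) (heat1 a t u v)%:E <= W u)%E &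
        (\int[mu]_(u in half) W u <= (A * decay (1 / 2) t)%:E)%E]].
Proof.
move=> ha; have a1 : -1 < a by lra.
have [A A0 HA] := heat1_le ha.
have p4 : 1 <= 4 * pi :> R by have := @pi_ge2 R; lra.
have p40 : 0 <= 4 * pi :> R by lra.
have pi0 : 0 <= pi :> R by exact: pi_ge0.
(* Up to two Gaussian integrals occur, each costing a factor (4 pi)^(1/2) <= 4 pi. *)
exists (A * (4 * pi) ^+ 2) => [|t t0].
  by rewrite mulr_gt0// exprn_gt0// (lt_le_trans ltr01).
have p42 : 4 * pi <= (4 * pi) ^+ 2 :> R by rewrite expr2 ler_peMr.
have p421 : 1 <= (4 * pi) ^+ 2 :> R by exact: le_trans p42.
have tau0 := htau_gt0 t0; have rho0 := hrho_ge0 t0; have rhoD := hrho_sqrt_le t0.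
have mh : measurable half by exact: measurable_itv.
have mheat u : measurable_fun half (fun v => (heat1 a t u v)%:E).
  apply/measurable_EFinP.
  by apply: (measurable_heat1 a1 mh (f := fun=> t) (g := fun=> u) (h := id)).
(* For positive u and v, (u + v)^2 >= u^2. This leaves a Gaussian in u - v of width [htau t ^ (1/2)]
   times a Gaussian in u of width [htau t ^ (-1/2)]; the second one makes the total mass finite. *)
have sq u v : heat1 a t u v <= A * hrho t `^ (1 / 2) *
    (expR (- ((0 - u) ^+ 2 / (4 * (htau t)^-1))) *
     expR (- ((u - v) ^+ 2 / (4 * htau t)))) \/ ~~ ((0 < u) && (0 < v)).
  have [/andP[u0 v0]|] := boolP ((0 < u) && (0 < v)); last by right.
  left; rewrite (le_trans (HA _ _ _ t0 u0 v0))// mulrA ler_wpM2l ?mulr_ge0 ?(ltW A0) ?powR_ge0//.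
  rewrite -expRD ler_expR sub0r sqrrN -subr_ge0.
  rewrite (_ : _ - _ = htau t * (v * (2 * u + v)) / 4); last first.
    by field; rewrite gt_eqF.
  by rewrite divr_ge0// mulr_ge0 ?(ltW tau0)// mulr_ge0 ?addr_ge0 ?mulr_ge0 ?(ltW u0) ?(ltW v0).
have inner u : 0 < u -> (\int[mu]_(v in half) (heat1 a t u v)%:E <=
    (A * (4 * pi) * (hrho t * htau t) `^ (1 / 2) *
      expR (- ((0 - u) ^+ 2 / (4 * (htau t)^-1))))%:E)%E.
  move=> u0.
  set E := expR (- ((0 - u) ^+ 2 / (4 * (htau t)^-1))).
  have E0 : 0 <= E by exact: expR_ge0.
  have c0 : 0 <= A * hrho t `^ (1 / 2) * E by rewrite !mulr_ge0 ?(ltW A0) ?powR_ge0.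
  apply: (@le_trans _ _ (\int[mu]_(v in half) ((A * hrho t `^ (1 / 2) * E)%:E *
     (expR (- ((u - v) ^+ 2 / (4 * htau t))))%:E))%E).
    apply: ge0_le_integral => //.
    - by move=> v _; rewrite lee_fin heat1_ge0.
    - exact: mheat.
    - by apply: measurable_funeM; exact: measurable_expR_sqr.
    move=> v /=; rewrite in_itv/= andbT => v0; rewrite -EFinM lee_fin.
    by have [|] := sq u v; [rewrite mulrA|rewrite u0 v0].
  apply: (@le_trans _ _ ((A * hrho t `^ (1 / 2) * E)%:E *
     ((4 * pi * htau t) `^ (1 / 2))%:E)%E).
    rewrite ge0_integralZl//.
    - by rewrite lee_wpmul2l ?lee_fin// integral_gauss_le.
    - exact: measurable_expR_sqr.
  rewrite -EFinM lee_fin (powRM _ p40 (ltW tau0)) (powRM _ rho0 (ltW tau0)).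
  have h : (4 * pi : R) `^ (1 / 2) <= 4 * pi by apply: ler1_powR => //; lra.
  rewrite [leLHS](_ : _ = A * E * (hrho t `^ (1 / 2) * htau t `^ (1 / 2)) *
    (4 * pi) `^ (1 / 2)); last by ring.
  rewrite [leRHS](_ : _ = A * E * (hrho t `^ (1 / 2) * htau t `^ (1 / 2)) * (4 * pi)); last by ring.
  by rewrite ler_wpM2l// !mulr_ge0 ?powR_ge0// ltW.
split.
- move=> u v u0 v0; apply: (le_trans (HA _ _ _ t0 u0 v0)).
  rewrite -mulrA ler_wpM2l ?(ltW A0)//.
  apply: (@le_trans _ _ (hrho t `^ (1 / 2))).
    rewrite ler_piMr ?powR_ge0// expR_le1 oppr_le0 divr_ge0// addr_ge0//.
      by rewrite divr_ge0 ?sqr_ge0// ltW.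
    by rewrite mulr_ge0 ?sqr_ge0// ltW.
  by rewrite (le_trans rhoD)// ler_peMl// mulr_ge0 ?powR_ge0 ?expR_ge0.
- move=> u u0; apply: (le_trans (inner u u0)); rewrite lee_fin.
  rewrite -[leRHS]mulr1 ler_pM ?expR_ge0 ?mulr_ge0 ?powR_ge0 ?(ltW A0)//; last first.
    by rewrite expR_le1 oppr_le0 divr_ge0 ?sqr_ge0// mulr_ge0// invr_ge0 ltW.
  rewrite ler_pM ?mulr_ge0 ?powR_ge0 ?(ltW A0) ?pi_ge0// ?ler_wpM2l ?(ltW A0)//.
  have h2 : 0 <= 1 / 2 :> R by lra.
  apply: (le_trans (powR_le_base h2 (mulr_ge0 rho0 (ltW tau0)) (hrho_htau_le t0))).
  by rewrite -expRM ler_expR; lra.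
have c0 : 0 <= A * (4 * pi) * (hrho t * htau t) `^ (1 / 2).
  by rewrite !mulr_ge0 ?powR_ge0 ?(ltW A0).
have i0 : 0 < (htau t)^-1 by rewrite invr_gt0.
exists (fun u => (A * (4 * pi) * (hrho t * htau t) `^ (1 / 2))%:E *
    (expR (- ((0 - u) ^+ 2 / (4 * (htau t)^-1))))%:E)%E; split.
- by apply: measurable_funeM; exact: measurable_expR_sqr.
- by move=> u; rewrite -EFinM lee_fin mulr_ge0 ?expR_ge0.
- by move=> u u0; rewrite -EFinM; exact: inner.
apply: (@le_trans _ _ ((A * (4 * pi) * (hrho t * htau t) `^ (1 / 2))%:E *
     ((4 * pi * (htau t)^-1) `^ (1 / 2))%:E)%E).
  rewrite ge0_integralZl//.
  - by rewrite lee_wpmul2l ?lee_fin// integral_gauss_le.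
  - exact: measurable_expR_sqr.
(* The two widths are inverse to each other and cancel, so that the total mass is of the order of
   [hrho t ^ (1/2)], like the supremum. *)
rewrite -EFinM lee_fin (powRM _ rho0 (ltW tau0)) (powRM _ p40 (ltW i0)) powR_inv ?(ltW tau0)//.
have tp : htau t `^ (1 / 2) != 0 by rewrite gt_eqF// powR_gt0.
rewrite [leLHS](_ : _ = A * (4 * pi * (4 * pi) `^ (1 / 2)) * hrho t `^ (1 / 2)).
  rewrite ler_pM ?mulr_ge0 ?powR_ge0 ?(ltW A0)// ler_wpM2l ?(ltW A0)//.
  by rewrite expr2 ler_wpM2l// ler1_powR//; lra.
by field.
Qed.

(* The series is integrated termwise: it is dominated by the sum of the
   e^(-t lambda_j) |phi_j(v)| |phi_j phi_k|, whose integral is finite because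
   |phi_j(v)| <= 1 + phi_j(v)^2 and the kernel is finite on the diagonal. *)
Lemma has_integral_heat1_phi1 a t v k : -1 < a -> 0 < t ->
  has_integral mu half (fun u => heat1 a t u v * phi1 a k u)
    (expR (- (t * (4 * k%:R + 2 * a + 2))) * phi1 a k v).
Proof.
move=> a1 t0; have mh : measurable half by exact: measurable_itv.
pose e j := expR (- (t * (4 * j%:R + 2 * a + 2))).
have e0 j : 0 <= e j by exact: expR_ge0.
pose w := expR (- (4 * t)).
have w1 : `|w| < 1 by rewrite ger0_norm ?expR_ge0// expR_lt1 oppr_lt0 mulr_gt0.
have eE j : e j = geometric (e 0%N) w j.
  by rewrite /geometric/= /e /w -expRM_natl -expRD; congr expR; ring.
pose F n u : \bar R := (\sum_(0 <= j < n) heat1_term a t u v j * phi1 a k u)%:E.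
pose b j u : \bar R := (e j * `|phi1 a j v| * `|phi1 a j u * phi1 a k u|)%:E.
have b0 j u : (0 <= b j u)%E by rewrite lee_fin !mulr_ge0.
have mb j : measurable_fun half (b j).
  apply/measurable_EFinP; apply: measurable_funM => //; apply: measurableT_comp => //.
  by apply: measurable_funM; exact: measurable_phi1.
(* By 2 |phi_j phi_k| <= phi_j^2 + phi_k^2 and normalization, |phi_j phi_k| has integral at most
   1. *)
have Ib j : (\int[mu]_(u in half) b j u <= (e j * `|phi1 a j v|)%:E)%E.
  have [p1 p2] := has_integral_phi1 j j a1.
  have [q1 q2] := has_integral_phi1 k k a1.
  rewrite eqxx in p2; rewrite eqxx in q2.
  apply: (@le_trans _ _ (\int[mu]_(u in half) ((e j * `|phi1 a j v|)%:E *
    (2^-1%:E * ((phi1 a j u * phi1 a j u)%:E + (phi1 a k u * phi1 a k u)%:E))))%E).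
    apply: ge0_le_integral => //; first exact: mb.
      apply: measurable_funeM; apply: measurable_funeM; apply: emeasurable_funD.
        by have /integrableP[] := p1.
      by have /integrableP[] := q1.
    move=> u _; rewrite -EFinD -!EFinM lee_fin ler_wpM2l ?mulr_ge0//.
    rewrite ler_norml; have := sqr_ge0 (phi1 a j u - phi1 a k u).
    have := sqr_ge0 (phi1 a j u + phi1 a k u).
    by rewrite !expr2; nra.
  rewrite integralZl//; last by apply: integrableZl => //; exact: integrableD.
  rewrite integralZl//; last exact: integrableD.
  by rewrite integralD// p2 q2 -EFinD -!EFinM lee_fin mulVf ?mulr1// pnatr_eq0.
have Se : (\sum_(j <oo) (e j * `|phi1 a j v|)%:E < +oo)%E.
  apply: (@le_lt_trans _ _ (\sum_(j <oo) ((e j)%:E + (heat1_term a t v v j)%:E))%E).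
    apply: lee_nneseries => // j _; first by rewrite lee_fin mulr_ge0.
    rewrite -EFinD lee_fin /heat1_term -/(e j) -mulrA -[X in X + _]mulr1 -mulrDr.
    rewrite ler_wpM2l// -expr2 -real_normK ?num_real//.
    by have := sqr_ge0 (`|phi1 a j v| - 1); rewrite !expr2; nra.
  have h0 j : 0 <= heat1_term a t v v j.
    by rewrite /heat1_term -mulrA mulr_ge0// -expr2 sqr_ge0.
  rewrite nneseriesD//; last 2 first.
  - by move=> j _; rewrite lee_fin.
  - by move=> j _; rewrite lee_fin.
  have gs : series e n @[n --> \oo] --> e 0%N / (1 - w).
    have -> : series e = series (geometric (e 0%N) w).
      by congr series; apply/funext => j; exact: eE.
    exact: cvg_geometric_series.
  rewrite (nneseries_cvg_series e0 gs).
  by rewrite (nneseries_cvg_series h0 (@is_cvg_heat1 _ a t v v a1 t0)) -EFinD ltry.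
have gi : mu.-integrable half (fun u => \sum_(j <oo) b j u)%E.
  apply/integrableP; split.
    by apply: (@ge0_emeasurable_sum _ _ _ half b xpredT) => // i u _ _; exact: b0.
  under eq_integral do rewrite gee0_abs ?nneseries_ge0//.
  rewrite integral_nneseries//; apply: le_lt_trans Se.
  apply: lee_nneseries => [j _ _|j _]; last exact: Ib.
  by apply: integral_ge0 => u _; exact: b0.
have mF n : measurable_fun half (F n).
  apply/measurable_EFinP; apply: measurable_sum => j; apply: measurable_funM.
    by apply: (measurable_heat1_term _ _ (f := fun=> t) (g := id) (h := fun=> v)).
  exact: measurable_phi1.
have Fb n u : (`|F n u| <= \sum_(j <oo) b j u)%E.
  apply: (@le_trans _ _ (\sum_(0 <= j < n) b j u)%E); last exact: nneseries_lim_ge.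
  rewrite /F abse_EFin sumEFin lee_fin (le_trans (ler_norm_sum _ _ _))//.
  apply: ler_sum => j _; rewrite /heat1_term -/(e j) !normrM (ger0_norm (e0 j)).
  by rewrite [leRHS]mulrA (mulrAC (e j)).
have Fc u : F n u @[n --> \oo] --> (heat1 a t u v * phi1 a k u)%:E.
  apply: cvg_EFin; first by near=> n.
  have : series (heat1_term a t u v) n * phi1 a k u @[n --> \oo] -->
     heat1 a t u v * phi1 a k u by apply: cvgM; [exact: is_cvg_heat1|exact: cvg_cst].
  apply: cvg_trans; apply: near_eq_cvg; near=> n.
  by rewrite /F /= /series/= mulr_suml.
have mf : measurable_fun half (fun u => (heat1 a t u v * phi1 a k u)%:E).
  apply/measurable_EFinP; apply: measurable_funM; last exact: measurable_phi1.
  by apply: (measurable_heat1 a1 mh (f := fun=> t) (g := id) (h := fun=> v)).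
have [h1 _ h2] := @dominated_convergence _ _ _ mu _ mh _ _ _ mF mf
  (aeW mu (fun u (_ : half u) => Fc u)) gi (aeW mu (fun u n (_ : half u) => Fb n u)).
split => //; rewrite -(cvg_lim (@ereal_hausdorff R) h2).
(* By orthonormality the integral of the partial sum no longer depends on n once n > k. *)
apply: (@lim_near_cst _ _ _ _ _ _ _) => //.
near=> n; have kn : (k < n)%N by near: n; exact: nbhs_infty_gt.
have : has_integral mu half (fun u => \sum_(j <- index_iota 0 n) e j * phi1 a j v *
    (phi1 a j u * phi1 a k u))
  (\sum_(j <- index_iota 0 n) e j * phi1 a j v * (if j == k then 1 else 0)).
  by apply: has_integral_sum => // j; apply: has_integralZ => //; exact: has_integral_phi1.
move=> [_].
rewrite (_ : \sum_(j <- index_iota 0 n) _ * (if _ then _ else _) = e k * phi1 a k v); last first.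
  under eq_bigr do rewrite (fun_if (fun x => e _ * phi1 a _ v * x)) mulr1 mulr0.
  by rewrite -big_mkcond big_nat1_eq/= kn.
move=> <-; apply: eq_integral => u _; rewrite /F; congr EFin.
by apply: eq_bigr => j _; rewrite /heat1_term -/(e j); ring.
Unshelve. all: end_near. Qed.

End heat1_estimates.

(** * The heat kernel on the orthant *)

Section product_integrals.
Context {R : realType}.
Notation mu := (@lebesgue_measure R).
Notation RT := (measurableTypeR R).
Notation half := (`]0%R, +oo[%classic : set RT).

Lemma prod_EFin n (f : 'I_n -> R) : ((\prod_(i < n) f i)%:E = \prod_(i < n) (f i)%:E)%E.
Proof. exact: (big_morph EFin (@EFinM _) erefl). Qed.

Lemma emeasurable_prod d (T : measurableType d) (D : set T) n (f : 'I_n -> T -> \bar R) :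
  (forall i, measurable_fun D (f i)) ->
  measurable_fun D (fun x => \prod_(i < n) f i x)%E.
Proof.
elim: n f => [f _|n IHn f mf]; last first.
  under eq_fun do rewrite big_ord_recl.
  by apply: emeasurable_funM => //; exact: IHn.
by under eq_fun do rewrite big_ord0; exact: measurable_cst.
Qed.

Lemma prode_ge0 n (f : 'I_n -> \bar R) : (forall i, 0 <= f i)%E ->
  (0 <= \prod_(i < n) f i)%E.
Proof.
by move=> f0; elim/big_ind : _ => [|x y|//]; [exact: lee01|exact: mule_ge0].
Qed.

Lemma lee_prod n (f g : 'I_n -> \bar R) : (forall i, 0 <= f i)%E ->
  (forall i, f i <= g i)%E -> (\prod_(i < n) f i <= \prod_(i < n) g i)%E.
Proof.
elim: n f g => [f g _ _|n IHn f g f0 fg]; first by rewrite !big_ord0.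
rewrite !big_ord_recl; apply: lee_pmul => //; [exact: prode_ge0|exact: IHn].
Qed.

Let mT n i : measurable_fun setT (fun x : n.-tuple RT => tnth x i).
Proof. exact: measurable_tnth. Qed.

Lemma measurable_tprod n (f : 'I_n -> RT -> \bar R) :
  (forall i, measurable_fun setT (f i)) ->
  measurable_fun setT (fun x : n.-tuple RT =>
    \prod_(i < n) f i (tnth x i))%E.
Proof.
move=> mf; apply: emeasurable_prod => i.
exact: (measurableT_comp (mf i) (mT i)).
Qed.

Lemma integral_pushforward_cons n (f : n.+1.-tuple RT -> \bar R) :
  (\int[lebesgueN R n.+1]_x f x =
   \int[pushforward (mu \x lebesgueN R n) (@tcons _ RT n)]_x f x)%E.
Proof. by []. Qed.

Lemma ge0_integral_tprod n (f : 'I_n -> RT -> \bar R) :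
  (forall i, measurable_fun setT (f i)) -> (forall i u, 0 <= f i u)%E ->
  (\int[lebesgueN R n]_x (\prod_(i < n) f i (tnth x i)) =
   \prod_(i < n) \int[mu]_u f i u)%E.
Proof.
elim: n f => [f _ _|n IHn f mf f0].
  by under eq_integral do rewrite big_ord0; rewrite integral_cst//= diracT mule1 big_ord0.
rewrite integral_pushforward_cons.
rewrite ge0_integral_pushforward//; last 3 first.
- by apply: measurable_tcons.
- exact: measurable_tprod.
- by move=> x _; exact: prode_ge0.
rewrite preimage_setT fubini_tonelli1; last 2 first.
- by apply: measurableT_comp; [exact: measurable_tprod|exact: measurable_tcons].
- by move=> z; exact: prode_ge0.
rewrite big_ord_recl -IHn// -ge0_integralZr//; last first.
- by apply: integral_ge0 => x _; exact: prode_ge0.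
apply: eq_integral => u _; rewrite /fubini_F.
rewrite -ge0_integralZl//; last 2 first.
- by apply: (@measurable_tprod _ (fun i => f (lift ord0 i))).
- by move=> x _; exact: prode_ge0.
apply: eq_integral => x _ /=; rewrite big_ord_recl tnth0; congr (_ * _)%E.
by apply: eq_bigr => i _; rewrite tnthS.
Qed.

Lemma measurable_orthant n : measurable (@orthant R n).
Proof.
rewrite (_ : @orthant R n = \bigcap_(i in [set: 'I_n])
   ((fun x : n.-tuple _ => tnth x i) @^-1` half)).
  apply: fin_bigcap_measurable => // i _; rewrite -[X in measurable X]setTI.
  by apply: mT => //; exact: measurable_itv.
apply/seteqP; split => x /= h i; first by move=> _ /=; rewrite in_itv/= h.
by have := h i Logic.I; rewrite /= in_itv/= andbT.
Qed.

(** Integrals over the orthant thus become integrals of products over the whole space, where the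
    recursive definition of the measure applies. *)
Lemma restrict_tprod n (f : 'I_n -> RT -> \bar R) (x : n.-tuple RT) :
  ((fun x : n.-tuple RT => \prod_(i < n) f i (tnth x i)) \_ (@orthant R n) x =
   \prod_(i < n) (f i \_ half) (tnth x i))%E.
Proof.
rewrite patchE; case: ifPn => [/[!inE] xo|].
  by apply: eq_bigr => i _; rewrite patchE ifT// inE/= in_itv/= xo.
rewrite notin_setE => xo; have [i xi] : exists i, ~~ (0 < tnth x i).
  by apply: contrapT => h; apply: xo => i; apply/negPn/negP => xi; apply: h; exists i.
rewrite (bigD1 i)//= patchE ifF ?mul0e//.
by apply/negbTE; rewrite notin_setE/= in_itv/= andbT; exact/negP.
Qed.

Lemma ge0_integral_orthant_prod n (f : 'I_n -> RT -> \bar R) :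
  (forall i, measurable_fun half (f i)) -> (forall i u, 0 <= f i u)%E ->
  (\int[lebesgueN R n]_(x in @orthant R n) (\prod_(i < n) f i (tnth x i)) =
   \prod_(i < n) \int[mu]_(u in half) f i u)%E.
Proof.
move=> mf f0; have mh : measurable half by exact: measurable_itv.
rewrite integral_mkcond (eq_integral (fun x : n.-tuple RT => \prod_(i < n) (f i \_ half) (tnth x i))%E); last first.
  by move=> x _; exact: restrict_tprod.
rewrite (@ge0_integral_tprod n (fun i => f i \_ half)); last 2 first.
- by move=> i; apply/(measurable_restrictT (f i) mh).
- by move=> i u; rewrite patchE; case: ifP.
by apply: eq_bigr => i _; rewrite [RHS]integral_mkcond.
Qed.

(** Fubini needs integrability beforehand: the absolute value of the product is again a product, to
    which Tonelli applies. *)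
Lemma has_integral_tprod n (g : 'I_n -> RT -> R) (c : 'I_n -> R) :
  (forall i, has_integral mu setT (g i) (c i)) ->
  has_integral (lebesgueN R n) setT
    (fun x => \prod_(i < n) g i (tnth x i)) (\prod_(i < n) c i).
Proof.
elim: n g c => [g c _|n IHn g c gc].
  split.
    apply: (@eq_integrable _ _ _ _ _ measurableT (cst 1%E)) => //.
      by move=> x _; rewrite big_ord0.
    by apply/finite_measure_integrable_cst.
  by under eq_integral do rewrite big_ord0; rewrite integral_cst//= diracT mule1 big_ord0.
have mg i : measurable_fun setT (fun u => (g i u)%:E) by have [/integrableP[]] := gc i.
have [i1 i2] := IHn (fun i => g (lift ord0 i)) (fun i => c (lift ord0 i))
   (fun i => gc (lift ord0 i)).
have [j1 j2] := gc ord0.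
pose Q (x : n.+1.-tuple RT) := ((\prod_(i < n.+1) g i (tnth x i))%:E).
pose P (x : n.-tuple RT) := ((\prod_(i < n) g (lift ord0 i) (tnth x i))%:E).
have QE u x : (Q \o @tcons _ RT n) (u, x) = ((g ord0 u)%:E * P x)%E.
  rewrite /Q /P /= big_ord_recl tnth0 EFinM; congr (_ * _%:E)%E.
  by apply: eq_bigr => i _; rewrite tnthS.
have mQ : measurable_fun setT Q.
  rewrite /Q; under eq_fun do rewrite prod_EFin.
  exact: (measurable_tprod (f := fun i u => (g i u)%:E)).
have mQt : measurable_fun setT (Q \o @tcons _ RT n).
  by apply: measurableT_comp => //; exact: measurable_tcons.
have iQ : (mu \x lebesgueN R n)%E.-integrable setT (Q \o @tcons _ RT n).
  apply/integrable12ltyP => //.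
  under eq_integral => u _.
    under eq_integral do rewrite QE abseM.
    rewrite ge0_integralZl//; last first.
      by apply: measurableT_comp => //; have /integrableP[] := i1.
    over.
  rewrite ge0_integralZr//; last 2 first.
  - by apply: measurableT_comp => //; have /integrableP[] := j1.
  - exact: integral_ge0.
  by rewrite lte_mul_pinfty ?integral_ge0// ?ge0_fin_numE ?integral_ge0//;
    [have /integrableP[] := j1|have /integrableP[] := i1].
have mt := @measurable_tcons _ RT n.
split.
  by apply: (integrable_pushforward mt mQ _ measurableT); rewrite preimage_setT.
rewrite integral_pushforward_cons (integral_pushforward mt mQ _ measurableT) ?preimage_setT//.
rewrite -integral12_prod_meas1//.
under eq_integral => u _.
  rewrite /fubini_F; under eq_integral do rewrite QE.
  rewrite integralZl// i2.
  over.
by rewrite integralZr// j2 big_ord_recl.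
Qed.

Lemma has_integral_orthant_prod n (f : 'I_n -> RT -> R) (c : 'I_n -> R) :
  (forall i, has_integral mu half (f i) (c i)) ->
  has_integral (lebesgueN R n) (@orthant R n)
    (fun x => \prod_(i < n) f i (tnth x i)) (\prod_(i < n) c i).
Proof.
move=> fc; have mh : measurable half by exact: measurable_itv.
pose g i := (f i) \_ half.
have gE i u : ((g i u)%:E = ((EFin \o f i) \_ half) u)%E by rewrite restrict_EFin.
have {fc}gc i : has_integral mu setT (g i) (c i).
  have [f1 f2] := fc i; split.
    apply: (@eq_integrable _ _ _ _ _ measurableT _ _ _ ((integrable_mkcond _ mh).1 f1)) => u _.
    by rewrite gE.
  by rewrite -f2 [RHS]integral_mkcond; apply: eq_integral => u _; rewrite gE.
suff [h1 h2] : has_integral (lebesgueN R n) setT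
    (fun x => \prod_(i < n) g i (tnth x i)) (\prod_(i < n) c i).
  have E (x : n.-tuple RT) : ((\prod_(i < n) g i (tnth x i))%:E =
      (fun x => (\prod_(i < n) f i (tnth x i))%:E) \_ (@orthant R n) x)%E.
    transitivity (((fun x : n.-tuple RT =>
        \prod_(i < n) (EFin \o f i) (tnth x i)) \_ (@orthant R n)) x)%E.
      by rewrite (restrict_tprod (fun i => EFin \o f i)) prod_EFin; apply: eq_bigr => i _; exact: gE.
    by rewrite !patchE; case: ifP => // _; rewrite prod_EFin.
  split.
    apply: (@integrable_mkcond _ _ _ (lebesgueN R n) _
      (fun x => (\prod_(i < n) f i (tnth x i))%:E) (@measurable_orthant n)).2.
    by apply: (eq_integrable measurableT _ _ _ h1) => x _; exact: E.
  by rewrite integral_mkcond -h2; apply: eq_integral => x _; rewrite E.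
exact: has_integral_tprod.
Qed.

End product_integrals.

(** * The multidimensional kernel as a product *)

Section heat_kernel.
Context {R : realType} (d : nat) (alpha : 'I_d -> R).
Hypothesis halpha : forall i, - (1 / 2) <= alpha i.
Notation mu := (@lebesgue_measure R).
Notation RT := (measurableTypeR R).
Notation X := (d.-tuple RT).
Notation leb := (lebesgueN R d).
Notation half := (`]0%R, +oo[%classic : set RT).
Implicit Types (x y : X) (t : R).

Let a1 i : -1 < alpha i. Proof. by have := halpha i; lra. Qed.

Lemma laguerre_eigenvalueE (k : 'I_d -> nat) :
  laguerre_eigenvalue alpha k = \sum_(i < d) (4 * (k i)%:R + 2 * alpha i + 2).
Proof.
rewrite /laguerre_eigenvalue natr_sum !mulr_sumr -big_split/=.
rewrite [RHS]big_split/=; congr (_ + _).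
by rewrite sumr_const card_ord mulr_natr.
Qed.

Lemma expR_eigenvalue t (k : 'I_d -> nat) :
  expR (- (t * laguerre_eigenvalue alpha k)) =
  \prod_(i < d) expR (- (t * (4 * (k i)%:R + 2 * alpha i + 2))).
Proof.
rewrite laguerre_eigenvalueE mulr_sumr -sumrN.
exact: (big_morph (@expR R) (@expRD R) (@expR0 R)).
Qed.

(** By distributivity, the sum over a box {0, ..., n - 1}^d is the product of the n-th partial sums
    of the one-dimensional series. *)
Lemma heat_kernelE t x y : 0 < t ->
  heat_kernel alpha t x y = \prod_(i < d) heat1 (alpha i) t (tnth x i) (tnth y i).
Proof.
move=> t0; apply: cvg_lim => //.
rewrite (_ : (fun n : nat => _) = fun n => \prod_(i < d)
    series (heat1_term (alpha i) t (tnth x i) (tnth y i)) n).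
  by apply: cvg_big_prod => i; exact: is_cvg_heat1.
apply/funext => n; rewrite /series/=.
under [RHS]eq_bigr do rewrite big_mkord.
rewrite bigA_distr_bigA/=; apply: eq_bigr => k _.
by rewrite expR_eigenvalue /phi -!big_split.
Qed.

Lemma heat_kernel_ge0 t x y : 0 < t -> 0 <= heat_kernel alpha t x y.
Proof. by move=> t0; rewrite heat_kernelE// prodr_ge0// => i _; exact: heat1_ge0. Qed.

(** Extension by zero to t <= 0 and off the orthant, so that Tonelli and Fubini can be applied on
    full product spaces. *)
Definition orthant_kernel (z : RT * (X * X)) : R :=
  ((fun z : RT * (X * X) => heat_kernel alpha z.1 z.2.1 z.2.2) \_
    (half `*` (@orthant R d `*` @orthant R d))) z.

Lemma orthant_kernelE t x y : 0 < t -> orthant x -> orthant y ->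
  orthant_kernel (t, (x, y)) = heat_kernel alpha t x y.
Proof.
by move=> t0 xo yo; rewrite /orthant_kernel patchE ifT// inE/= in_itv/= t0.
Qed.

Lemma orthant_kernel0 t x y : ~ (orthant x /\ orthant y) ->
  orthant_kernel (t, (x, y)) = 0.
Proof.
move=> xy; rewrite /orthant_kernel patchE ifF//; apply/negbTE.
by rewrite notin_setE => -[_ /xy].
Qed.

Lemma orthant_kernel_le0 t z : t <= 0 -> orthant_kernel (t, z) = 0.
Proof.
move=> t0; rewrite /orthant_kernel patchE ifF//; apply/negbTE.
by rewrite notin_setE => -[/=]; rewrite in_itv/= andbT ltNge t0.
Qed.

Lemma orthant_kernel_ge0 z : 0 <= orthant_kernel z.
Proof.
rewrite /orthant_kernel patchE; case: ifPn => // /[!inE] -[/=].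
by rewrite in_itv/= andbT => t0 _; exact: heat_kernel_ge0.
Qed.

Lemma orthant_kernel_sym t x y : orthant_kernel (t, (x, y)) = orthant_kernel (t, (y, x)).
Proof.
rewrite /orthant_kernel !patchE.
rewrite (_ : ((t, (y, x)) \in _) = ((t, (x, y)) \in half `*` (@orthant R d `*` @orthant R d))).
  case: ifPn => // /[!inE] -[/=]; rewrite in_itv/= andbT => t0 _.
  by rewrite !heat_kernelE//; apply: eq_bigr => i _; exact: heat1_sym.
by apply/idP/idP; rewrite !inE/= => -[? []].
Qed.

Lemma measurable_orthant_kernel : measurable_fun setT orthant_kernel.
Proof.
have mD : measurable (half `*` (@orthant R d `*` @orthant R d)).
  by apply: measurableX; [exact: measurable_itv|apply: measurableX; exact: measurable_orthant].
apply/(measurable_restrictT _ mD).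
apply: (@eq_measurable_fun _ _ _ _ _ (fun z : RT * (X * X) =>
    \prod_(i < d) heat1 (alpha i) z.1 (tnth z.2.1 i) (tnth z.2.2 i))).
  by move=> z /[!inE] -[/=]; rewrite in_itv/= andbT => t0 _; rewrite heat_kernelE.
apply: measurable_prod => i _; apply: measurable_heat1 => //.
- exact: measurable_funTS.
- apply: measurable_funTS; apply: (measurableT_comp (measurable_tnth i)).
  exact: (measurableT_comp measurable_fst measurable_snd).
- apply: measurable_funTS; apply: (measurableT_comp (measurable_tnth i)).
  exact: (measurableT_comp measurable_snd measurable_snd).
- by move=> z [/=]; rewrite in_itv/= andbT.
Qed.

Lemma orthant_kernel_estimates : (1 <= d)%N -> exists2 A : R, 0 < A &
  forall t, 0 < t ->
  [/\ forall x y, orthant_kernel (t, (x, y)) <= A * decay (d%:R / 2) t,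
      forall x, (\int[leb]_y (orthant_kernel (t, (x, y)))%:E <= (A * expR (- (t / 2)))%:E)%E &
      (\int[leb]_x \int[leb]_y (orthant_kernel (t, (x, y)))%:E
         <= (A * decay (d%:R / 2) t)%:E)%E].
Proof.
move=> d1.
pose A i := s2val (cid2 (heat1_estimates (halpha i))).
have A0 i : 0 < A i := s2valP (cid2 (heat1_estimates (halpha i))).
have HA i := s2valP' (cid2 (heat1_estimates (halpha i))); rewrite -/(A _) in HA.
exists (\prod_(i < d) A i) => [|t t0]; first by rewrite prodr_gt0.
have decay_prod : \prod_(i < d) (A i * decay (1 / 2) t) <=
    \prod_(i < d) A i * decay (d%:R / 2) t.
  rewrite big_split/= ler_wpM2l ?prodr_ge0// => [i _|]; first exact: ltW.
  rewrite prodr_const card_ord /decay exprMn ler_pM ?exprn_ge0 ?powR_ge0 ?expR_ge0//.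
    by rewrite -powR_mulrn ?powR_ge0// -powRrM mulNr mulrC mul1r.
  (* Here [1 <= d] enters: the d-th power of e^(-t/2) is at most e^(-t/2). *)
  rewrite -[leRHS]expr1; apply: ler_wiXn2l => //.
  by rewrite expR_le1 oppr_le0 divr_ge0// ltW.
have mass_prod : \prod_(i < d) (A i * expR (- (t / 2))) <=
    \prod_(i < d) A i * expR (- (t / 2)).
  rewrite big_split/= ler_wpM2l ?prodr_ge0// => [i _|]; first exact: ltW.
  rewrite prodr_const card_ord -[leRHS]expr1; apply: ler_wiXn2l => //.
  by rewrite expR_le1 oppr_le0 divr_ge0// ltW.
have inner x : orthant x -> (\int[leb]_y (orthant_kernel (t, (x, y)))%:E =
    \prod_(i < d) \int[mu]_(v in half) (heat1 (alpha i) t (tnth x i) v)%:E)%E.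
  move=> xo.
  rewrite -(@ge0_integral_orthant_prod _ _ (fun i v => (heat1 (alpha i) t (tnth x i) v)%:E)); last 2 first.
  - move=> i; apply/measurable_EFinP.
    by apply: (measurable_heat1 (a1 i) (measurable_itv _) (f := fun=> t) (g := fun=> tnth x i) (h := id)).
  - by move=> i u; rewrite lee_fin heat1_ge0.
  rewrite [RHS]integral_mkcond; apply: eq_integral => y _; rewrite patchE.
  case: ifPn => [/[!inE] yo|].
    by rewrite orthant_kernelE// heat_kernelE// prod_EFin.
  by rewrite notin_setE => yo; rewrite orthant_kernel0// => -[].
have inner0 x : ~ orthant x -> (\int[leb]_y (orthant_kernel (t, (x, y)))%:E = 0)%E.
  by move=> xo; rewrite integral0_eq// => y _; rewrite orthant_kernel0// => -[].
split.
- move=> x y; have [[xo yo]|xy] := pselect (orthant x /\ orthant y); last first.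
    rewrite orthant_kernel0// mulr_ge0 ?prodr_ge0// => [i _|]; first exact: ltW.
    by rewrite mulr_ge0 ?powR_ge0 ?expR_ge0.
  rewrite orthant_kernelE// heat_kernelE//; apply: le_trans decay_prod.
  apply: ler_prod => i _; rewrite heat1_ge0//=.
  have [h _ _] := HA i _ t0; exact: h (xo i) (yo i).
- move=> x; have [xo|xo] := pselect (orthant x); last first.
    rewrite inner0// lee_fin mulr_ge0 ?expR_ge0 ?prodr_ge0// => i _; exact: ltW.
  rewrite inner//; apply: (@le_trans _ _ (\prod_(i < d) (A i * expR (- (t / 2))))%:E); last first.
    by rewrite lee_fin.
  rewrite prod_EFin; apply: lee_prod => i.
    by apply: integral_ge0 => v _; rewrite lee_fin heat1_ge0.
  have [_ h _] := HA i _ t0; exact: h (xo i).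
have /choice[W HW] := fun i => let: And3 _ _ h := HA i _ t0 in h.
apply: (@le_trans _ _ (\int[leb]_(x in @orthant R d) \prod_(i < d) W i (tnth x i))%E).
  rewrite [leRHS]integral_mkcond; apply: ge0_le_integral => //.
  - by move=> x _; apply: integral_ge0 => y _; rewrite lee_fin orthant_kernel_ge0.
  - apply: (measurable_fun_fubini_tonelli_F (fun z : X * X => (orthant_kernel (t, z))%:E)).
      apply/measurable_EFinP; apply: (measurableT_comp measurable_orthant_kernel).
      exact: pair1_measurable.
    by move=> z; rewrite lee_fin orthant_kernel_ge0.
  - rewrite (_ : _ \_ _ = fun x : X => \prod_(i < d) (W i \_ half) (tnth x i))%E; last first.
      by apply/funext => x; exact: (restrict_tprod W).
    apply: (@measurable_tprod _ _ (fun i => W i \_ half)) => i.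
    have mW : measurable_fun half (W i) by have [] := HW i.
    exact: (measurable_restrictT (W i) (measurable_itv _)).1 mW.
  - move=> x _; rewrite patchE; case: ifPn => [/[!inE] xo|]; last first.
      by rewrite notin_setE => xo; rewrite inner0.
    rewrite inner//; apply: lee_prod => i.
      by apply: integral_ge0 => v _; rewrite lee_fin heat1_ge0.
    have [_ _ h _] := HW i; exact: h (xo i).
rewrite ge0_integral_orthant_prod; last 2 first.
- by move=> i; have [] := HW i.
- by move=> i; have [] := HW i.
apply: (@le_trans _ _ (\prod_(i < d) (A i * decay (1 / 2) t))%:E); last by rewrite lee_fin.
rewrite prod_EFin; apply: lee_prod => i; last by have [] := HW i.
by apply: integral_ge0 => v _; have [_ h _ _] := HW i.
Qed.

Lemma has_integral_heat_kernel_phi t y k : 0 < t ->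
  has_integral leb (@orthant R d) (fun x => heat_kernel alpha t x y * phi alpha k x)
    (expR (- (t * laguerre_eigenvalue alpha k)) * phi alpha k y).
Proof.
move=> t0; rewrite expR_eigenvalue /phi -big_split/=.
apply: (@eq_has_integral _ _ _ _ _ (@measurable_orthant R d) (fun x => \prod_(i < d)
    (heat1 (alpha i) t (tnth x i) (tnth y i) * phi1 (alpha i) (k i) (tnth x i)))).
  by move=> x _; rewrite heat_kernelE// -big_split.
apply: (has_integral_orthant_prod (f := fun i u =>
    heat1 (alpha i) t u (tnth y i) * phi1 (alpha i) (k i) u)) => i.
exact: has_integral_heat1_phi1.
Qed.

Lemma measurable_phi k : measurable_fun setT (fun x : X => phi alpha k x).
Proof.
apply: measurable_prod => i _.
apply: (@measurableT_comp _ _ _ _ _ _ (phi1 (alpha i) (k i))); first exact: measurable_phi1.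
exact: measurable_tnth.
Qed.

Lemma phi_estimates k : exists2 M : R, 0 < M &
  (forall x, orthant x -> `|phi alpha k x| <= M) /\
  (\int[leb]_(x in @orthant R d) `|phi alpha k x|%:E <= M%:E)%E.
Proof.
pose M i := s2val (cid2 (phi1_bound (k i) (halpha i))).
have M0 i : 0 < M i := s2valP (cid2 (phi1_bound (k i) (halpha i))).
have HM i u : 0 < u -> `|phi1 (alpha i) (k i) u| <= M i * expR (- (u ^+ 2 / 4)) :=
  s2valP' (cid2 (phi1_bound (k i) (halpha i))) u.
have g0 : 0 <= (4 * pi * 1 : R) `^ (1 / 2) by exact: powR_ge0.
have P0 : 0 < \prod_(i < d) M i by rewrite prodr_gt0.
pose N := \prod_(i < d) (M i * (4 * pi * 1) `^ (1 / 2)).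
have N0 : 0 <= N by rewrite prodr_ge0// => i _; rewrite mulr_ge0// ltW.
exists (\prod_(i < d) M i + N); [by rewrite ltr_pwDl|split].
  move=> x xo; rewrite /phi normr_prod; apply: (@le_trans _ _ (\prod_(i < d) M i)); last by rewrite lerDl.
  apply: ler_prod => i _; rewrite normr_ge0/=.
  rewrite (le_trans (HM i _ (xo i)))// ler_piMr ?(ltW (M0 i))// expR_le1 oppr_le0.
  by rewrite divr_ge0 ?sqr_ge0.
apply: (@le_trans _ _ N%:E); last by rewrite lee_fin lerDr ltW.
have mn i : measurable_fun half (fun u => `|phi1 (alpha i) (k i) u|%:E).
  by apply/measurable_EFinP; apply: measurableT_comp => //; exact: measurable_phi1.
under eq_integral do rewrite /phi normr_prod prod_EFin.
rewrite (@ge0_integral_orthant_prod _ _ (fun i u => `|phi1 (alpha i) (k i) u|%:E))//.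
rewrite prod_EFin; apply: lee_prod => i; first by apply: integral_ge0 => u _; rewrite lee_fin.
apply: (@le_trans _ _ (\int[mu]_(u in half) ((M i)%:E *
    (expR (- ((0 - u) ^+ 2 / (4 * 1))))%:E))%E).
  apply: ge0_le_integral => //.
  - by apply: measurable_funeM; exact: measurable_expR_sqr.
  - move=> u /=; rewrite in_itv/= andbT => u0; rewrite -EFinM lee_fin.
    by rewrite sub0r sqrrN mulr1; exact: HM.
rewrite ge0_integralZl//.
- by rewrite EFinM lee_wpmul2l ?lee_fin ?(ltW (M0 i))// integral_gauss_le.
- exact: measurable_expR_sqr.
- by rewrite lee_fin ltW.
Qed.

End heat_kernel.

(** * Bilinear estimates *)

Section powR_inequalities.
Context {R : realType}.
Implicit Types (a b c x y z r s g F H P T m l t u v L k : R).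

(** The addition law is in doubt only for x = 0 and r + s = 0; nonnegative exponents are then both
    zero and 0^0 = 1. Densities may vanish, so this case does occur. *)
Lemma ge0_powRD x r s : 0 <= r -> 0 <= s -> x `^ (r + s) = x `^ r * x `^ s.
Proof.
move=> r0 s0; have [rs|rs] := eqVneq (r + s) 0; last by rewrite powRD// (negbTE rs).
have -> : r = 0 by lra.
have -> : s = 0 by lra.
by rewrite addr0 powRr0 mulr1.
Qed.

Lemma powR_split g a b c : 0 <= g -> 0 <= a -> 0 <= b -> 0 <= c -> a + b + c = 1 ->
  g `^ a * g `^ b * g `^ c = g.
Proof.
by move=> g0 a0 b0 c0 abc; rewrite -!ge0_powRD ?addr_ge0// abc powRr1.
Qed.

Lemma powR_amgm3 a b c x y z : 0 <= a -> 0 <= b -> 0 <= c -> a + b + c = 1 ->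
  0 <= x -> 0 <= y -> 0 <= z ->
  x `^ a * y `^ b * z `^ c <= a * x + b * y + c * z.
Proof.
move=> a0 b0 c0 abc x0 y0 z0.
have [s0|s0] := eqVneq (a + b) 0.
  have -> : a = 0 by lra.
  have -> : b = 0 by lra.
  have -> : c = 1 by lra.
  by rewrite !powRr0 powRr1// !mul1r !mul0r !add0r.
have sp : 0 < a + b by rewrite lt_neqAle eq_sym s0 addr_ge0.
have bs : 1 - b / (a + b) = a / (a + b) by field.
have bs1 : b / (a + b) <= 1 by rewrite ler_pdivrMr// mul1r lerDr.
have bs0 : 0 <= b / (a + b) by rewrite divr_ge0 ?(ltW sp).
have h := powR_amgm x0 y0 (introT andP (conj bs0 bs1)).
have c01 : 0 <= c <= 1 by rewrite c0/=; lra.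
have c1E : 1 - c = a + b by lra.
have w0 : 0 <= x `^ (1 - b / (a + b)) * y `^ (b / (a + b)) by rewrite mulr_ge0 ?powR_ge0.
have := powR_amgm w0 z0 c01.
rewrite bs in h.
rewrite c1E bs (powRM _ (powR_ge0 _ _) (powR_ge0 _ _)) -!powRrM !divfK//.
move=> /le_trans; apply; rewrite lerD2r.
apply: (le_trans (ler_wpM2l (ltW sp) h)).
by apply: eqW; field.
Qed.

(* If 1 <= P + r, then g F^P H^r = (F g)^(1 - r) (H g)^(1 - P) (F H g)^(P + r - 1);
   otherwise g F^P H^r = (F g)^P (H g)^r g^(1 - P - r). Conclude by weighted AM-GM. *)
Lemma kernel_pointwise g F H P r T m : 0 <= g -> 0 <= F -> 0 <= H ->
  0 <= P <= 1 -> 0 <= r <= 1 -> 0 < T -> g <= m / T ->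
  g * (F `^ P * H `^ r) <= T `^ (- `|P + r - 1|) * (F * g + H * g + T * g + m * (F * H)).
Proof.
move=> g0 F0 H0 /andP[P0 P1] /andP[r0 r1] T0 gm.
have m0 : 0 <= m by have := le_trans g0 gm; rewrite pmulr_lge0// invr_gt0.
have Fg : 0 <= F * g by exact: mulr_ge0.
have Hg : 0 <= H * g by exact: mulr_ge0.
have FH : 0 <= F * H by exact: mulr_ge0.
have Tg : 0 <= T * g by rewrite mulr_ge0// ltW.
have mFH : 0 <= m * (F * H) by exact: mulr_ge0.
have T1 : 0 <= T^-1 by rewrite invr_ge0 ltW.
have [h|h] := leP 1 (P + r).
  rewrite ger0_norm ?subr_ge0//; set del := P + r - 1.
  have del0 : 0 <= del by rewrite /del; lra.
  have r10 : 0 <= 1 - r by lra.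
  have P10 : 0 <= 1 - P by lra.
  have -> : g * (F `^ P * H `^ r) =
      (F * g) `^ (1 - r) * (H * g) `^ (1 - P) * (F * H * g) `^ del.
    rewrite !powRM//; rewrite (_ : F `^ P = F `^ (1 - r) * F `^ del); last first.
      by rewrite -ge0_powRD//; congr (_ `^ _); rewrite /del; ring.
    rewrite (_ : H `^ r = H `^ (1 - P) * H `^ del); last first.
      by rewrite -ge0_powRD//; congr (_ `^ _); rewrite /del; ring.
    have abc : 1 - r + (1 - P) + del = 1 by rewrite /del; ring.
    by rewrite -{1}(powR_split g0 r10 P10 del0 abc); ring.
  apply: (@le_trans _ _ ((F * g) `^ (1 - r) * (H * g) `^ (1 - P) *
      (T^-1 * (m * (F * H))) `^ del)).
    rewrite ler_wpM2l ?mulr_ge0 ?powR_ge0// powR_le_base ?mulr_ge0//.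
    by rewrite (_ : T^-1 * _ = F * H * (m / T)); [exact: ler_wpM2l|ring].
  rewrite (powRM _ T1 mFH) powRN powR_inv ?(ltW T0)// mulrCA ler_wpM2l ?invr_ge0 ?powR_ge0//.
  have := powR_amgm3 r10 P10 del0 _ Fg Hg mFH.
  rewrite (_ : 1 - r + (1 - P) + del = 1); last by rewrite /del; ring.
  move=> /(_ erefl) /le_trans; apply.
  have d1 : del <= 1 by rewrite /del; lra.
  have : (1 - r) * (F * g) <= F * g by rewrite ler_piMl//; lra.
  have : (1 - P) * (H * g) <= H * g by rewrite ler_piMl//; lra.
  have : del * (m * (F * H)) <= m * (F * H) by rewrite ler_piMl.
  lra.
rewrite ltr0_norm ?subr_lt0//; set del := - (P + r - 1).
have del0 : 0 <= del by rewrite /del; lra.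
have -> : g * (F `^ P * H `^ r) =
    T `^ (- del) * ((F * g) `^ P * (H * g) `^ r * (T * g) `^ del).
  rewrite !powRM ?(ltW T0)//.
  have abc : P + r + del = 1 by rewrite /del; ring.
  rewrite -{1}(powR_split g0 P0 r0 del0 abc).
  rewrite powRN; field; by rewrite gt_eqF// powR_gt0.
rewrite ler_wpM2l ?powR_ge0//.
have := powR_amgm3 P0 r0 del0 _ Fg Hg Tg.
rewrite (_ : P + r + del = 1); last by rewrite /del; ring.
move=> /(_ erefl) /le_trans; apply.
have d1 : del <= 1 by rewrite /del; lra.
have : P * (F * g) <= F * g by rewrite ler_piMl.
have : r * (H * g) <= H * g by rewrite ler_piMl.
have : del * (T * g) <= T * g by rewrite ler_piMl.
lra.
Qed.

(** AM-GM for g^(1 - r) (T H g)^r: the version of the pointwise estimate with a single density, for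
    integration in one variable with the other fixed. *)
Lemma kernel_pointwise_one g H r T : 0 <= g -> 0 <= H -> 0 <= r <= 1 -> 0 < T ->
  g * H `^ r <= T `^ (- r) * (T * (H * g) + g).
Proof.
move=> g0 H0 r01 T0; have /andP[r0 r1] := r01.
have Hg : 0 <= T * (H * g) by rewrite mulr_ge0 ?(ltW T0)// mulr_ge0.
have -> : g * H `^ r = T `^ (- r) * ((g `^ (1 - r)) * (T * (H * g)) `^ r).
  rewrite !powRM ?mulr_ge0 ?(ltW T0)//.
  have rr : 1 - r + r = 1 by ring.
  have gE : g = g `^ (1 - r) * g `^ r by rewrite -ge0_powRD ?subr_ge0// rr powRr1.
  rewrite {1}gE.
  by rewrite powRN; field; rewrite gt_eqF// powR_gt0.
rewrite ler_wpM2l ?powR_ge0//; apply: (le_trans (powR_amgm g0 Hg r01)).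
have : (1 - r) * g <= g by rewrite ler_piMl//; lra.
have : r * (T * (H * g)) <= T * (H * g) by rewrite ler_piMl.
lra.
Qed.

(** With L = l^(-1/be) the minimum is max(L, t)^(-be r), and max(L, t) >= (L + t) / 2. A power of L
    + t has an explicit integral against t^(sigma - 1). *)
Lemma min_powR_le (l t be r : R) : 0 < l -> 0 < t -> 0 < be -> 0 <= r ->
  Num.min (l `^ r) (t `^ (- (be * r))) <=
  2 `^ (be * r) * (l `^ (- be^-1) + t) `^ (- (be * r)).
Proof.
move=> l0 t0 b0 r0; set L := l `^ (- be^-1); set k := be * r.
have k0 : 0 <= k by rewrite mulr_ge0// ltW.
have L0 : 0 < L by exact: powR_gt0.
have lE : l `^ r = L `^ (- k).
  by rewrite /L -powRrM mulrNN /k mulrA mulVf ?mul1r// gt_eqF.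
have anti (u v : R) : 0 < u -> u <= v -> v `^ (- k) <= u `^ (- k).
  move=> u0 uv; rewrite !powRN lef_pV2 ?posrE ?powR_gt0 ?(lt_le_trans u0)//.
  by rewrite powR_le_base// ltW.
have two (u : R) : 0 < u -> u `^ (- k) = 2 `^ k * (2 * u) `^ (- k).
  move=> u0; rewrite (powRM _ (ler0n R 2) (ltW u0)) mulrA (powRN 2) mulfV ?mul1r//.
rewrite lE; have [tL|Lt] := leP t L.
  rewrite ge_min; apply/orP; left; rewrite (two _ L0) ler_wpM2l ?powR_ge0// anti ?addr_gt0//; lra.
rewrite ge_min; apply/orP; right; rewrite (two _ t0) ler_wpM2l ?powR_ge0// anti ?addr_gt0//; lra.
Qed.

End powR_inequalities.

Section tonelli_setX.
Local Open Scope ereal_scope.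
Context d1 d2 (T1 : measurableType d1) (T2 : measurableType d2) (R : realType).
Variables (m1 : {sigma_finite_measure set T1 -> \bar R})
  (m2 : {sigma_finite_measure set T2 -> \bar R}).

Lemma tonelli_setX (D1 : set T1) (D2 : set T2) (f : T1 * T2 -> \bar R) :
  measurable D1 -> measurable D2 -> measurable_fun (D1 `*` D2) f ->
  (forall z, 0 <= f z) ->
  \int[m1]_(x in D1) \int[m2]_(y in D2) f (x, y) =
  \int[m2]_(y in D2) \int[m1]_(x in D1) f (x, y).
Proof.
move=> mD1 mD2 mf f0; pose F := f \_ (D1 `*` D2).
have mF : measurable_fun setT F by apply/(measurable_restrictT _ (measurableX mD1 mD2)).
have F0 z : 0 <= F z by rewrite /F patchE; case: ifP.
transitivity (\int[m1]_x \int[m2]_y F (x, y)).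
  rewrite integral_mkcond; apply: eq_integral => x _; rewrite patchE.
  case: ifPn => [xD|xD].
    rewrite integral_mkcond; apply: eq_integral => y _; rewrite /F !patchE in_setX xD.
    by case: ifP.
  by rewrite integral0_eq// => y _; rewrite /F patchE in_setX (negbTE xD).
rewrite (fubini_tonelli F)//.
rewrite [RHS]integral_mkcond; apply: eq_integral => y _; rewrite patchE.
case: ifPn => [yD|yD].
  rewrite [RHS]integral_mkcond; apply: eq_integral => x _; rewrite /F !patchE in_setX yD andbT.
  by case: ifP.
by rewrite integral0_eq// => x _; rewrite /F patchE in_setX (negbTE yD) andbF.
Qed.

End tonelli_setX.

(** * A beta integral on the half-line *)

Section beta.
Context {R : realType}.
Notation mu := (@lebesgue_measure R).
Notation RT := (measurableTypeR R).
Notation half := (`]0%R, +oo[%classic : set RT).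

Lemma integral_gamma_scaleZ (c s l : R) : 0 <= c -> 0 < s -> 0 < l ->
  (\int[mu]_(t in half) (c * (t `^ (s - 1) * expR (- (t * l))))%:E =
   (c * (Gamma s * l `^ (- s)))%:E)%E.
Proof.
move=> c0 s0 l0; under eq_integral do rewrite EFinM.
rewrite ge0_integralZl//; first by rewrite integral_gamma_scale.
- exact: measurable_gamma_scale.
- by move=> t _; rewrite lee_fin mulr_ge0 ?powR_ge0 ?expR_ge0.
Qed.

(** (L + t)^(-k) is 1 / Gamma(k) times the integral of r^(k - 1) e^(-r (L + t)) in r; exchanging the
    integrals leaves two Gamma integrals. *)
Lemma integral_beta (s k L : R) : 0 < s -> s < k -> 0 < L ->
  (\int[mu]_(t in half) (t `^ (s - 1) * (L + t) `^ (- k))%:E =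
   (Gamma s * Gamma (k - s) / Gamma k * L `^ (s - k))%:E)%E.
Proof.
move=> s0 sk L0; have k0 : 0 < k by exact: lt_trans sk.
have ks : 0 < k - s by rewrite subr_gt0.
have mh : measurable half by exact: measurable_itv.
have := Gamma_gt0 k0; have := integral_gamma_scaleZ (s := k).
have := Gamma_gt0 s0; have := integral_gamma_scaleZ (s := s).
have := integral_gamma_scaleZ (s := k - s).
move: (Gamma k) (Gamma s) (Gamma (k - s)) => gk gs gks Iks Is gs0 Ik gk0.
have Gk : gk != 0 by rewrite gt_eqF.
have gk1 : 0 <= gk^-1 by rewrite invr_ge0 ltW.
have c1 : 0 <= gk^-1 * gs by rewrite mulr_ge0// ltW.
pose f (z : RT * RT) : \bar R := (gk^-1 *
  (z.1 `^ (s - 1) * (z.2 `^ (k - 1) * expR (- (z.2 * (L + z.1))))))%:E.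
have f0 z : (0 <= f z)%E by rewrite lee_fin !mulr_ge0 ?powR_ge0 ?expR_ge0.
have mp (q : R) : measurable_fun setT (fun z : RT * RT => z.1 `^ q).
  apply: measurable_fun_powR; exact: measurable_fst.
have mp2 (q : R) : measurable_fun setT (fun z : RT * RT => z.2 `^ q).
  apply: measurable_fun_powR; exact: measurable_snd.
have mf : measurable_fun setT f.
  apply/measurable_EFinP; apply: measurable_funM => //; apply: measurable_funM => //.
  apply: measurable_funM => //; apply: measurableT_comp => //; apply: measurableT_comp => //.
  apply: measurable_funM; first exact: measurable_snd.
  by apply: measurable_funD => //; exact: measurable_fst.
transitivity (\int[mu]_(t in half) \int[mu]_(r in half) f (t, r))%E.
  apply: eq_integral => t; rewrite inE/= in_itv/= andbT => t0.
  have Lt : 0 < L + t by exact: addr_gt0.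
  have c0 : 0 <= gk^-1 * t `^ (s - 1) by exact: mulr_ge0 gk1 (powR_ge0 _ _).
  rewrite (eq_integral (fun r : RT => (gk^-1 * t `^ (s - 1) *
      (r `^ (k - 1) * expR (- (r * (L + t)))))%:E)%E); last first.
    by move=> r _; rewrite /f/=; congr EFin; ring.
  by rewrite Ik//; congr EFin; field.
rewrite (tonelli_setX mu mu mh mh (measurable_funTS mf) f0).
rewrite (eq_integral (fun r : RT => (gk^-1 * gs *
    (r `^ (k - s - 1) * expR (- (r * L))))%:E)%E).
  by rewrite Iks// opprB; congr EFin; ring.
move=> r; rewrite inE/= in_itv/= andbT => r0.
have c2 : 0 <= gk^-1 * (r `^ (k - 1) * expR (- (r * L))).
  exact: mulr_ge0 gk1 (mulr_ge0 (powR_ge0 _ _) (expR_ge0 _)).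
rewrite (eq_integral (fun t : RT => (gk^-1 * (r `^ (k - 1) * expR (- (r * L))) *
   (t `^ (s - 1) * expR (- (t * r))))%:E)%E); last first.
  move=> t _; rewrite /f/=; congr EFin.
  by rewrite (_ : - (r * (L + t)) = - (r * L) + - (t * r)); [rewrite expRD; ring|ring].
rewrite Is//; congr EFin.
rewrite (_ : r `^ (k - s - 1) = r `^ (k - 1) * r `^ (- s)); first by ring.
by rewrite -powRD ?(gt_eqF r0) ?implybT//; congr (_ `^ _); ring.
Qed.

End beta.

(** Mass at most 1, rather than 1, is what division by an upper bound of a norm provides; it also
    admits the zero function. *)
Definition density d (X : measurableType d) (R : realType)
    (mu : {measure set X -> \bar R}) (H : X -> R) :=
  [/\ measurable_fun setT H, forall x, 0 <= H x & (\int[mu]_x (H x)%:E <= 1)%E].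

(** * Bilinear estimates for an abstract kernel with heat-type bounds *)

Section heat_bilinear.
Context dX (X : measurableType dX) {R : realType}.
Variable mu : {sigma_finite_measure set X -> \bar R}.
Notation RT := (measurableTypeR R).
Notation lam := (@lebesgue_measure R).
Notation half := (`]0%R, +oo[%classic : set RT).
Variables (g : RT * (X * X) -> R) (A be sigma : R).
Hypotheses (A0 : 0 < A) (be0 : 0 < be) (sigma0 : 0 < sigma).
Hypothesis mg : measurable_fun setT g.
Hypothesis g_ge0 : forall w, 0 <= g w.
Hypothesis g_le0 : forall t z, t <= 0 -> g (t, z) = 0.
Hypothesis g_sym : forall t x y, g (t, (x, y)) = g (t, (y, x)).
Hypothesis g_sup : forall t x y, 0 < t -> g (t, (x, y)) <= A * decay be t.
Hypothesis g_mass : forall t x, 0 < t ->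
  (\int[mu]_y (g (t, (x, y)))%:E <= (A * expR (- (t / 2)))%:E)%E.
Hypothesis g_total : forall t, 0 < t ->
  (\int[mu]_x \int[mu]_y (g (t, (x, y)))%:E <= (A * decay be t)%:E)%E.
Implicit Types (t : R) (F H : X -> R).

Let sg (w : RT * (X * X)) : R := w.1 `^ (sigma - 1) * g w.

Let msg : measurable_fun setT sg.
Proof.
apply: measurable_funM => //.
apply: measurable_fun_powR; exact: measurable_fst.
Qed.

Let sg_ge0 w : 0 <= sg w. Proof. by rewrite mulr_ge0 ?powR_ge0. Qed.

Definition time_kernel (z : X * X) : \bar R :=
  (\int[lam]_t (t `^ (sigma - 1) * g (t, z))%:E)%E.

Lemma time_kernel_ge0 z : (0 <= time_kernel z)%E.
Proof. by apply: integral_ge0 => t _; rewrite lee_fin; exact: (sg_ge0 (t, z)). Qed.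

Lemma time_kernel_sym x y : time_kernel (x, y) = time_kernel (y, x).
Proof. by apply: eq_integral => t _; rewrite g_sym. Qed.

Lemma measurable_time_kernel : measurable_fun setT time_kernel.
Proof.
apply: (measurable_fun_fubini_tonelli_G (m1 := lam) (fun w : RT * (X * X) => (sg w)%:E)).
  exact/measurable_EFinP.
by move=> w; rewrite lee_fin.
Qed.

Lemma integral_time_kernel dY (Y : measurableType dY)
    (nu : {sigma_finite_measure set Y -> \bar R}) (h : Y -> X * X) (Phi : Y -> R) :
  measurable_fun setT h -> measurable_fun setT Phi -> (forall y, 0 <= Phi y) ->
  (\int[nu]_y (time_kernel (h y) * (Phi y)%:E) =
   \int[lam]_(t in half) ((t `^ (sigma - 1))%:E * \int[nu]_y (g (t, h y) * Phi y)%:E))%E.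
Proof.
move=> mh mPhi Phi0.
have mgh t : measurable_fun setT (fun y => g (t, h y)).
  apply: (measurableT_comp mg); apply: measurable_fun_pair => //; exact: measurable_cst.
pose f (w : RT * Y) := (sg (w.1, h w.2) * Phi w.2)%:E.
have f0 w : (0 <= f w)%E by rewrite lee_fin mulr_ge0.
have mf : measurable_fun setT f.
  apply/measurable_EFinP; apply: measurable_funM; last exact: (measurableT_comp mPhi measurable_snd).
  apply: (measurableT_comp msg); apply: measurable_fun_pair; first exact: measurable_fst.
  exact: (measurableT_comp mh measurable_snd).
transitivity (\int[nu]_y \int[lam]_t f (t, y))%E.
  apply: eq_integral => y _; rewrite /time_kernel -ge0_integralZr//.
  - apply/measurable_EFinP.
    have mp : measurable_fun setT (fun t : RT => (t, h y)).
      by apply: measurable_fun_pair; [exact: measurable_id|exact: measurable_cst].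
    exact: (measurableT_comp msg mp).
  - by move=> t _; rewrite lee_fin; exact: (sg_ge0 (t, h y)).
  - by rewrite lee_fin.
rewrite -(fubini_tonelli f)// [RHS]integral_mkcond.
apply: eq_integral => t _; rewrite patchE; case: ifPn => [_|].
  rewrite -ge0_integralZl ?lee_fin ?powR_ge0//.
  - by apply: eq_integral => y _; rewrite /f /sg/= -EFinM mulrA.
  - by apply/measurable_EFinP; apply: measurable_funM.
  - by move=> y _; rewrite lee_fin mulr_ge0.
rewrite notin_setE/= in_itv/= andbT => /negP; rewrite -leNgt => t0.
by rewrite integral0_eq// => y _; rewrite /f /sg/= g_le0// mulr0 mul0r.
Qed.

Lemma time_kernel_le dY (Y : measurableType dY)
    (nu : {sigma_finite_measure set Y -> \bar R}) (h : Y -> X * X) (Phi : Y -> R)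
    (q : R -> R) :
  measurable_fun setT h -> measurable_fun setT Phi -> (forall y, 0 <= Phi y) ->
  measurable_fun half q -> (forall t, 0 < t -> 0 <= q t) ->
  (forall t, 0 < t -> (\int[nu]_y (g (t, h y) * Phi y)%:E <= (q t)%:E)%E) ->
  (\int[nu]_y (time_kernel (h y) * (Phi y)%:E) <=
   \int[lam]_(t in half) (t `^ (sigma - 1) * q t)%:E)%E.
Proof.
move=> mh mPhi Phi0 mq q0 hq; rewrite integral_time_kernel//.
apply: ge0_le_integral => //.
- move=> t _; rewrite mule_ge0 ?lee_fin ?powR_ge0//.
  by apply: integral_ge0 => y _; rewrite lee_fin mulr_ge0.
- apply: emeasurable_funM.
    by apply/measurable_EFinP; apply: measurable_funTS; exact: measurable_powR.
  apply: measurable_funTS.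
  apply: (measurable_fun_fubini_tonelli_F (m2 := nu)
      (fun w : RT * Y => (g (w.1, h w.2) * Phi w.2)%:E)).
    apply/measurable_EFinP; apply: measurable_funM; last exact: (measurableT_comp mPhi measurable_snd).
    apply: (measurableT_comp mg); apply: measurable_fun_pair; first exact: measurable_fst.
    exact: (measurableT_comp mh measurable_snd).
  by move=> w; rewrite lee_fin mulr_ge0.
- apply/measurable_EFinP; apply: measurable_funM => //.
  by apply: measurable_funTS; exact: measurable_powR.
- move=> t; rewrite /= in_itv/= andbT => t0; rewrite EFinM lee_wpmul2l ?lee_fin ?powR_ge0//.
  exact: hq.
Qed.

Let mgt t : measurable_fun setT (fun z => g (t, z)).
Proof.
apply: (measurableT_comp mg); apply: measurable_fun_pair; [exact: measurable_cst|exact: measurable_id].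
Qed.

Let mgtx t x : measurable_fun setT (fun y => g (t, (x, y))).
Proof.
by apply: (measurableT_comp (mgt t)); apply: measurable_fun_pair; [exact: measurable_cst|exact: measurable_id].
Qed.

Let integral_fst (z : X * X -> R) : measurable_fun setT z -> (forall w, 0 <= z w) ->
  (\int[mu \x mu]_w (z w)%:E = \int[mu]_x \int[mu]_y (z (x, y))%:E)%E.
Proof.
by move=> mz z0; rewrite (fubini_tonelli1 (EFin \o z))//; exact/measurable_EFinP.
Qed.

Let integral_snd (z : X * X -> R) : measurable_fun setT z -> (forall w, 0 <= z w) ->
  (\int[mu \x mu]_w (z w)%:E = \int[mu]_y \int[mu]_x (z (x, y))%:E)%E.
Proof.
by move=> mz z0; rewrite (fubini_tonelli2 (EFin \o z))//; exact/measurable_EFinP.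
Qed.

Lemma time_kernel_le2 (Phi : X * X -> R) (q : R -> R) :
  measurable_fun setT Phi -> (forall z, 0 <= Phi z) ->
  measurable_fun half q -> (forall t, 0 < t -> 0 <= q t) ->
  (forall t, 0 < t -> (\int[mu \x mu]_z (g (t, z) * Phi z)%:E <= (q t)%:E)%E) ->
  (\int[mu \x mu]_z (time_kernel z * (Phi z)%:E) <=
   \int[lam]_(t in half) (t `^ (sigma - 1) * q t)%:E)%E.
Proof.
move=> mPhi Phi0 mq q0 hq.
have mpair x : measurable_fun setT (pair x : X -> X * X).
  by apply: measurable_fun_pair; [exact: measurable_cst|exact: measurable_id].
have mgPhi t : measurable_fun setT (fun z => g (t, z) * Phi z) by exact: measurable_funM.
rewrite (fubini_tonelli1 (fun z => time_kernel z * (Phi z)%:E)%E); last 2 first.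
- by apply: emeasurable_funM; [exact: measurable_time_kernel|exact/measurable_EFinP].
- by move=> z; rewrite mule_ge0 ?time_kernel_ge0 ?lee_fin.
pose V (w : X * RT) := ((w.2 `^ (sigma - 1))%:E *
  \int[mu]_y (g (w.2, (w.1, y)) * Phi (w.1, y))%:E)%E.
have V0 w : (0 <= V w)%E.
  rewrite mule_ge0 ?lee_fin ?powR_ge0//.
  by apply: integral_ge0 => y _; rewrite lee_fin mulr_ge0.
have mV : measurable_fun setT V.
  apply: emeasurable_funM.
    apply/measurable_EFinP; apply: measurable_fun_powR; exact: measurable_snd.
  apply: (measurable_fun_fubini_tonelli_F (m2 := mu)
      (fun w : (X * RT) * X => (g (w.1.2, (w.1.1, w.2)) * Phi (w.1.1, w.2))%:E)).
    have m11 : measurable_fun setT (fun w : (X * RT) * X => w.1.1).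
      exact: (measurableT_comp measurable_fst measurable_fst).
    have m12 : measurable_fun setT (fun w : (X * RT) * X => w.1.2).
      exact: (measurableT_comp measurable_snd measurable_fst).
    have m1 : measurable_fun setT (fun w : (X * RT) * X => (w.1.1, w.2)).
      by apply: measurable_fun_pair => //; exact: measurable_snd.
    apply/measurable_EFinP; apply: measurable_funM; last exact: (measurableT_comp mPhi m1).
    by apply: (measurableT_comp mg); exact: measurable_fun_pair.
  by move=> w; rewrite lee_fin mulr_ge0.
apply: (@le_trans _ _ (\int[mu]_x \int[lam]_(t in half) V (x, t))%E).
  apply: eqW; apply: eq_integral => x _.
  rewrite /fubini_F (integral_time_kernel mu (mpair x) (Phi := fun y => Phi (x, y)))//.
  exact: (measurableT_comp mPhi (mpair x)).
rewrite (tonelli_setX mu lam measurableT (measurable_itv _) (measurable_funTS mV))//.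
apply: ge0_le_integral => //.
- by move=> t _; exact: integral_ge0.
- apply: measurable_funTS.
  exact: (measurable_fun_fubini_tonelli_G (m1 := mu) V).
- apply/measurable_EFinP; apply: measurable_funM => //.
  by apply: measurable_funTS; exact: measurable_powR.
move=> t; rewrite /= in_itv/= andbT => t0; rewrite /V/= EFinM.
rewrite ge0_integralZl ?lee_fin ?powR_ge0//.
- rewrite lee_wpmul2l ?lee_fin ?powR_ge0//; apply: le_trans (hq t t0).
  by rewrite integral_fst// => z; rewrite mulr_ge0.
- apply: (measurable_fun_fubini_tonelli_F (m2 := mu) (fun z => (g (t, z) * Phi z)%:E)).
    exact/measurable_EFinP.
  by move=> z; rewrite lee_fin mulr_ge0.
- by move=> x _; apply: integral_ge0 => y _; rewrite lee_fin mulr_ge0.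
Qed.

Let density_mass t H : 0 < t -> density mu H ->
  (\int[mu \x mu]_z (H z.1 * g (t, z))%:E <= (A * expR (- (t / 2)))%:E)%E.
Proof.
move=> t0 [mH H0 H1]; have m0 : 0 <= A * expR (- (t / 2)) by rewrite mulr_ge0 ?expR_ge0// ltW.
rewrite integral_fst; last 2 first.
- apply: measurable_funM => //; exact: (measurableT_comp mH measurable_fst).
- by move=> w; rewrite mulr_ge0.
rewrite (_ : (A * expR _)%:E = 1 * (A * expR (- (t / 2)))%:E)%E; last by rewrite mul1e.
apply: (@le_trans _ _ ((\int[mu]_x (H x)%:E) * (A * expR (- (t / 2)))%:E)%E); last first.
  by rewrite lee_wpmul2r ?lee_fin.
rewrite -ge0_integralZr//; last 2 first.
- exact/measurable_EFinP.
- by move=> x _; rewrite lee_fin.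
apply: ge0_le_integral => //.
- by move=> x _; apply: integral_ge0 => y _; rewrite lee_fin mulr_ge0.
- apply: (measurable_fun_fubini_tonelli_F (m2 := mu) (fun z : X * X => (H z.1 * g (t, z))%:E)).
    apply/measurable_EFinP; apply: measurable_funM => //.
    exact: (measurableT_comp mH measurable_fst).
  by move=> w; rewrite lee_fin mulr_ge0.
- by apply: emeasurable_funM; [exact/measurable_EFinP|exact: measurable_cst].
- move=> x _ /=; under eq_integral do rewrite EFinM.
  rewrite ge0_integralZl ?lee_fin//.
  + by rewrite lee_wpmul2l ?lee_fin//; exact: g_mass.
  + exact/measurable_EFinP.
  + by move=> y _; rewrite lee_fin.
Qed.

Let density_mass_snd t F : 0 < t -> density mu F ->
  (\int[mu \x mu]_z (F z.2 * g (t, z))%:E <= (A * expR (- (t / 2)))%:E)%E.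
Proof.
move=> t0 dF; have [mF F0 _] := dF; apply: le_trans (density_mass t0 dF).
rewrite integral_snd; last 2 first.
- apply: measurable_funM => //; exact: (measurableT_comp mF measurable_snd).
- by move=> w; rewrite mulr_ge0.
rewrite integral_fst; last 2 first.
- apply: measurable_funM => //; exact: (measurableT_comp mF measurable_fst).
- by move=> w; rewrite mulr_ge0.
by apply: eqW; apply: eq_integral => y _;
  apply: eq_integral => x _ /=; rewrite g_sym.
Qed.

Let bilinear F P H r (z : X * X) : R := F z.2 `^ P * H z.1 `^ r.

Let mbilinear F P H r : measurable_fun setT F -> measurable_fun setT H ->
  measurable_fun setT (bilinear F P H r).
Proof.
move=> mF mH; apply: measurable_funM.
  exact: measurable_fun_powR (measurableT_comp mF measurable_snd).
exact: measurable_fun_powR (measurableT_comp mH measurable_fst).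
Qed.

Lemma subcritical_fixed_time F P H r t :
  0 < t -> 0 <= P <= 1 -> 0 <= r <= 1 ->
  density mu F -> density mu H ->
  (\int[mu \x mu]_z (g (t, z) * bilinear F P H r z)%:E <=
   (t `^ (- (be * `|P + r - 1|)) * (4 * (A * expR (- (t / 2)))))%:E)%E.
Proof.
move=> t0 P01 r01 dF dH; have [mF F0 F1] := dF; have [mH H0 H1] := dH; set m := A * expR (- (t / 2)).
have m0 : 0 <= m by rewrite mulr_ge0 ?expR_ge0// ltW.
(* This choice gives g <= m / T, and T g has total mass at most m. Each of the four terms of
   [kernel_pointwise] then has integral at most m, whence the factor 4. *)
pose T := t `^ be; have T0 : 0 < T by exact: powR_gt0.
have mT z : g (t, z) <= m / T.
  case: z => x y; apply: (le_trans (g_sup x y t0)).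
  by rewrite /decay powRN /m /T; apply: eqW; ring.
have mF2 : measurable_fun setT (fun z : X * X => F z.2) by exact: (measurableT_comp mF measurable_snd).
have mH1 : measurable_fun setT (fun z : X * X => H z.1) by exact: (measurableT_comp mH measurable_fst).
pose f1 (z : X * X) := F z.2 * g (t, z); pose f2 (z : X * X) := H z.1 * g (t, z).
pose f3 (z : X * X) := T * g (t, z); pose f4 (z : X * X) := m * (F z.2 * H z.1).
have [p1 p2 p3 p4] : [/\ forall z, 0 <= f1 z, forall z, 0 <= f2 z,
    forall z, 0 <= f3 z & forall z, 0 <= f4 z].
  by split=> z; rewrite !mulr_ge0// ltW.
have [q1 q2 q3 q4] : [/\ measurable_fun setT f1, measurable_fun setT f2,
    measurable_fun setT f3 & measurable_fun setT f4].
  by split; apply: measurable_funM => //; apply: measurable_funM.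
have i1 : (\int[mu \x mu]_z (f1 z)%:E <= m%:E)%E by exact: density_mass_snd.
have i2 : (\int[mu \x mu]_z (f2 z)%:E <= m%:E)%E by exact: density_mass.
have i3 : (\int[mu \x mu]_z (f3 z)%:E <= m%:E)%E.
  rewrite /f3; under eq_integral do rewrite EFinM.
  rewrite ge0_integralZl ?lee_fin ?(ltW T0)//; last 2 first.
  - exact/measurable_EFinP.
  - by move=> z _; rewrite lee_fin.
  rewrite integral_fst//; apply: (@le_trans _ _ (T%:E * (A * decay be t)%:E)%E).
    by rewrite lee_wpmul2l ?lee_fin ?(ltW T0)//; exact: g_total.
  rewrite -EFinM lee_fin /decay powRN /m /T; apply: eqW.
  by field; rewrite gt_eqF.
have i4 : (\int[mu \x mu]_z (f4 z)%:E <= m%:E)%E.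
  rewrite /f4; under eq_integral do rewrite EFinM.
  rewrite ge0_integralZl ?lee_fin//; last 2 first.
  - by apply/measurable_EFinP; exact: measurable_funM.
  - by move=> z _; rewrite lee_fin mulr_ge0.
  rewrite -[leRHS]mule1 lee_wpmul2l ?lee_fin//.
  rewrite integral_fst; [|exact: measurable_funM|by move=> w; rewrite mulr_ge0].
  apply: (@le_trans _ _ (\int[mu]_x (H x)%:E)%E) => //.
  apply: ge0_le_integral => //.
  - by move=> x _; apply: integral_ge0 => y _; rewrite lee_fin mulr_ge0.
  - apply: (measurable_fun_fubini_tonelli_F (m2 := mu) (fun z : X * X => (F z.2 * H z.1)%:E)).
      by apply/measurable_EFinP; exact: measurable_funM.
    by move=> w; rewrite lee_fin mulr_ge0.
  - exact/measurable_EFinP.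
  - move=> x _ /=; under eq_integral do rewrite EFinM.
    rewrite ge0_integralZr ?lee_fin//; last 2 first.
    + exact/measurable_EFinP.
    + by move=> y _; rewrite lee_fin.
    by rewrite -[leRHS]mul1e lee_wpmul2r ?lee_fin.
have TE : T `^ (- `|P + r - 1|) = t `^ (- (be * `|P + r - 1|)).
  by rewrite /T -powRrM mulrN.
apply: (@le_trans _ _ (\int[mu \x mu]_z ((T `^ (- `|P + r - 1|))%:E *
    ((f1 z)%:E + (f2 z)%:E + (f3 z)%:E + (f4 z)%:E)))%E).
  apply: ge0_le_integral => //.
  - by move=> z _; rewrite lee_fin mulr_ge0// mulr_ge0 ?powR_ge0.
  - by apply/measurable_EFinP; apply: measurable_funM => //; exact: mbilinear.
  - apply: measurable_funeM; do 3! (apply: emeasurable_funD; last exact/measurable_EFinP).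
    exact/measurable_EFinP.
  - move=> z _; rewrite -!EFinD -EFinM lee_fin.
    exact: kernel_pointwise.
rewrite ge0_integralZl ?lee_fin ?powR_ge0//; last 2 first.
- by do 3! (apply: emeasurable_funD; last exact/measurable_EFinP); exact/measurable_EFinP.
- by move=> z _; rewrite -!EFinD lee_fin !addr_ge0.
rewrite TE EFinM lee_wpmul2l ?lee_fin ?powR_ge0//.
rewrite !ge0_integralD//; try by [move=> z _; rewrite -?EFinD lee_fin ?addr_ge0|exact/measurable_EFinP].
- rewrite (_ : 4 * m = m + m + m + m); last by ring.
  by rewrite !EFinD !leeD.
- by apply: emeasurable_funD; exact/measurable_EFinP.
- by do 2! (apply: emeasurable_funD; last exact/measurable_EFinP); exact/measurable_EFinP.
Qed.

Lemma subcritical_bound P r : 0 <= P <= 1 -> 0 <= r <= 1 ->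
  be * `|P + r - 1| < sigma -> exists2 C : R, 0 <= C & forall F H,
    density mu F -> density mu H ->
  (\int[mu \x mu]_z (time_kernel z * (F z.2 `^ P * H z.1 `^ r)%:E) <= C%:E)%E.
Proof.
move=> P01 r01; set k := be * _ => ks; have s0 : 0 < sigma - k by rewrite subr_gt0.
have A40 : 0 <= 4 * A by rewrite mulr_ge0// ltW.
(* The integral of t^(sigma - 1) against the bound 4 A t^(-k) e^(-t/2) at fixed time. *)
exists (4 * A * (Gamma (sigma - k) * (1 / 2) `^ (- (sigma - k)))).
  by rewrite mulr_ge0// mulr_ge0 ?powR_ge0// ltW// Gamma_gt0.
move=> F H dF dH; have [mF _ _] := dF; have [mH _ _] := dH.
have q0 t : 0 < t -> 0 <= t `^ (- k) * (4 * (A * expR (- (t / 2)))).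
  by move=> _; rewrite mulr_ge0 ?powR_ge0// mulr_ge0// mulr_ge0 ?expR_ge0// ltW.
have bi0 z : 0 <= bilinear F P H r z by rewrite mulr_ge0 ?powR_ge0.
have := @time_kernel_le2 (bilinear F P H r) _ (mbilinear P r mF mH) bi0 _ q0 _.
rewrite /bilinear => h; apply: (le_trans (h _ _)).
- apply: measurable_funM; first by apply: measurable_funTS; exact: measurable_powR.
  apply: measurable_funM => //; apply: measurable_funM => //.
  by apply: measurableT_comp => //; apply: measurableT_comp => //; exact: measurable_funM.
- move=> t t0; exact: subcritical_fixed_time.
have h2 : 0 < 1 / 2 :> R by lra.
rewrite -(integral_gamma_scaleZ A40 s0 h2).
apply: eqW; apply: eq_integral => t.
rewrite inE/= in_itv/= andbT => t0; congr EFin.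
rewrite (_ : t `^ (sigma - k - 1) = t `^ (sigma - 1) * t `^ (- k)); last first.
  by rewrite -powRD ?(gt_eqF t0) ?implybT//; congr (_ `^ _); ring.
by rewrite mul1r; ring.
Qed.

Let mcut H r l : measurable_fun setT H ->
  measurable_fun setT (fun x => if H x <= l then H x `^ r else 0).
Proof.
move=> mH; apply: measurable_fun_ifT => //; last exact: measurable_fun_powR.
by apply: measurable_fun_ler.
Qed.

(** The bound with l^r replaces H by its truncation level and uses the mass of g. The other one
    forgets the truncation and combines, by AM-GM with T = t^be, the supremum of g with the mass of
    H. They cross at t^be = 1 / l. *)
Lemma cut_fixed_time H r l t x : 0 < t -> 0 <= r <= 1 -> 0 < l ->
  density mu H ->
  (\int[mu]_y (g (t, (x, y)) * (if H y <= l then H y `^ r else 0))%:E <=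
   (2 * A * Num.min (l `^ r) (t `^ (- (be * r))))%:E)%E.
Proof.
move=> t0 r01 l0 [mH H0 H1]; have /andP[r0 r1] := r01.
set I := (\int[mu]_y _)%E.
have A2 : 0 <= 2 * A by rewrite mulr_ge0// ltW.
have et1 : expR (- (t / 2)) <= 1 by rewrite expR_le1 oppr_le0 divr_ge0// ltW.
have cut0 y : 0 <= (if H y <= l then H y `^ r else 0) by case: ifP => // _; exact: powR_ge0.
have mI : measurable_fun setT (fun y => (g (t, (x, y)) * (if H y <= l then H y `^ r else 0))%:E).
  by apply/measurable_EFinP; apply: measurable_funM => //; exact: mcut.
have I0 y : (0 <= (g (t, (x, y)) * (if H y <= l then H y `^ r else 0))%:E)%E.
  by rewrite lee_fin mulr_ge0.
have mgE : measurable_fun setT (fun y => (g (t, (x, y)))%:E) by exact/measurable_EFinP.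
have mass1 : (\int[mu]_y (g (t, (x, y)))%:E <= A%:E)%E.
  by rewrite (le_trans (g_mass x t0))// lee_fin ler_piMr// ltW.
have I1 : (I <= (2 * A * l `^ r)%:E)%E.
  apply: (@le_trans _ _ (\int[mu]_y ((l `^ r)%:E * (g (t, (x, y)))%:E))%E).
    apply: ge0_le_integral => //; first by apply: measurable_funeM.
    move=> y _; rewrite -EFinM lee_fin mulrC ler_wpM2r//.
    by case: ifPn => [Hl|_]; [rewrite powR_le_base|exact: powR_ge0].
  rewrite ge0_integralZl ?lee_fin ?powR_ge0//; last by move=> y _; rewrite lee_fin.
  apply: (@le_trans _ _ ((l `^ r)%:E * A%:E)%E); first by rewrite lee_wpmul2l ?lee_fin ?powR_ge0.
  rewrite -EFinM lee_fin mulrC ler_wpM2r ?powR_ge0//; by move: (ltW A0); lra.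
pose T := t `^ be; have T0 : 0 < T by exact: powR_gt0.
have I2 : (I <= (2 * A * t `^ (- (be * r)))%:E)%E.
  have Hg0 y : 0 <= H y * g (t, (x, y)) by exact: mulr_ge0.
  have mHg : measurable_fun setT (fun y => H y * g (t, (x, y))) by exact: measurable_funM.
  apply: (@le_trans _ _ (\int[mu]_y ((T `^ (- r))%:E *
      (T%:E * (H y * g (t, (x, y)))%:E + (g (t, (x, y)))%:E)))%E).
    apply: ge0_le_integral => //.
      by apply: measurable_funeM; apply: emeasurable_funD => //; apply: measurable_funeM;
        exact/measurable_EFinP.
    move=> y _; rewrite (_ : (_ * (_ + _))%E =
      (T `^ (- r) * (T * (H y * g (t, (x, y))) + g (t, (x, y))))%:E)// lee_fin.
    apply: le_trans (kernel_pointwise_one (g_ge0 _) (H0 y) r01 T0).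
    by rewrite ler_wpM2l//; case: ifP => // _; exact: powR_ge0.
  have mTHg : measurable_fun setT (fun y => (T%:E * (H y * g (t, (x, y)))%:E)%E).
    by apply: measurable_funeM; exact/measurable_EFinP.
  have THg0 y : (0 <= T%:E * (H y * g (t, (x, y)))%:E)%E.
    by rewrite -EFinM lee_fin mulr_ge0// ltW.
  rewrite ge0_integralZl; [|exact: measurableT|exact: emeasurable_funD|
    by move=> y _; rewrite adde_ge0// lee_fin|by rewrite lee_fin powR_ge0].
  rewrite ge0_integralD//; last by move=> y _; rewrite lee_fin.
  rewrite ge0_integralZl ?lee_fin ?(ltW T0)//; last 2 first.
  - exact/measurable_EFinP.
  - by move=> y _; rewrite lee_fin.
  have hHg : (\int[mu]_y (H y * g (t, (x, y)))%:E <= (A * decay be t)%:E)%E.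
    apply: (@le_trans _ _ (\int[mu]_y ((A * decay be t)%:E * (H y)%:E))%E).
      apply: ge0_le_integral => //.
      - by move=> y _; rewrite lee_fin.
      - exact/measurable_EFinP.
      - by apply: measurable_funeM; exact/measurable_EFinP.
      - by move=> y _; rewrite -EFinM lee_fin mulrC ler_wpM2r// g_sup.
    have Ad0 : 0 <= A * decay be t.
      by rewrite mulr_ge0 ?(ltW A0)// mulr_ge0 ?powR_ge0 ?expR_ge0.
    rewrite ge0_integralZl ?lee_fin//; last 2 first.
    - exact/measurable_EFinP.
    - by move=> y _; rewrite lee_fin.
    by rewrite -[leRHS]mule1 lee_wpmul2l ?lee_fin.
  apply: (@le_trans _ _ ((T `^ (- r))%:E * (T%:E * (A * decay be t)%:E + A%:E))%E).
    by rewrite lee_wpmul2l ?lee_fin ?powR_ge0// leeD// lee_wpmul2l ?lee_fin ?(ltW T0).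
  rewrite (_ : (_%:E * (_ + _))%E =
    (T `^ (- r) * (T * (A * decay be t) + A))%:E)// lee_fin (_ : t `^ (- (be * r)) = T `^ (- r)); last first.
    by rewrite /T -powRrM mulrN.
  rewrite mulrC ler_wpM2r ?powR_ge0//.
  rewrite (_ : T * _ = A * expR (- (t / 2))).
    have : A * expR (- (t / 2)) <= A by rewrite ler_piMr// ltW.
    lra.
  by rewrite /decay powRN /T; field; rewrite gt_eqF.
by rewrite minEle; case: ifP.
Qed.

(** The minimum of the two bounds at fixed time is integrated as a beta integral with L = l^(-1/be)
    and k = be r, giving a multiple of L^(sigma - k) = l^(r - th). Convergence at infinity is sigma
    < k, that is, th < r. *)
Lemma cut_bound th r : sigma = be * th -> th < r -> r <= 1 ->
  exists2 C : R, 0 <= C & forall H,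
  density mu H ->
  forall x l, 0 <= l ->
  (\int[mu]_y (time_kernel (x, y) * (if H y <= l then H y `^ r else 0)%:E) <=
   (C * l `^ (r - th))%:E)%E.
Proof.
move=> sE thr r1; have th0 : 0 < th by move: sigma0; rewrite sE pmulr_rgt0.
have r0 : 0 < r by exact: lt_trans thr.
set k := be * r; have k0 : 0 < k by exact: mulr_gt0.
have sk : sigma < k by rewrite sE /k ltr_pM2l.
pose c := Gamma sigma * Gamma (k - sigma) / Gamma k.
have c0 : 0 <= c by rewrite /c divr_ge0 ?mulr_ge0// ltW// Gamma_gt0// subr_gt0.
pose M := 2 * A * 2 `^ k.
have M0 : 0 <= M by rewrite mulr_ge0 ?powR_ge0// mulr_ge0// ltW.
exists (M * c); first exact: mulr_ge0.
move=> H dH x l l0; have [mH H0 _] := dH.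
have cut0 y : 0 <= (if H y <= l then H y `^ r else 0) by case: ifP => // _; exact: powR_ge0.
(* At level 0 the integrand vanishes, since H y <= 0 forces H y = 0 and 0^r = 0 for r > 0; [L] would
   not be meaningful there. *)
have [l00|lp] := eqVneq l 0.
  rewrite integral0_eq; first by rewrite lee_fin mulr_ge0 ?powR_ge0// mulr_ge0.
  move=> y _; case: ifPn => [Hl|_]; last by rewrite mule0.
  have -> : H y = 0 by apply/eqP; rewrite eq_le H0 -l00 Hl.
  by rewrite powR0 ?mule0// gt_eqF.
have {}lp : 0 < l by rewrite lt_neqAle eq_sym lp.
pose L := l `^ (- be^-1); have L0 : 0 < L by exact: powR_gt0.
have q0 t : 0 < t -> 0 <= M * (L + t) `^ (- k) by move=> _; rewrite mulr_ge0 ?powR_ge0.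
have mq : measurable_fun half (fun t : R => (L + t) `^ (- k)).
  apply: measurable_funTS; apply: measurable_fun_powR; exact: measurable_funD.
apply: (le_trans (time_kernel_le (nu := mu) (h := fun y => (x, y))
  (q := fun t => M * (L + t) `^ (- k)) _ (mcut r l mH) cut0 _ q0 _)).
- by apply: measurable_fun_pair; [exact: measurable_cst|exact: measurable_id].
- exact: measurable_funM.
- move=> t t0; apply: (le_trans (cut_fixed_time x t0 _ lp dH)); first by rewrite (ltW r0).
  rewrite lee_fin /M -[leRHS]mulrA ler_wpM2l ?mulr_ge0 ?(ltW A0)//.
  by apply: min_powR_le => //; exact: ltW.
rewrite (eq_integral (fun t : RT => (M%:E * (t `^ (sigma - 1) * (L + t) `^ (- k))%:E)%E)); last first.
  by move=> t _; rewrite -EFinM; congr EFin; ring.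
rewrite ge0_integralZl ?lee_fin//; last 2 first.
- apply/measurable_EFinP; apply: measurable_funM => //.
  by apply: measurable_funTS; exact: measurable_powR.
- by move=> t _; rewrite lee_fin mulr_ge0 ?powR_ge0.
rewrite integral_beta// -EFinM lee_fin -/c mulrA; apply: eqW.
congr (_ * _); rewrite /L -powRrM; congr (_ `^ _); rewrite /k sE; field.
by rewrite gt_eqF.
Qed.

(* Where H(x) <= F(y), integrating in x first leaves F(y)^P F(y)^(r - th) = F(y);
   the other half is symmetric. *)
Lemma critical_bound th P r : sigma = be * th -> P + r = 1 + th ->
  th < P -> P <= 1 -> th < r -> r <= 1 ->
  exists2 C : R, 0 <= C & forall F H,
    density mu F -> density mu H ->
  (\int[mu \x mu]_z (time_kernel z * (F z.2 `^ P * H z.1 `^ r)%:E) <= C%:E)%E.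
Proof.
move=> sE Pr thP P1 thr r1; have th0 : 0 < th by move: sigma0; rewrite sE pmulr_rgt0.
have [C1 C10 HC1] := cut_bound sE thr r1.
have [C2 C20 HC2] := cut_bound sE thP P1.
exists (C1 + C2) => [|F H dF dH]; first exact: addr_ge0.
have [mF F0 _] := dF; have [mH H0 _] := dH.
pose cut (u v q : R) := if u <= v then u `^ q else 0.
have cut0 u v q : 0 <= cut u v q by rewrite /cut; case: ifP => // _; exact: powR_ge0.
have mF2 : measurable_fun setT (fun z : X * X => F z.2) by exact: (measurableT_comp mF measurable_snd).
have mH1 : measurable_fun setT (fun z : X * X => H z.1) by exact: (measurableT_comp mH measurable_fst).
have mcut2 (f1 f2 : X * X -> R) q : measurable_fun setT f1 -> measurable_fun setT f2 ->
    measurable_fun setT (fun z => cut (f1 z) (f2 z) q).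
  move=> m1 m2; apply: measurable_fun_ifT => //; first exact: measurable_fun_ler.
  exact: measurable_fun_powR.
have one C (f : X -> R) p q : 0 <= C -> p + (q - th) = 1 -> 0 <= p -> th < q ->
    density mu f -> (\int[mu]_x ((f x `^ p)%:E * (C * f x `^ (q - th))%:E) <= C%:E)%E.
  move=> C0 pq p0 thq [mf f0 f1]; apply: (@le_trans _ _ (\int[mu]_x (C%:E * (f x)%:E))%E).
    apply: eqW; apply: eq_integral => x _.
    by rewrite -!EFinM mulrCA -ge0_powRD ?subr_ge0 ?(ltW thq)// pq powRr1.
  rewrite ge0_integralZl ?lee_fin//; last 2 first.
  - exact/measurable_EFinP.
  - by move=> x _; rewrite lee_fin.
  by rewrite -[leRHS]mule1 lee_wpmul2l ?lee_fin.
pose f1 (z : X * X) := F z.2 `^ P * cut (H z.1) (F z.2) r.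
pose f2 (z : X * X) := H z.1 `^ r * cut (F z.2) (H z.1) P.
have f10 z : 0 <= f1 z by rewrite mulr_ge0 ?powR_ge0.
have f20 z : 0 <= f2 z by rewrite mulr_ge0 ?powR_ge0.
have mf1 : measurable_fun setT f1.
  apply: measurable_funM; last exact: mcut2.
  exact: measurable_fun_powR.
have mf2 : measurable_fun setT f2.
  apply: measurable_funM; last exact: mcut2.
  exact: measurable_fun_powR.
have mtk (f : X * X -> R) : measurable_fun setT f -> measurable_fun setT (fun z => time_kernel z * (f z)%:E)%E.
  by move=> mf; apply: emeasurable_funM; [exact: measurable_time_kernel|exact/measurable_EFinP].
have tk0 (f : X * X -> R) z : 0 <= f z -> (0 <= time_kernel z * (f z)%:E)%E.
  by move=> fz; rewrite mule_ge0 ?time_kernel_ge0.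
have mtkx x : measurable_fun setT (fun y => time_kernel (x, y)).
  apply: (measurableT_comp measurable_time_kernel).
  by apply: measurable_fun_pair; [exact: measurable_cst|exact: measurable_id].
have mcutx (f : X -> R) l q : measurable_fun setT f -> measurable_fun setT (fun x => (cut (f x) l q)%:E).
  by move=> mf; apply/measurable_EFinP; exact: mcut.
apply: (@le_trans _ _ (\int[mu \x mu]_z (time_kernel z * (f1 z)%:E + time_kernel z * (f2 z)%:E))%E).
  apply: ge0_le_integral => //.
  - by move=> z _; apply: (tk0 (bilinear F P H r)); rewrite mulr_ge0 ?powR_ge0.
  - by apply: (mtk (bilinear F P H r)); exact: mbilinear.
  - by apply: emeasurable_funD; exact: mtk.
  - move=> z _; rewrite -ge0_muleDr ?lee_fin// lee_wpmul2l ?time_kernel_ge0// -EFinD lee_fin.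
    rewrite /f1 /f2 /cut; have [h|h] := leP (H z.1) (F z.2).
      by rewrite lerDl mulr_ge0 ?powR_ge0//; case: ifP => // _; exact: powR_ge0.
    by rewrite (ltW h) mulr0 add0r mulrC.
rewrite ge0_integralD//; try by [move=> z _; exact: tk0|exact: mtk].
rewrite EFinD leeD//.
  rewrite (fubini_tonelli2 (fun z => time_kernel z * (f1 z)%:E)%E)//; try by [exact: mtk|move=> z; exact: tk0].
  apply: le_trans (one C1 F P r C10 _ _ thr dF); [|lra|lra].
  apply: ge0_le_integral => //.
  - by move=> y _; apply: integral_ge0 => x _; exact: tk0.
  - by apply: (measurable_fun_fubini_tonelli_G (m1 := mu) (fun z => time_kernel z * (f1 z)%:E)%E);
      [exact: mtk|move=> z; exact: tk0].
  - by apply: emeasurable_funM; apply/measurable_EFinP; [|apply: measurable_funM => //]; exact: measurable_fun_powR.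
  - move=> y _; apply: (@le_trans _ _ (\int[mu]_x ((F y `^ P)%:E *
        (time_kernel (y, x) * (cut (H x) (F y) r)%:E)))%E).
      apply: eqW; apply: eq_integral => x _.
      by rewrite /f1/= time_kernel_sym EFinM muleCA.
    rewrite ge0_integralZl ?lee_fin ?powR_ge0//.
    + by rewrite lee_wpmul2l ?lee_fin ?powR_ge0//; exact: HC1.
    + by apply: emeasurable_funM => //; exact: mcutx.
    + by move=> x _; rewrite mule_ge0 ?time_kernel_ge0 ?lee_fin.
rewrite (fubini_tonelli1 (fun z => time_kernel z * (f2 z)%:E)%E)//; try by [exact: mtk|move=> z; exact: tk0].
apply: le_trans (one C2 H r P C20 _ _ thP dH); [|lra|lra].
apply: ge0_le_integral => //.
- by move=> x _; apply: integral_ge0 => y _; exact: tk0.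
- by apply: (measurable_fun_fubini_tonelli_F (m2 := mu) (fun z => time_kernel z * (f2 z)%:E)%E);
    [exact: mtk|move=> z; exact: tk0].
- by apply: emeasurable_funM; apply/measurable_EFinP; [|apply: measurable_funM => //]; exact: measurable_fun_powR.
- move=> x _; apply: (@le_trans _ _ (\int[mu]_y ((H x `^ r)%:E *
      (time_kernel (x, y) * (cut (F y) (H x) P)%:E)))%E).
    apply: eqW; apply: eq_integral => y _.
    by rewrite /f2/= EFinM muleCA.
  rewrite ge0_integralZl ?lee_fin ?powR_ge0//.
  + by rewrite lee_wpmul2l ?lee_fin ?powR_ge0//; exact: HC2.
  + by apply: emeasurable_funM => //; exact: mcutx.
  + by move=> y _; rewrite mule_ge0 ?time_kernel_ge0 ?lee_fin.
Qed.

End heat_bilinear.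

(** * Duality *)

Section duality.
Context d (X : measurableType d) {R : realType}.
Variable mu : {sigma_finite_measure set X -> \bar R}.
Implicit Types (F H f : X -> R) (V : X -> \bar R) (r B N : R) (p q : \bar R).

Lemma finite_exhaustion : exists E : nat -> set X,
  [/\ \bigcup_n E n = setT, {homo E : n m / (n <= m)%N >-> n `<=` m} &
      forall n, measurable (E n) /\ (mu (E n) < +oo)%E].
Proof.
have /sigma_finiteP[E [ET ndE Efin]] := sigma_finiteT mu.
by exists E; split => // n m nm; apply/subsetPset; exact: ndE.
Qed.

Section dual.
Variables (V : X -> \bar R) (r B : R).
Hypotheses (mV : measurable_fun setT V) (V0 : forall x, (0 <= V x)%E).
Hypotheses (r0 : 0 <= r) (B0 : 0 <= B).
(* The unit ball of the dual of L^s, 1/s = 1 - r, consists up to signs of the H^r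
   with H of mass at most 1. *)
Hypothesis dualV : forall H, density mu H ->
  (\int[mu]_x (V x * (H x `^ r)%:E) <= B%:E)%E.

(** The hypothesis is tested on the normalized indicator of S, whose r-th power is mu(S)^(-r) on
    S. *)
Lemma dual_indicator (S : set X) : measurable S -> (0 < mu S)%E -> (mu S < +oo)%E ->
  (\int[mu]_(x in S) V x <= (B * fine (mu S) `^ r)%:E)%E.
Proof.
move=> mS S0 Soo; have Sfin : mu S \is a fin_num by rewrite ge0_fin_numE.
set m := fine (mu S); have mE : mu S = m%:E by rewrite fineK.
have m0 : 0 < m by rewrite -lte_fin -mE.
have mi0 : 0 <= m^-1 by rewrite invr_ge0 ltW.
pose H x : R := m^-1 * \1_S x.
have H0 x : 0 <= H x by rewrite mulr_ge0.
have mH : measurable_fun setT H by apply: measurable_funM => //; exact: measurable_indic.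
have dH : density mu H.
  split=> //; under eq_integral do rewrite EFinM.
  rewrite ge0_integralZl ?lee_fin//.
    rewrite (_ : (\int[mu]_x (\1_S x)%:E)%E = m%:E).
      by rewrite -EFinM lee_fin mulVf// gt_eqF.
    by rewrite integral_indic// setIT; exact: mE.
  by apply/measurable_EFinP; exact: measurable_indic.
have mHr : measurable_fun setT (fun x => H x `^ r).
  exact: measurable_fun_powR.
apply: (@le_trans _ _ ((m `^ r)%:E * \int[mu]_x (V x * (H x `^ r)%:E))%E); last first.
  by rewrite mulrC EFinM lee_wpmul2l ?lee_fin ?powR_ge0//; exact: dualV.
rewrite -ge0_integralZl ?lee_fin ?powR_ge0//; last 2 first.
- by apply: emeasurable_funM => //; exact/measurable_EFinP.
- by move=> x _; rewrite mule_ge0 ?lee_fin ?powR_ge0.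
rewrite [leLHS]integral_mkcond; apply: ge0_le_integral => //.
- by move=> x _; rewrite patchE; case: ifP.
- exact: (measurable_restrictT V mS).1 (measurable_funTS mV).
- by apply: measurable_funeM; apply: emeasurable_funM => //; exact/measurable_EFinP.
move=> x _; rewrite patchE; case: ifPn => xS; last first.
  by rewrite mule_ge0 ?lee_fin ?powR_ge0// mule_ge0 ?lee_fin ?powR_ge0.
rewrite muleCA -EFinM /H indicE xS mulr1 powR_inv ?(ltW m0)// mulfV ?mule1//.
by rewrite gt_eqF// powR_gt0.
Qed.

(** By sigma-finiteness S is a countable union of subsets of finite measure, each of which must then
    be null. *)
Lemma dual_negligible (S : set X) : measurable S ->
  (forall T, measurable T -> T `<=` S -> (0 < mu T)%E -> (mu T < +oo)%E -> False) ->
  mu.-negligible S.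
Proof.
move=> mS hS; have [E [ET ndE Efin]] := finite_exhaustion.
apply: (@negligibleS _ _ _ mu (\bigcup_n (S `&` E n))).
  by move=> x Sx; have [n _ En] : (\bigcup_n E n) x by [rewrite ET]; exists n.
apply: negligible_bigcup => n; have [mE Eoo] := Efin n.
have mSE : measurable (S `&` E n) by exact: measurableI.
apply/negligibleP => //; apply/eqP/negPn/negP => SE0.
apply: (hS (S `&` E n) mSE (@subIsetl _ _ _)).
  by rewrite lt_neqAle eq_sym SE0/=.
apply: le_lt_trans Eoo; apply: le_measure; rewrite ?inE//.
Qed.

Lemma dual_ae_fin_num : {ae mu, forall x, V x \is a fin_num}.
Proof.
have mS : measurable (V @^-1` [set +oo%E]).
  by rewrite -[X in measurable X]setTI; apply: mV => //; exact: emeasurable_set1.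
have : mu.-negligible (V @^-1` [set +oo%E]).
  apply: dual_negligible => // T mT TS T0 Too; have := dual_indicator mT T0 Too.
  rewrite (eq_integral (cst +oo%E)); last by move=> x /[!inE] /TS.
  by rewrite integral_cst// gt0_mulye.
apply: negligibleS => x /= /negP; rewrite ge0_fin_numE// -leNgt leye_eq.
by move/eqP.
Qed.

(** The extremal density of duality is H = V^s / c, where c is the integral of V^s. Since 1 + s r =
    s, the hypothesis becomes c^(1 - r) <= B, that is, c <= B^s. Restricting V to sets of finite
    measure on which V <= n makes c finite, so that dividing by it is legitimate; monotone
    convergence removes the restriction. *)
Lemma dual_Lnorm_real (s : R) : 0 < s -> s^-1 = 1 - r ->
  (\int[mu]_x (`|V x| `^ s) <= (B `^ s)%:E)%E.
Proof.
move=> s0 sr; have s1 : 1 + s * r = s.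
  by have := mulfV (lt0r_neq0 s0); rewrite sr; lra.
have [E [ET ndE Efin]] := finite_exhaustion.
have mVs : measurable_fun setT (fun x => (`|V x| `^ s)%E).
  apply: (@measurableT_comp _ _ _ _ _ _ (fun t : \bar R => t `^ s)%E).
    exact: measurable_poweR.
  exact: measurableT_comp.
pose D n := E n `&` V @^-1` [set u | (u <= n%:R%:E)%E].
have mVn n : measurable (V @^-1` [set u | (u <= n%:R%:E)%E]).
  rewrite -[X in measurable X]setTI; apply: mV => //.
  rewrite (_ : [set u | _] = `]-oo, n%:R%:E]%classic); first exact: emeasurable_itv.
  by apply/seteqP; split => u; rewrite /= in_itv.
have mD n : measurable (D n) by apply: measurableI => //; exact: (Efin n).1.
have ndD : {homo D : n m / (n <= m)%N >-> (n <= m)%O}.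
  move=> n m nm; apply/subsetPset => x [Ex Vx]; split; first exact: ndE Ex.
  by apply: (le_trans Vx); rewrite lee_fin ler_nat.
have DV n x : D n x -> V x = (fine (V x))%:E /\ 0 <= fine (V x) <= n%:R.
  move=> [_ /= Vx]; have Vf : V x \is a fin_num by rewrite ge0_fin_numE// (le_lt_trans Vx)// ltry.
  by split; [rewrite fineK|rewrite -!lee_fin fineK// V0].
have bound n : (\int[mu]_(x in D n) (`|V x| `^ s) <= (B `^ s)%:E)%E.
  have DE : (\int[mu]_(x in D n) (`|V x| `^ s) =
      \int[mu]_x (fine (V x) `^ s * \1_(D n) x)%:E)%E.
    rewrite integral_mkcond; apply: eq_integral => x _; rewrite patchE indicE.
    case: ifPn => [/[!inE] Dx|_]; last by rewrite mulr0.
    have [VE /andP[v0 _]] := DV n x Dx.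
    by rewrite mulr1 VE gee0_abs// poweR_EFin.
  pose G x := fine (V x) `^ s * \1_(D n) x.
  have G0 x : 0 <= G x by rewrite mulr_ge0 ?powR_ge0.
  have mG : measurable_fun setT G.
    apply: measurable_funM; last exact: measurable_indic.
    apply: measurable_fun_powR; by apply: measurableT_comp.
  have Goo : (\int[mu]_x (G x)%:E < +oo)%E.
    rewrite -DE; apply: (@le_lt_trans _ _ (\int[mu]_(x in D n) (n%:R `^ s)%:E)%E).
      apply: ge0_le_integral => //.
      - by move=> x _; exact: poweR_ge0.
      - exact: measurable_funTS.
      - move=> x Dx; have [VE /andP[v0 vn]] := DV n x Dx.
        by rewrite VE gee0_abs// poweR_EFin lee_fin powR_le_base// ltW.
    rewrite integral_cst// lte_mul_pinfty ?lee_fin ?powR_ge0//.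
    apply: le_lt_trans (Efin n).2; apply: le_measure; rewrite ?inE//; last exact: subIsetl.
    exact: (Efin n).1.
  have Ge0 : (0 <= \int[mu]_x (G x)%:E)%E by apply: integral_ge0 => x _; rewrite lee_fin.
  rewrite DE -/G; have Gfin : (\int[mu]_x (G x)%:E)%E \is a fin_num by rewrite ge0_fin_numE.
  set c := fine (\int[mu]_x (G x)%:E)%E; have cE : (\int[mu]_x (G x)%:E)%E = c%:E by rewrite fineK.
  rewrite cE lee_fin; have c0 : 0 <= c by rewrite -lee_fin -cE.
  have [->|c1] := eqVneq c 0; first exact: powR_ge0.
  have {c1}cp : 0 < c by rewrite lt_neqAle eq_sym c1.
  have ci0 : 0 <= c^-1 by rewrite invr_ge0.
  pose H x := c^-1 * G x.
  have dH : density mu H.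
    split; [exact: measurable_funM|by move=> x; exact: mulr_ge0|].
    under eq_integral do rewrite EFinM.
    rewrite ge0_integralZl ?lee_fin//; last 2 first.
    - exact/measurable_EFinP.
    - by move=> x _; rewrite lee_fin.
    by rewrite cE -EFinM lee_fin mulVf// gt_eqF.
  have h : ((c `^ (- r))%:E * c%:E <= B%:E)%E.
    apply: le_trans (dualV dH); rewrite -cE -ge0_integralZl ?lee_fin ?powR_ge0//; last 2 first.
    - exact/measurable_EFinP.
    - by move=> x _; rewrite lee_fin.
    apply: ge0_le_integral => //.
    - by move=> x _; rewrite mule_ge0 ?lee_fin ?powR_ge0.
    - by apply: measurable_funeM; exact/measurable_EFinP.
    - apply: emeasurable_funM => //; apply/measurable_EFinP.
      apply: measurable_fun_powR; by have [] := dH.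
    move=> x _; have [Dx|Dx] := pselect (D n x); last first.
      by rewrite /G indicE memNset// mulr0 mule0 mule_ge0 ?lee_fin ?powR_ge0.
    have [VE /andP[v0 _]] := DV n x Dx; rewrite VE -!EFinM lee_fin /H /G indicE mem_set// mulr1.
    move: (fine (V x)) v0 => v v0.
    rewrite powRM ?powR_ge0// powR_inv// -powRN -powRrM mulrCA ler_wpM2l ?powR_ge0//.
    by rewrite -{2}(powRr1 v0) -ge0_powRD ?mulr_ge0 ?(ltW s0)// s1.
  have cB : c `^ (1 - r) <= B.
    move: h; rewrite -EFinM lee_fin; apply: le_trans; apply: eqW.
    rewrite addrC powRD; last by rewrite (gt_eqF cp) implybT.
    by rewrite powRr1.
  rewrite (_ : c = (c `^ (1 - r)) `^ s); first by apply: powR_le_base => //; [exact: ltW|exact: powR_ge0].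
  by rewrite -powRrM -sr mulVf ?gt_eqF// powRr1.
have mU : measurable (\bigcup_n D n) by exact: bigcup_measurable.
(* The sets D n cover every point where V is finite, hence almost every point. *)
rewrite (ge0_ae_eq_integral (g := (fun x => `|V x| `^ s)%E \_ (\bigcup_n D n))) //; first last.
- move: dual_ae_fin_num; apply: filterS => x Vx _; rewrite patchE ifT// inE.
  have [n _ En] : (\bigcup_n E n) x by rewrite ET.
  have := fine_ge0 (V0 x) => v0.
  exists (maxn n (Num.truncn (fine (V x))).+1) => //; split.
    by apply: ndE En; exact: leq_maxl.
  rewrite /= -(fineK Vx) lee_fin (le_trans (ltW (truncnS_gt _)))// ler_nat leq_maxr//.
- by move=> x _; rewrite patchE; case: ifP => // _; exact: poweR_ge0.
- by move=> x _; exact: poweR_ge0.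
- by apply/(measurable_restrictT _ mU); exact: measurable_funTS.
rewrite -integral_mkcond.
have h := ge0_nondecreasing_set_cvg_integral (mu := mu) ndD mD
  (fun n => measurable_funTS mVs) (fun n x _ => poweR_ge0 _ _).
rewrite -(cvg_lim (@ereal_hausdorff R) h); apply: lime_le.
  by apply/cvg_ex; eexists; exact: h.
exact: nearW.
Qed.

Lemma dual_Lnorm q : (1 <= q)%E -> q^-1%E = (1 - r)%:E -> (Lnorm mu q V <= B%:E)%E.
Proof.
case: q => [s|_|//].
  rewrite lee_fin => s1; have s0 : 0 < s by exact: lt_le_trans s1.
  rewrite inver gt_eqF// => -[sr]; rewrite unlock.
  have := dual_Lnorm_real s0 sr => h.
  have i0 : (0 <= \int[mu]_x (`|V x| `^ s))%E by apply: integral_ge0 => x _; exact: poweR_ge0.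
  apply: (@le_trans _ _ (((B `^ s)%:E) `^ s^-1)%E).
    apply: gt0_ler_poweR => //; first by rewrite invr_ge0 ltW.
      by rewrite in_itv/= i0 leey.
    by rewrite in_itv/= lee_fin powR_ge0 leey.
  by rewrite poweR_EFin -powRrM mulfV ?gt_eqF// powRr1.
(* For q infinite, r = 1 and the means of V over sets of positive finite measure are at most B, so V
   exceeds B + e only on a null set. On a space of measure zero the norm is 0 by convention. *)
rewrite invey => -[] r1; have {}r1 : r = 1 by lra.
rewrite unlock; case: ifPn => [mu0|_]; last by rewrite lee_fin.
apply/lee_addgt0Pr => e e0; rewrite -EFinD; apply/ess_supP.
have mS : measurable (V @^-1` [set u | ((B + e)%:E < u)%E]).
  rewrite -[X in measurable X]setTI; apply: mV => //.
  rewrite (_ : [set u | _] = `](B + e)%:E, +oo[%classic); first exact: emeasurable_itv.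
  by apply/seteqP; split => u; rewrite /= in_itv/= andbT.
have : mu.-negligible (V @^-1` [set u | ((B + e)%:E < u)%E]).
  apply: dual_negligible => // T mT TS T0 Too; have := dual_indicator mT T0 Too.
  have Tfin : mu T \is a fin_num by rewrite ge0_fin_numE.
  have t0 : 0 < fine (mu T) by rewrite -lte_fin fineK.
  apply/negP; rewrite -ltNge; apply: (@lt_le_trans _ _ (\int[mu]_(x in T) (B + e)%:E)%E).
    rewrite (_ : (\int[mu]_(_ in T) _)%E = ((B + e) * fine (mu T))%:E); last first.
      by rewrite integral_cst// EFinM fineK.
    by rewrite lte_fin r1 powRr1 ?(ltW t0)// ltr_pM2r// ltrDl.
  apply: ge0_le_integral => //.
  - by move=> x _; rewrite lee_fin addr_ge0// ltW.
  - exact: measurable_funTS.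
  - by move=> x /TS /= /ltW.
apply: negligibleS => x /= /negP; rewrite -ltNge gee0_abs//.
Qed.

End dual.

(** Represents a function of L^p as a multiple of the P-th power of a density, F = (f / N)^p for
    finite p. A number N strictly above the norm stays positive even when the norm is 0. *)
Lemma Lnorm_density p P f N : (1 <= p)%E -> p^-1%E = P%:E ->
  measurable_fun setT f -> (forall x, 0 <= f x) -> 0 < N ->
  (Lnorm mu p (EFin \o f) < N%:E)%E ->
  exists2 F, density mu F & {ae mu, forall x, f x <= N * F x `^ P}.
Proof.
move=> p1 pP mf f0 N0; have Ni0 : 0 <= N^-1 by rewrite invr_ge0 ltW.
case: p p1 pP => [s|_|//].
  rewrite lee_fin => s1; have s0 : 0 < s by exact: lt_le_trans s1.
  rewrite inver gt_eqF// => -[sP] fN.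
  have mfs : measurable_fun setT (fun x => f x `^ s).
    exact: measurable_fun_powR.
  have fs : (\int[mu]_x (f x `^ s)%:E <= (N `^ s)%:E)%E.
    rewrite (_ : (\int[mu]_x _)%E = ('N[mu]_s%:E[EFin \o f] `^ s)%E); last first.
      rewrite poweR_Lnorm ?gt_eqF//; apply: eq_integral => x _ /=.
      by rewrite ger0_norm.
    rewrite -poweR_EFin; apply: gt0_ler_poweR; first exact: ltW.
    - by rewrite in_itv/= Lnorm_ge0 leey.
    - by rewrite in_itv/= lee_fin ltW//= leey.
    - exact: ltW.
  exists (fun x => N^-1 `^ s * f x `^ s).
    split; first exact: measurable_funM.
      by move=> x; rewrite mulr_ge0 ?powR_ge0.
    under eq_integral do rewrite EFinM.
    rewrite ge0_integralZl ?lee_fin ?powR_ge0//; last 2 first.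
    - exact/measurable_EFinP.
    - by move=> x _; rewrite lee_fin powR_ge0.
    apply: (@le_trans _ _ ((N^-1 `^ s)%:E * (N `^ s)%:E)%E).
      by rewrite lee_wpmul2l ?lee_fin ?powR_ge0.
    by rewrite -EFinM lee_fin powR_inv ?(ltW N0)// mulVf// gt_eqF// powR_gt0.
  apply: aeW => x; rewrite -sP powRM ?powR_ge0// -!powRrM mulfV ?gt_eqF//.
  by rewrite !powRr1// mulrA mulfV ?mul1r// gt_eqF.
rewrite invey => -[<-] fN.
(* For p infinite P = 0, and 0^0 = 1 makes the zero density suffice: the claim reduces to f <= N
   almost everywhere. *)
exists (fun=> 0).
  by split => //; rewrite integral0 lee01.
rewrite powRr0 mulr1; have [mu0|] := boolP (0 < mu setT)%E; last first.
  rewrite -leNgt measure_le0 => /eqP mu0.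
  by exists setT; split.
move: fN; rewrite unlock mu0 => fN.
have := ess_sup_ge mu (abse \o (EFin \o f)); apply: filterS => x /= fx.
rewrite -lee_fin (le_trans _ (ltW fN))// (le_trans _ fx)//.
by rewrite lee_fin ler_norm.
Qed.

Section bounded_operator.
Variables (K : X * X -> \bar R) (P r C : R).
Hypotheses (mK : measurable_fun setT K) (K0 : forall z, (0 <= K z)%E).
Hypothesis KC : forall F H, density mu F -> density mu H ->
  (\int[mu \x mu]_z (K z * (F z.2 `^ P * H z.1 `^ r)%:E) <= C%:E)%E.

Definition kernel_integral f x : \bar R := (\int[mu]_y (K (x, y) * (f y)%:E))%E.

Let mKx x : measurable_fun setT (fun y => K (x, y)).
Proof.
apply: (measurableT_comp mK); apply: measurable_fun_pair; first exact: measurable_cst.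
exact: measurable_id.
Qed.

Lemma kernel_integral_ge0 f x : (forall y, 0 <= f y) -> (0 <= kernel_integral f x)%E.
Proof. by move=> f0; apply: integral_ge0 => y _; rewrite mule_ge0 ?lee_fin. Qed.

Lemma measurable_kernel_integral f : measurable_fun setT f -> (forall y, 0 <= f y) ->
  measurable_fun setT (kernel_integral f).
Proof.
move=> mf f0; apply: (measurable_fun_fubini_tonelli_F (m2 := mu) (fun z => K z * (f z.2)%:E)%E).
  apply: emeasurable_funM => //; apply/measurable_EFinP.
  exact: (measurableT_comp mf measurable_snd).
by move=> z; rewrite mule_ge0 ?lee_fin.
Qed.

Lemma kernel_integral_dual p f N : (1 <= p)%E -> p^-1%E = P%:E ->
  measurable_fun setT f -> (forall x, 0 <= f x) -> 0 < N ->
  (Lnorm mu p (EFin \o f) < N%:E)%E -> forall H, density mu H ->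
  (\int[mu]_x (kernel_integral f x * (H x `^ r)%:E) <= (N * C)%:E)%E.
Proof.
move=> p1 pP mf f0 N0 fN H dH.
have [F dF fF] := Lnorm_density p1 pP mf f0 N0 fN.
have [mF F0 _] := dF; have [mH H0 _] := dH.
have mFP : measurable_fun setT (fun x => F x `^ P).
  exact: measurable_fun_powR.
have mHr : measurable_fun setT (fun x => H x `^ r).
  exact: measurable_fun_powR.
have mKF : measurable_fun setT (fun z => (K z * (F z.2 `^ P * H z.1 `^ r)%:E)%E).
  apply: emeasurable_funM => //; apply/measurable_EFinP; apply: measurable_funM.
    exact: (measurableT_comp mFP measurable_snd).
  exact: (measurableT_comp mHr measurable_fst).
have KF0 z : (0 <= K z * (F z.2 `^ P * H z.1 `^ r)%:E)%E.
  by rewrite mule_ge0 ?lee_fin ?mulr_ge0 ?powR_ge0.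
apply: (@le_trans _ _ (N%:E * \int[mu \x mu]_z (K z * (F z.2 `^ P * H z.1 `^ r)%:E))%E); last first.
  by rewrite EFinM lee_wpmul2l ?lee_fin ?(ltW N0)//; exact: KC.
rewrite fubini_tonelli1// -ge0_integralZl ?lee_fin ?(ltW N0)//; last 2 first.
- exact: measurable_fun_fubini_tonelli_F.
- by move=> x _; exact: integral_ge0.
apply: ge0_le_integral => //.
- by move=> x _; rewrite mule_ge0 ?kernel_integral_ge0 ?lee_fin ?powR_ge0.
- apply: emeasurable_funM; [exact: measurable_kernel_integral|exact/measurable_EFinP].
- by apply: measurable_funeM; exact: measurable_fun_fubini_tonelli_F.
move=> x _; rewrite /fubini_F/=.
rewrite -ge0_integralZl ?lee_fin ?(ltW N0)//; last first.
- apply: emeasurable_funM => //; apply/measurable_EFinP.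
  by apply: measurable_funM => //; exact: measurable_cst.
rewrite /kernel_integral -ge0_integralZr ?lee_fin ?powR_ge0//; last 2 first.
- by apply: emeasurable_funM => //; exact/measurable_EFinP.
- by move=> y _; rewrite mule_ge0 ?lee_fin.
apply: ae_ge0_le_integral => //.
- by move=> y _; rewrite !mule_ge0 ?lee_fin ?powR_ge0.
- by apply: emeasurable_funM => //; apply: emeasurable_funM => //; exact/measurable_EFinP.
- by move=> y _; rewrite mule_ge0 ?lee_fin ?(ltW N0)//; exact: (KF0 (x, y)).
- apply: measurable_funeM; apply: emeasurable_funM => //; apply/measurable_EFinP.
  by apply: measurable_funM => //; exact: measurable_cst.
apply: filterS fF => y fy _; rewrite muleCA -muleA lee_wpmul2l// -!EFinM lee_fin mulrA.
by rewrite ler_wpM2r ?powR_ge0.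
Qed.

End bounded_operator.
End duality.

(** * Nonnegative kernels applied to signed functions *)

Section signed_kernel_integral.
Context d (X : measurableType d) {R : realType}.
Variable mu : {sigma_finite_measure set X -> \bar R}.
Variable K : X * X -> \bar R.
Hypotheses (mK : measurable_fun setT K) (K0 : forall z, (0 <= K z)%E).
Implicit Types f h phi : X -> R.

Let mKx x : measurable_fun setT (fun y => K (x, y)).
Proof.
apply: (measurableT_comp mK); apply: measurable_fun_pair; first exact: measurable_cst.
exact: measurable_id.
Qed.

Let mKh x h : measurable_fun setT h -> measurable_fun setT (fun y => K (x, y) * (h y)%:E)%E.
Proof. by move=> mh; apply: emeasurable_funM => //; exact/measurable_EFinP. Qed.

Lemma measurable_signed_kernel_integral h : measurable_fun setT h ->
  measurable_fun setT (kernel_integral mu K h).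
Proof.
move=> mh; rewrite /kernel_integral.
have mF : measurable_fun setT (fun z => K z * (h z.2)%:E)%E.
  apply: emeasurable_funM => //; apply/measurable_EFinP.
  exact: (measurableT_comp mh measurable_snd).
pose F z := (K z * (h z.2)%:E)%E.
have Fp0 z : (0 <= F^\+ z)%E by exact: funepos_ge0.
have Fn0 z : (0 <= F^\- z)%E by exact: funeneg_ge0.
have mFp := measurable_fun_fubini_tonelli_F (m2 := mu) _ (measurable_funepos mF) Fp0.
have mFn := measurable_fun_fubini_tonelli_F (m2 := mu) _ (measurable_funeneg mF) Fn0.
rewrite (_ : (fun x => _) = (fun x => \int[mu]_y F^\+ (x, y) - \int[mu]_y F^\- (x, y))%E).
  by apply: emeasurable_funB; [exact: mFp|exact: mFn].
by apply/funext => x; rewrite integralE; congr (_ - _)%E; apply: eq_integral => y _;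
  rewrite ?funeposE ?funenegE.
Qed.

Lemma abse_kernel f h x y : (forall y, `|h y| <= f y) ->
  (`|K (x, y) * (h y)%:E| <= K (x, y) * (f y)%:E)%E.
Proof. by move=> hf; rewrite abseM gee0_abs// lee_wpmul2l// lee_fin. Qed.

Lemma abse_kernel_integral f h x : measurable_fun setT f -> measurable_fun setT h ->
  (forall y, `|h y| <= f y) ->
  (`|kernel_integral mu K h x| <= kernel_integral mu K f x)%E.
Proof.
move=> mf mh hf; apply: (le_trans (le_abse_integral _ measurableT (mKh x mh))).
apply: ge0_le_integral => //.
- by apply: measurableT_comp => //; exact: mKh.
- exact: mKh.
- by move=> y _; exact: abse_kernel.
Qed.

Lemma integrable_kernel f h x : measurable_fun setT f -> measurable_fun setT h ->
  (forall y, `|h y| <= f y) -> (kernel_integral mu K f x < +oo)%E ->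
  mu.-integrable setT (fun y => K (x, y) * (h y)%:E)%E.
Proof.
move=> mf mh hf foo; apply/integrableP; split; first exact: mKh.
apply: le_lt_trans foo; apply: ge0_le_integral => //.
- by apply: measurableT_comp => //; exact: mKh.
- exact: mKh.
- by move=> y _; exact: abse_kernel.
Qed.

(** Fubini for K(x, y) h(y) phi(x): the integral of its absolute value is at most that of |phi|
    against the kernel integral of the majorant f, which is assumed finite. *)
Lemma kernel_integral_pairing f h phi (E : X -> R) :
  measurable_fun setT f -> measurable_fun setT h -> measurable_fun setT phi ->
  (forall y, `|h y| <= f y) ->
  (\int[mu]_x (kernel_integral mu K f x * `|phi x|%:E) < +oo)%E ->
  {ae mu, forall x, kernel_integral mu K f x \is a fin_num} ->
  (forall y, mu.-integrable setT (fun x => K (x, y) * (phi x)%:E)%E) ->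
  (forall y, \int[mu]_x (K (x, y) * (phi x)%:E) = (E y)%:E)%E ->
  has_integral mu setT (fun x => fine (kernel_integral mu K h x) * phi x)
    (fine (\int[mu]_y (h y * E y)%:E)%E).
Proof.
move=> mf mh mphi hf Uphi Uae Kphi KE.
have f0 y : 0 <= f y by exact: le_trans (hf y).
pose F (z : X * X) := (K z * (h z.2)%:E * (phi z.1)%:E)%E.
have mF : measurable_fun setT F.
  apply: emeasurable_funM; last by apply/measurable_EFinP; exact: (measurableT_comp mphi measurable_fst).
  apply: emeasurable_funM => //; apply/measurable_EFinP.
  exact: (measurableT_comp mh measurable_snd).
have mU : measurable_fun setT (kernel_integral mu K f) by exact: measurable_signed_kernel_integral.
have mKI : measurable_fun setT (kernel_integral mu K h) by exact: measurable_signed_kernel_integral.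
have U0 x : (0 <= kernel_integral mu K f x)%E by exact: kernel_integral_ge0.
have iF : (mu \x mu)%E.-integrable setT F.
  apply/integrable12ltyP => //; apply: le_lt_trans Uphi; apply: ge0_le_integral => //.
  - by move=> x _; exact: integral_ge0.
  - by apply: (measurable_fun_fubini_tonelli_F (m2 := mu) (fun z => `|F z|)%E) => //;
      exact: measurableT_comp.
  - by apply: emeasurable_funM => //; apply/measurable_EFinP; exact: measurableT_comp.
  - move=> x _; rewrite /kernel_integral -ge0_integralZr ?lee_fin//; last 2 first.
    + exact: mKh.
    + by move=> y _; rewrite mule_ge0 ?lee_fin.
    apply: ge0_le_integral => //.
    + apply: measurableT_comp => //; apply: emeasurable_funM; first exact: mKh.
      by rewrite /=; exact: measurable_cst.
    + by apply: emeasurable_funM; [exact: mKh|exact: measurable_cst].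
    + by move=> y _; rewrite /F/= abseM lee_wpmul2r ?lee_fin//; exact: abse_kernel.
have iF1 := integrable_fubini_F iF.
(* [fine] sends infinite values to 0, so the identification with the inner integral is made only
   where the kernel integral of f is finite, that is, almost everywhere. *)
have E1 : ae_eq mu setT (fubini_F mu F) (fun x => (fine (kernel_integral mu K h x) * phi x)%:E).
  move: Uae; apply: filterS => x Ux _; rewrite /fubini_F /F/=.
  have Uoo : (kernel_integral mu K f x < +oo)%E by rewrite -ge0_fin_numE.
  rewrite integralZr//; last exact: (integrable_kernel mf mh hf Uoo).
  rewrite EFinM fineK// fin_num_abs.
  exact: le_lt_trans (abse_kernel_integral x mf mh hf) Uoo.
have mfin : measurable_fun setT (fun x => (fine (kernel_integral mu K h x) * phi x)%:E).
  by apply/measurable_EFinP; apply: measurable_funM => //; apply: measurableT_comp.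
have EG : (\int[mu]_y fubini_G mu F y = \int[mu]_y (h y * E y)%:E)%E.
  apply: eq_integral => y _; rewrite /fubini_G /F/= EFinM -KE -integralZl//.
  by apply: eq_integral => x _; rewrite muleAC muleC.
have FG : (\int[mu]_x (fine (kernel_integral mu K h x) * phi x)%:E = \int[mu]_y (h y * E y)%:E)%E.
  rewrite -EG integral21_prod_meas1// -integral12_prod_meas1//.
  apply: ae_eq_integral => //; first exact: measurable_int iF1.
  by move: E1; apply: filterS => x + _ => /(_ Logic.I).
have iI : mu.-integrable setT (fun x => (fine (kernel_integral mu K h x) * phi x)%:E).
  apply/integrableP; split => //.
  have /integrableP[_] := iF1; apply: le_lt_trans; apply: eqW.
  apply: ae_eq_integral => //.
  - exact: measurableT_comp.
  - by apply: measurableT_comp => //; exact: measurable_int iF1.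
  - by move: E1; apply: filterS => x + _ => /(_ Logic.I) ->.
split => //; rewrite -FG fineK//; exact: integrable_fin_num.
Qed.

End signed_kernel_integral.

(** * The potential operator *)

Section exponents.
Context {R : realType}.
Implicit Types p q : \bar R.

Lemma inve_exponent p : (1 <= p)%E -> exists2 P : R, p^-1%E = P%:E & 0 <= P <= 1.
Proof.
case: p => [s|_|//]; last by exists 0; rewrite ?invey// lexx ler01.
rewrite lee_fin => s1; have s0 : 0 < s by exact: lt_le_trans s1.
exists s^-1; first by rewrite inver gt_eqF.
by rewrite invr_ge0 (ltW s0) invf_le1.
Qed.

Lemma inve_eqy p : (1 <= p)%E -> p^-1%E = 0%:E -> p = +oo%E.
Proof.
case: p => [s| |//] //; rewrite lee_fin => s1; have s0 : 0 < s by exact: lt_le_trans s1.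
by rewrite inver gt_eqF// => -[/eqP]; rewrite invr_eq0 gt_eqF.
Qed.

Lemma inve_eqr p (c : R) : (1 <= p)%E -> c != 0 -> p^-1%E = c%:E -> p = (c^-1)%:E.
Proof.
case: p => [s|_ c0|//]; last by rewrite invey => -[c0']; rewrite -c0' eqxx in c0.
rewrite lee_fin => s1 c0; have s0 : 0 < s by exact: lt_le_trans s1.
by rewrite inver gt_eqF// => -[<-]; rewrite invrK.
Qed.

End exponents.

(** Integrability is not assumed: as f has a sign, a scalar of either sign can be taken out of a
    possibly infinite integral. *)
Lemma ge0_integralZr_sign d (T : measurableType d) (R : realType)
    (mu : {measure set T -> \bar R}) (D : set T) (f : T -> \bar R) (c : R) :
  measurable D -> measurable_fun D f -> (forall x, D x -> (0 <= f x)%E) ->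
  (\int[mu]_(x in D) (f x * c%:E) = \int[mu]_(x in D) f x * c%:E)%E.
Proof.
move=> mD mf f0; have [c0|c0] := leP 0 c; first by rewrite ge0_integralZr.
have c0' : 0 <= - c by rewrite oppr_ge0 ltW.
have cE : c%:E = (- (- c)%:E)%E by rewrite -EFinN opprK.
under eq_integral do rewrite cE muleN.
rewrite integral_ge0N; first by rewrite ge0_integralZr// [in RHS]cE muleN.
by move=> x Dx; rewrite mule_ge0 ?lee_fin ?f0.
Qed.

(** * The potential kernel: admissible exponents and action on the Laguerre functions *)

Section heat_potential.
Context {R : realType} (d : nat) (alpha : 'I_d -> R) (sigma : R).
Hypotheses (d_gt0 : (1 <= d)%N) (halpha : forall i, - (1 / 2) <= alpha i).
Hypothesis hsigma : 0 < sigma.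
Notation RT := (measurableTypeR R).
Notation X := (d.-tuple RT).
Notation leb := (lebesgueN R d).
Notation lam := (@lebesgue_measure R).
Notation half := (`]0%R, +oo[%classic : set RT).
Notation G := (@orthant_kernel R d alpha).
Implicit Types (t : R) (x y : X) (F H f h : X -> R).

Let mG := measurable_orthant_kernel halpha.
Let G0 := orthant_kernel_ge0 halpha.
Let Gle0 := @orthant_kernel_le0 R d alpha.
Let Gsym := orthant_kernel_sym halpha.

Definition full_kernel (z : X * X) : \bar R :=
  ((Gamma sigma)^-1%:E * time_kernel G sigma z)%E.

Let Gi0 : 0 <= (Gamma sigma)^-1. Proof. by rewrite invr_ge0 ltW// Gamma_gt0. Qed.

Lemma full_kernel_ge0 z : (0 <= full_kernel z)%E.
Proof. by rewrite mule_ge0 ?lee_fin//; exact: time_kernel_ge0. Qed.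

Lemma measurable_full_kernel : measurable_fun setT full_kernel.
Proof. by apply: measurable_funeM; exact: measurable_time_kernel. Qed.

Lemma full_kernel_sym x y : full_kernel (x, y) = full_kernel (y, x).
Proof. by rewrite /full_kernel (time_kernel_sym _ Gsym). Qed.

Lemma full_kernel0 x y : ~ (orthant x /\ orthant y) -> full_kernel (x, y) = 0%E.
Proof.
move=> xy; rewrite /full_kernel /time_kernel integral0_eq ?mule0// => t _.
by rewrite orthant_kernel0// mulr0.
Qed.

Lemma potential_kernelE x y : orthant x -> orthant y ->
  potential_kernel alpha sigma x y = full_kernel (x, y).
Proof.
move=> xo yo; rewrite /potential_kernel /full_kernel; congr (_ * _)%E.
rewrite [LHS]integral_mkcond; apply: eq_integral => t _; rewrite patchE.
case: ifPn => [/[!inE]/=|]; first by rewrite in_itv/= andbT => t0; rewrite orthant_kernelE// mulrC.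
by rewrite notin_setE/= in_itv/= andbT => /negP; rewrite -leNgt => t0; rewrite Gle0// mulr0.
Qed.

(** Here P + r - 1 = 1/p - 1/q, of absolute value at most 1. In the first case this already gives
    the subcritical condition. In the second, absolute value 1 is reached only at the two excluded
    pairs. In the third, with th = 2 sigma/d, the condition fails only for 1/p - 1/q = th; excluding
    1/q = 0 and 1/p = 1 on that line yields the strict inequalities th < P and th < r of the
    critical bound. *)
Lemma full_kernel_bound (p q : \bar R) : (1 <= p)%E -> (1 <= q)%E ->
  [\/ d%:R / 2 < sigma,
      [/\ sigma = d%:R / 2, (p, q) <> (+oo, 1)%E & (p, q) <> (1, +oo)%E] |
      [/\ sigma < d%:R / 2,
          (p^-1 - (2 * sigma / d%:R)%:E <= q^-1)%E,
          (q^-1 < p^-1 + (2 * sigma / d%:R)%:E)%E,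
          (p, q) <> (1%E, (d%:R / (d%:R - 2 * sigma))%:E) &
          (p, q) <> ((d%:R / (2 * sigma))%:E, +oo%E)]] ->
  exists P r C : R, [/\ p^-1%E = P%:E /\ 0 <= P <= 1, q^-1%E = (1 - r)%:E /\ 0 <= r <= 1,
    0 <= C & forall F H, density leb F -> density leb H ->
    (\int[leb \x leb]_z (full_kernel z * (F z.2 `^ P * H z.1 `^ r)%:E) <= C%:E)%E].
Proof.
move=> p1 q1 hpq; have [P pP P01] := inve_exponent p1; have [Q qQ Q01] := inve_exponent q1.
have [A A0 HA] := orthant_kernel_estimates halpha d_gt0.
have Gsup t x y : 0 < t -> G (t, (x, y)) <= A * decay (d%:R / 2) t by move=> /HA[].
have Gmass t x : 0 < t -> (\int[leb]_y (G (t, (x, y)))%:E <= (A * expR (- (t / 2)))%:E)%E.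
  by move=> /HA[].
have Gtot t : 0 < t -> (\int[leb]_x \int[leb]_y (G (t, (x, y)))%:E <= (A * decay (d%:R / 2) t)%:E)%E.
  by move=> /HA[].
pose r := 1 - Q; have r01 : 0 <= r <= 1 by move: Q01; rewrite /r; lra.
have d0 : 0 < d%:R :> R by rewrite ltr0n.
have b0 : 0 < d%:R / 2 :> R by rewrite divr_gt0.
suff [C C0 HC] : exists2 C : R, 0 <= C & forall F H,
    density leb F -> density leb H ->
    (\int[leb \x leb]_z (time_kernel G sigma z * (F z.2 `^ P * H z.1 `^ r)%:E) <= C%:E)%E.
  exists P, r, ((Gamma sigma)^-1 * C); split => //.
  - by split => //; rewrite qQ /r opprB addrC subrK.
  - exact: mulr_ge0.
  move=> F H dF dH; have [mF F0 _] := dF; have [mH H0 _] := dH.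
  under eq_integral do rewrite /full_kernel -muleA.
  rewrite ge0_integralZl ?lee_fin//.
  - by rewrite EFinM lee_wpmul2l ?lee_fin//; exact: HC.
  - apply: emeasurable_funM; first exact: measurable_time_kernel.
    apply/measurable_EFinP; apply: measurable_funM.
      apply: measurable_fun_powR; exact: (measurableT_comp mF measurable_snd).
    apply: measurable_fun_powR; exact: (measurableT_comp mH measurable_fst).
  - by move=> z _; rewrite mule_ge0 ?time_kernel_ge0// lee_fin mulr_ge0 ?powR_ge0.
have sub := subcritical_bound (sigma := sigma) A0 mG G0 Gle0 Gsym Gsup Gmass Gtot P01 r01.
have Pr1 : `|P + r - 1| <= 1 by rewrite ler_norml; move: P01 r01; lra.
case: hpq => [bs|[sb p1q p2q]|[sb h1 h2 e1 e2]].
- apply: sub; apply: le_lt_trans bs; rewrite ler_piMr// ltW//.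
- apply: sub; rewrite sb -[ltRHS]mulr1 ltr_pM2l// lt_neqAle Pr1 andbT.
  apply/eqP => n1; have : P + r - 1 = 1 \/ P + r - 1 = -1.
    by move: n1; have [h|h] := leP 0 (P + r - 1); [rewrite ger0_norm//; left|rewrite ltr0_norm//; right; lra].
  move=> [h|h]; [apply: p2q|apply: p1q].
    have P1 : P = 1 by move: P01 r01; lra.
    have Q0 : Q = 0 by move: P01 r01 h; rewrite /r; lra.
    rewrite Q0 in qQ; rewrite P1 in pP; rewrite (inve_eqy q1 qQ).
    by rewrite (inve_eqr p1 (oner_neq0 _) pP) invr1.
  have P0 : P = 0 by move: P01 r01; lra.
  have Q1 : Q = 1 by move: P01 r01 h; rewrite /r; lra.
  rewrite Q1 in qQ; rewrite P0 in pP; rewrite (inve_eqy p1 pP).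
  by rewrite (inve_eqr q1 (oner_neq0 _) qQ) invr1.
pose th := 2 * sigma / d%:R.
have th0 : 0 < th by rewrite divr_gt0// mulr_gt0.
have sE : sigma = d%:R / 2 * th by rewrite /th; field; rewrite gt_eqF.
have th1 : th < 1 by rewrite /th ltr_pdivrMr// mul1r; move: sb; lra.
rewrite -/th pP qQ -EFinB lee_fin in h1; rewrite -/th pP qQ -EFinD lte_fin in h2.
have [crit|ncrit] := eqVneq (P + r) (1 + th); last first.
  apply: sub; rewrite [X in _ < X]sE ltr_pM2l// ltr_norml; move: ncrit h1 h2; rewrite /r.
  move=> /eqP ncrit h1 h2; have : P - Q != th by apply/eqP => h; apply: ncrit; lra.
  rewrite neq_lt => /orP[]; lra.
have thP : th < P.
  rewrite lt_neqAle; apply/andP; split; last by move: r01; lra.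
  apply/eqP => thP; apply: e2; have Q0 : Q = 0 by move: crit; rewrite /r; lra.
  rewrite Q0 in qQ; rewrite (inve_eqy q1 qQ); congr (_, _).
  rewrite (inve_eqr p1 _ pP) -?thP ?gt_eqF//; congr EFin.
  by rewrite /th invf_div.
have thr : th < r.
  rewrite lt_neqAle; apply/andP; split; last by move: P01; lra.
  apply/eqP => thr; apply: e1; have P1 : P = 1 by lra.
  have Q1 : Q = 1 - th by move: thr; rewrite /r; lra.
  rewrite P1 in pP; rewrite (inve_eqr p1 (oner_neq0 _) pP) invr1; congr (_, _).
  have th1' : 1 - th != 0 by rewrite subr_eq0 gt_eqF.
  rewrite Q1 in qQ; rewrite (inve_eqr q1 th1' qQ); congr EFin.
  have dd : 0 < d%:R - 2 * sigma by lra.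
  by rewrite /th; field; rewrite (gt_eqF d0) (gt_eqF dd).
apply: (critical_bound (sigma := sigma) A0 b0 hsigma mG G0 Gle0 Gsym Gsup Gmass sE crit thP _ thr).
  by case/andP: P01.
by case/andP: r01.
Qed.

Lemma laguerre_eigenvalue_gt0 k : 0 < laguerre_eigenvalue alpha k.
Proof.
rewrite laguerre_eigenvalueE; apply: (@lt_le_trans _ _ (\sum_(i < d) 1)).
  by rewrite sumr_const card_ord ltr0n.
apply: ler_sum => i _; have := halpha i; have : 0 <= (k i)%:R :> R by []; lra.
Qed.

Definition orthant_phi k : X -> R := phi alpha k \_ (@orthant R d).

Lemma measurable_orthant_phi k : measurable_fun setT (orthant_phi k).
Proof.
apply/(measurable_restrictT _ (@measurable_orthant R d)).
by apply: measurable_funTS; exact: measurable_phi.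
Qed.

Lemma orthant_phi_estimates k : exists2 M : R, 0 < M &
  (forall x, `|orthant_phi k x| <= M) /\ (\int[leb]_x `|orthant_phi k x|%:E <= M%:E)%E.
Proof.
have [M M0 [bM iM]] := phi_estimates halpha k; exists M => //; split.
  move=> x; rewrite /orthant_phi patchE; case: ifPn => [/[!inE]|_]; first exact: bM.
  by rewrite normr0 ltW.
rewrite integral_mkcond in iM; apply: le_trans iM; apply: eqW.
apply: eq_integral => x _; rewrite /orthant_phi !patchE; case: ifP => // _.
by rewrite normr0.
Qed.

(** The time integral of t^(sigma - 1) e^(-t lambda_k) is Gamma(sigma) lambda_k^(-sigma). The
    exchange of integrals is justified because phi_k is bounded and the kernel at time t has mass at
    most A e^(-t/2), which is integrable against t^(sigma - 1). *)
Lemma integral_full_kernel_phi k y :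
  leb.-integrable setT (fun x => full_kernel (y, x) * (orthant_phi k x)%:E)%E /\
  (\int[leb]_x (full_kernel (y, x) * (orthant_phi k x)%:E) =
    (laguerre_eigenvalue alpha k `^ (- sigma) * orthant_phi k y)%:E)%E.
Proof.
set l := laguerre_eigenvalue alpha k; have l0 : 0 < l by exact: laguerre_eigenvalue_gt0.
have mphi := measurable_orthant_phi k.
have [yo|yo] := pselect (orthant y); last first.
  have z x : (full_kernel (y, x) * (orthant_phi k x)%:E = 0)%E.
    by rewrite full_kernel0 ?mul0e// => -[].
  have -> : orthant_phi k y = 0 by rewrite /orthant_phi patchE memNset.
  rewrite mulr0; split; last by rewrite integral0_eq.
  by apply: (@eq_integrable _ _ _ leb _ measurableT (cst 0%E)); [move=> x _; rewrite z|exact: integrable0].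
have [A A0 HA] := orthant_kernel_estimates halpha d_gt0.
have [M M0 [bM _]] := orthant_phi_estimates k.
pose gi := (Gamma sigma)^-1; have gi0 : 0 <= gi by [].
pose w t := gi * t `^ (sigma - 1); have w0 t : 0 <= w t by rewrite mulr_ge0 ?powR_ge0.
have mw : measurable_fun setT (w : RT -> R).
  by apply: measurable_funM => //; exact: measurable_powR.
have mGy : measurable_fun setT (fun z : X * RT => G (z.2, (y, z.1))).
  apply: (measurableT_comp mG); apply: measurable_fun_pair; first exact: measurable_snd.
  by apply: measurable_fun_pair; [exact: measurable_cst|exact: measurable_fst].
have mGt t : measurable_fun setT (fun x => G (t, (y, x))).
  apply: (measurableT_comp mG); apply: measurable_fun_pair; first exact: measurable_cst.
  by apply: measurable_fun_pair; [exact: measurable_cst|exact: measurable_id].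
have mGx x : measurable_fun setT (fun t : RT => G (t, (y, x))).
  apply: (measurableT_comp mG); apply: measurable_fun_pair; first exact: measurable_id.
  exact: measurable_cst.
pose F (z : X * RT) := (w z.2 * G (z.2, (y, z.1)) * orthant_phi k z.1)%:E.
have mF : measurable_fun setT F.
  apply/measurable_EFinP; apply: measurable_funM; last exact: (measurableT_comp mphi measurable_fst).
  by apply: measurable_funM => //; exact: (measurableT_comp mw measurable_snd).
have h2 : 0 < 1 / 2 :> R by [].
have iF : (leb \x lam)%E.-integrable setT F.
  apply/integrable21ltyP => //.
  apply: (@le_lt_trans _ _ (\int[lam]_(t in half)
      (gi * (M * A) * (t `^ (sigma - 1) * expR (- (t * (1 / 2)))))%:E)%E); last first.
    rewrite (integral_gamma_scaleZ _ hsigma h2) ?ltry//.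
    by rewrite !mulr_ge0// ltW.
  rewrite [leRHS]integral_mkcond; apply: ge0_le_integral => //.
  - by move=> t _; exact: integral_ge0.
  - by apply: (measurable_fun_fubini_tonelli_G (m1 := leb) (fun z => `|F z|)%E) => //;
      exact: measurableT_comp.
  - apply/(measurable_restrictT _ (measurable_itv _)); apply/measurable_EFinP.
    by apply: measurable_funM => //; apply/measurable_EFinP; exact: measurable_gamma_scale.
  move=> t _; rewrite patchE; case: ifPn => [/[!inE]/=|]; last first.
    rewrite notin_setE/= in_itv/= andbT => /negP; rewrite -leNgt => t0.
    by rewrite integral0_eq// => x _; rewrite /F/= Gle0// mulr0 mul0r normr0.
  rewrite in_itv/= andbT => t0; have [_ mass _] := HA t t0.
  apply: (@le_trans _ _ (\int[leb]_x ((w t * M)%:E * (G (t, (y, x)))%:E))%E).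
    apply: ge0_le_integral => //.
    - apply/measurable_EFinP; apply: measurableT_comp => //; apply: measurable_funM => //.
      exact: measurable_funM.
    - by apply: measurable_funeM; exact/measurable_EFinP.
    - move=> x _; rewrite /F/= -EFinM lee_fin normrM (ger0_norm (mulr_ge0 (w0 t) (G0 _))).
      by rewrite mulrAC ler_wpM2r// ler_wpM2l.
  have wM : 0 <= w t * M by rewrite mulr_ge0// ltW.
  rewrite ge0_integralZl ?lee_fin//; last 2 first.
  - exact/measurable_EFinP.
  - by move=> x _; rewrite lee_fin.
  apply: (@le_trans _ _ ((w t * M)%:E * (A * expR (- (t / 2)))%:E)%E).
    by rewrite lee_wpmul2l ?lee_fin.
  rewrite -EFinM lee_fin /w mul1r; apply: eqW.
  by ring.
have FE x : fubini_F lam F x = (full_kernel (y, x) * (orthant_phi k x)%:E)%E.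
  rewrite /fubini_F /F/= /full_kernel /time_kernel.
  under eq_integral do rewrite EFinM.
  rewrite ge0_integralZr_sign//; last 2 first.
  - by apply/measurable_EFinP; exact: measurable_funM.
  - by move=> t _; rewrite lee_fin mulr_ge0.
  congr (_ * _)%E; under eq_integral do rewrite /w -mulrA EFinM.
  rewrite ge0_integralZl ?lee_fin//.
  - by apply/measurable_EFinP; apply: measurable_funM => //; exact: measurable_powR.
  - by move=> t _; rewrite lee_fin mulr_ge0 ?powR_ge0.
split.
  apply: (@eq_integrable _ _ _ leb _ measurableT (fubini_F lam F)); first by move=> x _; exact: FE.
  exact: integrable_fubini_F.
under eq_integral do rewrite -FE.
rewrite integral12_prod_meas1// -integral21_prod_meas1//.
transitivity (\int[lam]_(t in half) ((t `^ (sigma - 1) * expR (- (t * l)))%:E *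
    (gi * orthant_phi k y)%:E))%E.
  rewrite [RHS]integral_mkcond; apply: eq_integral => t _; rewrite /fubini_G patchE.
  case: ifPn => [/[!inE]/=|]; last first.
    rewrite notin_setE/= in_itv/= andbT => /negP; rewrite -leNgt => t0.
    by rewrite integral0_eq// => x _; rewrite /F/= Gle0// mulr0 mul0r.
  rewrite in_itv/= andbT => t0; have [i1 i2] := has_integral_heat_kernel_phi halpha y k t0.
  transitivity (\int[leb]_(x in @orthant R d) ((w t)%:E * (heat_kernel alpha t x y * phi alpha k x)%:E))%E.
    rewrite [RHS]integral_mkcond; apply: eq_integral => x _; rewrite /F/= /orthant_phi !patchE.
    case: ifPn => [/[!inE] xo|_]; last by rewrite mulr0.
    by rewrite Gsym orthant_kernelE// -EFinM mulrA.
  rewrite integralZl//; last exact: measurable_orthant.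
  rewrite i2 -!EFinM /w /orthant_phi patchE mem_set//; congr EFin; rewrite -/l.
  by ring.
rewrite ge0_integralZr_sign//; last 2 first.
- exact: measurable_gamma_scale.
- by move=> t _; rewrite lee_fin mulr_ge0 ?powR_ge0 ?expR_ge0.
rewrite integral_gamma_scale// -EFinM; congr EFin; rewrite /gi.
have : Gamma sigma != 0 by rewrite gt_eqF// Gamma_gt0.
by move: (Gamma sigma) => gs gs0; field.
Qed.

End heat_potential.

(** * Real part, imaginary part and modulus *)

Section complex_modulus.
Context {R : realType}.
Implicit Types z : R[i].

Lemma normc_ge0 z : 0 <= Normc.normc z.
Proof. by case: z => a b; exact: sqrtr_ge0. Qed.

Lemma normc_geRe z : `|complex.Re z| <= Normc.normc z.
Proof. by case: z => a b /=; rewrite -sqrtr_sqr ler_wsqrtr// lerDl sqr_ge0. Qed.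

Lemma normc_geIm z : `|complex.Im z| <= Normc.normc z.
Proof. by case: z => a b /=; rewrite -sqrtr_sqr ler_wsqrtr// lerDr sqr_ge0. Qed.

Lemma normc_leD z : Normc.normc z <= `|complex.Re z| + `|complex.Im z|.
Proof.
case: z => a b /=; have ab0 : 0 <= `|a| + `|b| by rewrite addr_ge0.
rewrite -[leRHS]ger0_norm// -sqrtr_sqr ler_wsqrtr// sqrrD !real_normK ?num_real//.
by rewrite lerD2r lerDl mulrn_wge0// mulr_ge0.
Qed.

Lemma measurable_normc d (T : measurableType d) (D : set T) (f : T -> R[i]) :
  measurable_fun D (fun x => complex.Re (f x)) ->
  measurable_fun D (fun x => complex.Im (f x)) ->
  measurable_fun D (fun x => Normc.normc (f x)).
Proof.
move=> mr mi; rewrite (_ : (fun x => _) =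
  (fun x => Num.sqrt (complex.Re (f x) ^+ 2 + complex.Im (f x) ^+ 2))); last first.
  by apply/funext => x; case: (f x).
apply: (@measurableT_comp _ _ _ _ _ _ (@Num.sqrt R)).
  by apply: continuous_measurable_fun; exact: sqrt_continuous.
by apply: measurable_funD; exact: measurable_funX.
Qed.

Lemma Re_mul_real z (c : R) : complex.Re (z * Num.conj (c%:C)%C) = complex.Re z * c.
Proof.
have -> : Num.conj (c%:C)%C = (c%:C)%C by exact: conjc_real.
by case: z => a b /=; ring.
Qed.

Lemma Im_mul_real z (c : R) : complex.Im (z * Num.conj (c%:C)%C) = complex.Im z * c.
Proof.
have -> : Num.conj (c%:C)%C = (c%:C)%C by exact: conjc_real.
by case: z => a b /=; ring.
Qed.

End complex_modulus.

(** * Norm bounds and pairings for the potential operator *)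

Section potential_bounds.
Context {R : realType} (d : nat) (alpha : 'I_d -> R) (sigma : R).
Hypotheses (d_gt0 : (1 <= d)%N) (halpha : forall i, - (1 / 2) <= alpha i).
Hypothesis hsigma : 0 < sigma.
Notation RT := (measurableTypeR R).
Notation X := (d.-tuple RT).
Notation leb := (lebesgueN R d).
Notation ort := (@orthant R d).
Notation K := (full_kernel alpha sigma).
Notation kint := (kernel_integral leb K).
Variables (p q : \bar R) (P r C : R).
Hypotheses (p1 : (1 <= p)%E) (q1 : (1 <= q)%E).
Hypotheses (pP : p^-1%E = P%:E) (P01 : 0 <= P <= 1).
Hypotheses (qr : q^-1%E = (1 - r)%:E) (r01 : 0 <= r <= 1) (C0 : 0 <= C).
Hypothesis KC : forall F H, density leb F -> density leb H ->
  (\int[leb \x leb]_z (K z * (F z.2 `^ P * H z.1 `^ r)%:E) <= C%:E)%E.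
Implicit Types (t N : R) (x y : X) (F H h : X -> R) (f : X -> R[i]).

Let mK := measurable_full_kernel sigma halpha.
Let K0 := full_kernel_ge0 halpha hsigma.

Definition re_part f : X -> R := (fun x => complex.Re (f x)) \_ ort.
Definition im_part f : X -> R := (fun x => complex.Im (f x)) \_ ort.
Definition modulus f : X -> R := (fun x => Normc.normc (f x)) \_ ort.

Lemma re_part_le f x : `|re_part f x| <= modulus f x.
Proof.
rewrite /re_part /modulus !patchE; case: ifP => _; [exact: normc_geRe|by rewrite normr0].
Qed.

Lemma im_part_le f x : `|im_part f x| <= modulus f x.
Proof.
rewrite /im_part /modulus !patchE; case: ifP => _; [exact: normc_geIm|by rewrite normr0].
Qed.

Lemma modulus_ge0 f x : 0 <= modulus f x.
Proof. by rewrite /modulus patchE; case: ifP => // _; exact: normc_ge0. Qed.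

Lemma norm_LpE (s : \bar R) f : norm_Lp s f = Lnorm leb s (EFin \o modulus f).
Proof.
rewrite /norm_Lp; apply: eq_Lnorm => x /=; rewrite /modulus !patchE.
by case: ifP.
Qed.

Lemma measurable_re_part (s : \bar R) f : in_Lp s f -> measurable_fun setT (re_part f).
Proof. by move=> [mr _ _]; apply/(measurable_restrictT _ (@measurable_orthant R d)). Qed.

Lemma measurable_im_part (s : \bar R) f : in_Lp s f -> measurable_fun setT (im_part f).
Proof. by move=> [_ mi _]; apply/(measurable_restrictT _ (@measurable_orthant R d)). Qed.

Lemma measurable_modulus (s : \bar R) f : in_Lp s f -> measurable_fun setT (modulus f).
Proof.
move=> [mr mi _]; apply/(measurable_restrictT _ (@measurable_orthant R d)).
exact: measurable_normc.
Qed.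

Lemma kernel_restrict (u : X -> R) x : orthant x ->
  (fun y => K (x, y) * ((u \_ ort) y)%:E)%E =
  (fun y => potential_kernel alpha sigma x y * (u y)%:E)%E \_ ort.
Proof.
move=> xo; apply/funext => y; rewrite !patchE; case: ifPn => [/[!inE] yo|_].
  by rewrite potential_kernelE.
by rewrite mule0.
Qed.

Lemma potentialE f x : orthant x -> potential alpha sigma f x =
  (fine (kint (re_part f) x) +i* fine (kint (im_part f) x))%C.
Proof.
by move=> xo; rewrite /potential /kernel_integral /re_part /im_part !kernel_restrict//
  -!integral_mkcond.
Qed.

Lemma potential_integrable f x (u : X -> R) : orthant x ->
  leb.-integrable setT (fun y => K (x, y) * ((u \_ ort) y)%:E)%E ->
  leb.-integrable ort (fun y => potential_kernel alpha sigma x y * (u y)%:E)%E.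
Proof.
move=> xo; rewrite kernel_restrict// => h.
exact: (integrable_mkcond _ (@measurable_orthant R d)).2 h.
Qed.

Section fixed_function.
Variables (f : X -> R[i]) (fp : in_Lp p f).

Let m0 := modulus_ge0 f.
Let mm := measurable_modulus fp.

Lemma modulus_dual N : 0 < N -> (norm_Lp p f < N%:E)%E -> forall H, density leb H ->
  (\int[leb]_x (kint (modulus f) x * (H x `^ r)%:E) <= (N * C)%:E)%E.
Proof.
move=> N0; rewrite norm_LpE => fN.
exact: (kernel_integral_dual mK K0 KC p1 pP mm m0 N0 fN).
Qed.

Lemma norm_Lp_lt : exists2 N, 0 < N & (norm_Lp p f < N%:E)%E.
Proof.
have [_ _ foo] := fp; have f0 : (0 <= norm_Lp p f)%E by exact: Lnorm_ge0.
have ff : norm_Lp p f \is a fin_num by rewrite ge0_fin_numE.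
exists (fine (norm_Lp p f) + 1); first by rewrite ltr_wpDl// fine_ge0.
by rewrite -{1}(fineK ff) lte_fin ltrDl.
Qed.

Let mU : measurable_fun setT (kint (modulus f)).
Proof. exact: measurable_signed_kernel_integral. Qed.

Let U0 x : (0 <= kint (modulus f) x)%E. Proof. exact: kernel_integral_ge0. Qed.

Lemma modulus_ae_fin : {ae leb, forall x, kint (modulus f) x \is a fin_num}.
Proof.
have [N N0 fN] := norm_Lp_lt.
exact: (dual_ae_fin_num mU U0 (modulus_dual N0 fN)).
Qed.

Lemma potential_dom_Lp : potential_dom alpha sigma f.
Proof.
have := modulus_ae_fin; apply: filterS => x Ux xo.
have Uoo : (kint (modulus f) x < +oo)%E by rewrite -ge0_fin_numE.
split; apply: potential_integrable => //.
  exact: (integrable_kernel mK K0 mm (measurable_re_part fp) (re_part_le f) Uoo).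
exact: (integrable_kernel mK K0 mm (measurable_im_part fp) (im_part_le f) Uoo).
Qed.

Lemma measurable_potential :
  measurable_fun ort (fun x => complex.Re (potential alpha sigma f x)) /\
  measurable_fun ort (fun x => complex.Im (potential alpha sigma f x)).
Proof.
have mfine h : measurable_fun setT h -> measurable_fun ort (fun x => fine (kint h x)).
  move=> mh; apply: measurable_funTS; apply: measurableT_comp => //.
  exact: measurable_signed_kernel_integral.
split.
  apply: eq_measurable_fun (mfine _ (measurable_re_part fp)) => x /[!inE] xo.
  by rewrite potentialE.
apply: eq_measurable_fun (mfine _ (measurable_im_part fp)) => x /[!inE] xo.
by rewrite potentialE.
Qed.

Let V x : \bar R := (modulus (potential alpha sigma f) x)%:E.

Let mV : measurable_fun setT V.
Proof.
apply/measurable_EFinP; apply/(measurable_restrictT _ (@measurable_orthant R d)).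
by apply: measurable_normc; have [] := measurable_potential.
Qed.

Let VU x : (V x <= 2%:E * kint (modulus f) x)%E.
Proof.
have Ux0 := U0 x; rewrite /V /modulus patchE; case: ifPn => [/[!inE] xo|_]; last first.
  by rewrite mule_ge0.
have [Ux|] := boolP (kint (modulus f) x \is a fin_num); last first.
  by rewrite ge0_fin_numE// -leNgt leye_eq => /eqP ->; rewrite gt0_muley ?lte_fin// leey.
rewrite -(fineK Ux) -EFinM lee_fin (le_trans (normc_leD _))//.
have bnd h : measurable_fun setT h -> (forall y, `|h y| <= modulus f y) ->
    `|fine (kint h x)| <= fine (kint (modulus f) x).
  move=> mh hm; have := @abse_kernel_integral _ _ _ leb K mK K0 (modulus f) h x mm mh hm.
  rewrite -{1}(fineK Ux); move: (fine (kint (modulus f) x)) (fine_ge0 Ux0) => c c0.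
  by case: (kint h x) => [s| |]//=; rewrite normr0.
rewrite potentialE//= (_ : 2 * _ = fine (kint (modulus f) x) + fine (kint (modulus f) x)); last by ring.
apply: lerD; apply: bnd.
- exact: measurable_re_part fp.
- exact: re_part_le.
- exact: measurable_im_part fp.
- exact: im_part_le.
Qed.

(** Stated for N strictly above the norm, since the representation by a density divides by N and the
    norm itself may be 0. *)
Lemma norm_potential_lt N : 0 < N -> (norm_Lp p f < N%:E)%E ->
  (norm_Lp q (potential alpha sigma f) <= (2 * (N * C))%:E)%E.
Proof.
move=> N0 fN; rewrite norm_LpE; have /andP[r0 _] := r01.
have V0 x : (0 <= V x)%E by rewrite lee_fin modulus_ge0.
apply: (dual_Lnorm mV V0 r0) => //; first by rewrite !mulr_ge0// ltW.
move=> H dH; have [mH H0 _] := dH.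
have mHr : measurable_fun setT (fun x => (H x `^ r)%:E).
  by apply/measurable_EFinP; apply: measurable_fun_powR.
apply: (@le_trans _ _ (2%:E * \int[leb]_x (kint (modulus f) x * (H x `^ r)%:E))%E); last first.
  by rewrite EFinM lee_wpmul2l ?lee_fin//; exact: modulus_dual.
rewrite -ge0_integralZl ?lee_fin//; last 2 first.
- exact: emeasurable_funM.
- by move=> x _; rewrite mule_ge0 ?lee_fin ?powR_ge0.
apply: ge0_le_integral => //.
- by move=> x _; rewrite mule_ge0// lee_fin powR_ge0.
- exact: emeasurable_funM.
- by apply: measurable_funeM; exact: emeasurable_funM.
- move=> x _; rewrite [leRHS]muleA; apply: lee_wpmul2r; last exact: VU.
  by rewrite lee_fin powR_ge0.
Qed.

Lemma norm_potential_le :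
  (norm_Lp q (potential alpha sigma f) <= (2 * C)%:E * norm_Lp p f)%E.
Proof.
have [_ _ foo] := fp; have f0 : (0 <= norm_Lp p f)%E by exact: Lnorm_ge0.
have ff : norm_Lp p f \is a fin_num by rewrite ge0_fin_numE.
rewrite -(fineK ff); set a := fine (norm_Lp p f); have a0 : 0 <= a by rewrite fine_ge0.
apply/lee_addgt0Pr => e e0; have D0 : 0 < 2 * C + 1 by rewrite ltr_wpDl// mulr_ge0.
(* The norm is exceeded by e / (2C + 1), which costs at most e after multiplication by 2C; the
   summand 1 keeps the divisor positive when C = 0. *)
have e1 : 0 < e / (2 * C + 1) by rewrite divr_gt0.
have aN : (norm_Lp p f < (a + e / (2 * C + 1))%:E)%E by rewrite -(fineK ff) lte_fin ltrDl.
have N0 : 0 < a + e / (2 * C + 1) by rewrite ltr_wpDl.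
apply: (le_trans (norm_potential_lt N0 aN)).
rewrite -EFinM -EFinD lee_fin (_ : 2 * _ = 2 * C * a + 2 * C * (e / (2 * C + 1))); last by ring.
rewrite lerD2l mulrCA ler_piMr ?(ltW e0)// ler_pdivrMr// mul1r; lra.
Qed.

Lemma in_Lp_potential : in_Lp q (potential alpha sigma f).
Proof.
have [mr mi] := measurable_potential; split => //.
have [N N0 fN] := norm_Lp_lt.
by rewrite (le_lt_trans (norm_potential_lt N0 fN))// ltry.
Qed.

Variable k : 'I_d -> nat.
Notation phik := (orthant_phi alpha k).
Let mphi := measurable_orthant_phi alpha k.

(** H = |phi_k| / M takes values in [0, 1], where u <= u^s. The same density is used with exponent r
    against the potential and with exponent 1 - P against f. *)
Lemma phi_density : exists2 M : R, 0 < M &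
  exists2 H, density leb H & forall s x, 0 <= s <= 1 -> `|phik x| <= M * H x `^ s.
Proof.
have [M M0 [bM iM]] := orthant_phi_estimates halpha k; exists M => //.
have Mi0 : 0 <= M^-1 by rewrite invr_ge0 ltW.
exists (fun x => M^-1 * `|phik x|).
  split.
  - by apply: measurable_funM => //; exact: measurableT_comp.
  - by move=> x; rewrite mulr_ge0.
  under eq_integral do rewrite EFinM.
  rewrite ge0_integralZl ?lee_fin//.
    apply: (@le_trans _ _ (M^-1%:E * M%:E)%E); first by rewrite lee_wpmul2l ?lee_fin.
    by rewrite -EFinM lee_fin mulVf// gt_eqF.
  by apply/measurable_EFinP; exact: measurableT_comp.
move=> s x /andP[s0 s1]; set u := M^-1 * `|phik x|.
have u0 : 0 <= u by rewrite mulr_ge0.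
have u1 : u <= 1 by rewrite /u mulrC ler_pdivrMr// mul1r.
have -> : `|phik x| = M * u by rewrite /u mulrA mulfV ?mul1r// gt_eqF.
rewrite ler_wpM2l ?(ltW M0)//.
have uE : u = u `^ s * u `^ (1 - s) by rewrite -ge0_powRD ?subr_ge0// addrC subrK powRr1.
rewrite {1}uE ler_piMr ?powR_ge0//.
have := @powR_le_base R (1 - s) u 1; rewrite subr_ge0 powR1; exact.
Qed.

(** Hölder's inequality in the language of densities: |h phi_k| <= N M F^P H^(1 - P) <= N M (F + H)
    almost everywhere. *)
Lemma integrable_mul_phi h : measurable_fun setT h -> (forall x, `|h x| <= modulus f x) ->
  leb.-integrable setT (fun x => (h x * phik x)%:E).
Proof.
move=> mh hm; have [M M0 [H dH HM]] := phi_density; have [N N0 fN] := norm_Lp_lt.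
rewrite norm_LpE in fN; have [F dF fF] := Lnorm_density p1 pP mm m0 N0 fN.
have [mF F0 F1] := dF; have [mH H0 H1] := dH.
have mhp : measurable_fun setT (fun x => (h x * phik x)%:E).
  by apply/measurable_EFinP; exact: measurable_funM.
have NM : 0 <= N * M by rewrite mulr_ge0// ltW.
apply/integrableP; split => //.
apply: (@le_lt_trans _ _ (\int[leb]_x ((N * M)%:E * ((F x)%:E + (H x)%:E)))%E).
  apply: ae_ge0_le_integral => //.
  - exact: measurableT_comp.
  - by move=> x _; rewrite mule_ge0 ?lee_fin// addr_ge0.
  - by apply: measurable_funeM; apply: emeasurable_funD; exact/measurable_EFinP.
  apply: filterS fF => x fx _; rewrite -EFinD -EFinM lee_fin normrM.
  have P1 : 0 <= 1 - P <= 1 by move: P01; lra.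
  apply: (@le_trans _ _ ((N * F x `^ P) * (M * H x `^ (1 - P)))).
    by rewrite ler_pM// ?HM// (le_trans (hm x)).
  rewrite (_ : _ * _ = N * M * (H x `^ (1 - P) * F x `^ P)); last by ring.
  rewrite ler_wpM2l// (le_trans (powR_amgm (H0 x) (F0 x) P01))// addrC lerD//.
    by rewrite ler_piMl//; case/andP: P01.
  by rewrite ler_piMl//; case/andP: P1.
rewrite ge0_integralZl ?lee_fin//; last 2 first.
- by apply: emeasurable_funD; exact/measurable_EFinP.
- by move=> x _; rewrite adde_ge0 ?lee_fin.
rewrite ge0_integralD//; [|by move=> x _; rewrite lee_fin|exact/measurable_EFinP|
  by move=> x _; rewrite lee_fin|exact/measurable_EFinP].
apply: (@le_lt_trans _ _ ((N * M)%:E * (1 + 1))%E); last by rewrite -EFinD -EFinM ltry.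
by rewrite lee_wpmul2l ?lee_fin// leeD.
Qed.

Notation l := (laguerre_eigenvalue alpha k).

Lemma has_integral_kint_phi h : measurable_fun setT h -> (forall x, `|h x| <= modulus f x) ->
  has_integral leb setT (fun x => fine (kint h x) * phik x)
    (l `^ (- sigma) * fine (\int[leb]_x (h x * phik x)%:E)%E).
Proof.
move=> mh hm; have [M M0 [H dH HM]] := phi_density; have [N N0 fN] := norm_Lp_lt.
have [mH H0 H1] := dH.
have mHr : measurable_fun setT (fun x => (H x `^ r)%:E).
  by apply/measurable_EFinP; apply: measurable_fun_powR.
have Uphi : (\int[leb]_x (kint (modulus f) x * `|phik x|%:E) < +oo)%E.
  apply: (@le_lt_trans _ _ (\int[leb]_x (M%:E * (kint (modulus f) x * (H x `^ r)%:E)))%E).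
    apply: ge0_le_integral => //.
    - by move=> x _; rewrite mule_ge0 ?lee_fin.
    - by apply: emeasurable_funM => //; apply/measurable_EFinP; exact: measurableT_comp.
    - by apply: measurable_funeM; exact: emeasurable_funM.
    - by move=> x _; rewrite muleCA lee_wpmul2l// -EFinM lee_fin HM.
  rewrite ge0_integralZl ?lee_fin ?(ltW M0)//; last 2 first.
  - exact: emeasurable_funM.
  - by move=> x _; rewrite mule_ge0 ?lee_fin ?powR_ge0.
  apply: (@le_lt_trans _ _ (M%:E * (N * C)%:E)%E); last by rewrite -EFinM ltry.
  by rewrite lee_wpmul2l ?lee_fin ?(ltW M0)//; exact: modulus_dual.
have Kphi y : leb.-integrable setT (fun x => K (x, y) * (phik x)%:E)%E.
  have [ik _] := integral_full_kernel_phi d_gt0 halpha hsigma k y.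
  by apply: (eq_integrable measurableT _ _ _ ik) => x _; rewrite full_kernel_sym.
have KE y : (\int[leb]_x (K (x, y) * (phik x)%:E) = (l `^ (- sigma) * phik y)%:E)%E.
  have [_ <-] := integral_full_kernel_phi d_gt0 halpha hsigma k y.
  by apply: eq_integral => x _; rewrite full_kernel_sym.
have := kernel_integral_pairing mK K0 mm mh mphi hm Uphi modulus_ae_fin Kphi KE.
congr has_integral; have ihp := integrable_mul_phi mh hm.
have E : (\int[leb]_y (h y * (l `^ (- sigma) * phik y))%:E =
    (l `^ (- sigma))%:E * \int[leb]_y (h y * phik y)%:E)%E.
  rewrite -integralZl//; apply: eq_integral => y _.
  by rewrite -EFinM mulrCA.
rewrite E fineM//; by apply: integrable_fin_num.
Qed.

Lemma has_integral_orthant (g : X -> R) (u : X -> R) (c : R) :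
  (forall x, orthant x -> g x = u x) -> (forall x, ~ orthant x -> u x = 0) ->
  has_integral leb setT u c -> has_integral leb ort g c.
Proof.
move=> gu u0 [u1 u2].
have E x : (((fun x => (g x)%:E) \_ ort) x = (u x)%:E)%E.
  rewrite patchE; case: ifPn => [|]; first by rewrite inE => xo; rewrite gu.
  by rewrite notin_setE => xo; rewrite u0.
split.
  apply: (@integrable_mkcond _ _ _ leb _ (fun x => (g x)%:E) (@measurable_orthant R d)).2.
  by apply: (eq_integrable measurableT _ _ _ u1) => x _; rewrite E.
by rewrite integral_mkcond -u2; apply: eq_integral => x _; rewrite E.
Qed.

Lemma orthant_phi0 x : ~ orthant x -> phik x = 0.
Proof. by move=> xo; rewrite /orthant_phi patchE memNset. Qed.

Lemma orthant_phiE x : orthant x -> phik x = phi alpha k x.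
Proof. by move=> xo; rewrite /orthant_phi patchE mem_set. Qed.

Lemma pairing_phi :
  [/\ pairing_dom (potential alpha sigma f) (phiC alpha k), pairing_dom f (phiC alpha k) &
      pairing (potential alpha sigma f) (phiC alpha k) =
        (l `^ (- sigma))%:C%C * pairing f (phiC alpha k)].
Proof.
have mre := measurable_re_part fp; have mim := measurable_im_part fp.
(* As phi_k is real, the pairing splits into the real and imaginary parts of f, each dominated by
   the modulus. *)
have fin h : leb.-integrable setT (fun x => (h x * phik x)%:E) ->
    has_integral leb setT (fun x => h x * phik x) (fine (\int[leb]_x (h x * phik x)%:E)%E).
  by move=> ih; split => //; rewrite fineK//; apply: integrable_fin_num.
have re1 := has_integral_kint_phi mre (re_part_le f).
have im1 := has_integral_kint_phi mim (im_part_le f).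
have re2 := fin _ (integrable_mul_phi mre (re_part_le f)).
have im2 := fin _ (integrable_mul_phi mim (im_part_le f)).
have z (s : R) (x : X) : ~ orthant x -> s * phik x = 0 by move=> xo; rewrite orthant_phi0// mulr0.
have [a1 a2] := has_integral_orthant (g := fun x => complex.Re (potential alpha sigma f x *
    Num.conj (phiC alpha k x)))
  (fun x xo => etrans (Re_mul_real _ _) (congr2 *%R (congr1 (@complex.Re R) (potentialE f xo))
    (esym (orthant_phiE xo)))) (fun x => z _ x) re1.
have [b1 b2] := has_integral_orthant (g := fun x => complex.Im (potential alpha sigma f x *
    Num.conj (phiC alpha k x)))
  (fun x xo => etrans (Im_mul_real _ _) (congr2 *%R (congr1 (@complex.Im R) (potentialE f xo))
    (esym (orthant_phiE xo)))) (fun x => z _ x) im1.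
have rE x : orthant x -> re_part f x = complex.Re (f x).
  by move=> xo; rewrite /re_part patchE mem_set.
have iE x : orthant x -> im_part f x = complex.Im (f x).
  by move=> xo; rewrite /im_part patchE mem_set.
have [c1 c2] := has_integral_orthant (g := fun x => complex.Re (f x * Num.conj (phiC alpha k x)))
  (fun x xo => etrans (Re_mul_real _ _) (congr2 *%R (esym (rE x xo)) (esym (orthant_phiE xo))))
  (fun x => z _ x) re2.
have [d1 d2] := has_integral_orthant (g := fun x => complex.Im (f x * Num.conj (phiC alpha k x)))
  (fun x xo => etrans (Im_mul_real _ _) (congr2 *%R (esym (iE x xo)) (esym (orthant_phiE xo))))
  (fun x => z _ x) im2.
split; [by split|by split|].
rewrite /pairing /Rintegral a2 b2 c2 d2 /=.
by apply/eqP; rewrite eq_complex /= !mul0r subr0 addr0 !eqxx.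
Qed.

End fixed_function.
End potential_bounds.

Local Open Scope complex_scope.

Theorem theorem3p1 (R : realType) (d : nat) (alpha : 'I_d -> R) (sigma : R)
    (p q : \bar R)
    (hd : (1 <= d)%N)
    (halpha : forall i, - (1 / 2) <= alpha i)
    (hsigma : 0 < sigma)
    (hp : (1 <= p)%E)
    (hq : (1 <= q)%E)
    (hpq :
      [\/ d%:R / 2 < sigma,
          [/\ sigma = d%:R / 2,
              (p, q) <> (+oo, 1)%E &
              (p, q) <> (1, +oo)%E] |
          [/\ sigma < d%:R / 2,
              (p^-1 - (2 * sigma / d%:R)%:E <= q^-1)%E,
              (q^-1 < p^-1 + (2 * sigma / d%:R)%:E)%E,
              (p, q) <> (1%E, (d%:R / (d%:R - 2 * sigma))%:E) &
              (p, q) <> ((d%:R / (2 * sigma))%:E, +oo%E)]]) :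
  (exists C : R, forall f : d.-tuple (measurableTypeR R) -> R[i],
    in_Lp p f ->
    [/\ potential_dom alpha sigma f,
        in_Lp q (potential alpha sigma f) &
        (norm_Lp q (potential alpha sigma f) <= C%:E * norm_Lp p f)%E]) /\
  ((p < +oo)%E ->
    forall (k : 'I_d -> nat) (f : d.-tuple (measurableTypeR R) -> R[i]),
    in_Lp p f ->
    [/\ pairing_dom (potential alpha sigma f) (phiC alpha k),
        pairing_dom f (phiC alpha k) &
        pairing (potential alpha sigma f) (phiC alpha k) =
          (laguerre_eigenvalue alpha k `^ (- sigma))%:C * pairing f (phiC alpha k)]).
Proof.
have [P [r [C [[pP P01] [qr r01] C0 KC]]]] := full_kernel_bound hd halpha hsigma hp hq hpq.
split; last by move=> _ k f fp; exact: (pairing_phi hd halpha hsigma hp pP P01 r01 KC fp k).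
(* The factor 2 comes from estimating the real and imaginary parts separately. *)
exists (2 * C) => f fp; split.
- exact: (potential_dom_Lp halpha hsigma hp pP KC fp).
- exact: (in_Lp_potential halpha hsigma hp hq pP qr r01 C0 KC fp).
- exact: (norm_potential_le halpha hsigma hp hq pP qr r01 C0 KC fp).
Qed.
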